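(* Let $N\ge 2$, let $\Omega\subset\mathbb{R}^N$ be a bounded domain with $C^{1,1}$-boundary, let $p>1$ and $s\in(0,1)$ be real numbers, and let $f:\Omega\times[0,\infty)\to\mathbb{R}$ be a Carathéodory function such that: (1) $f(\cdot,t)\in L^\infty(\Omega)$ for all $t\ge 0$; (2) there exists $c_0>0$ such that $f(x,t)\le c_0(1+t^{p-1})$ for a.e. $x\in\Omega$ and all $t\ge 0$; (3) for a.e. $x\in\Omega$ the map $t\mapsto f(x,t)/t^{p-1}$ is strictly decreasing in $(0,\infty)$. Consider the Dirichlet problem $$(-\Delta)_p^s u=f(x,u)\ \text{in }\Omega,\qquad u>0\ \text{in }\Omega,\qquad u=0\ \text{in }\mathbb{R}^N\setminus\Omega. \qquad (D)$$ Then: (i) problem (D) has at most one solution; (ii) problem (D) has a solution if and only if $\lambda_1(a_0)<0<\lambda_1(a_\infty)$. Here, for a.e. $x\in\Omega$, $a_0(x)=\lim_{t\to0^+}\frac{f(x,t)}{t^{p-1}}$ and $a_\infty(x)=\lim_{t\to\infty}\frac{f(x,t)}{t^{p-1}}$, and solutions and $\lambda_1(\cdot)$ are as defined in the context.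
   Context: For measurable $u:\mathbb{R}^N\to\mathbb{R}$ let $[u]_{s,p}=\Big(\iint_{\mathbb{R}^N\times\mathbb{R}^N}\frac{|u(x)-u(y)|^p}{|x-y|^{N+ps}}\,dx\,dy\Big)^{1/p}$. Set $W^{s,p}(\mathbb{R}^N)=\{u\in L^p(\mathbb{R}^N):[u]_{s,p}<\infty\}$ and $W^{s,p}_0(\Omega)=\{u\in W^{s,p}(\mathbb{R}^N): u=0 \text{ a.e. in }\mathbb{R}^N\setminus\Omega\}$, normed by $\|u\|=[u]_{s,p}$. $\|\cdot\|_p$ is the norm of $L^p(\Omega)$. With $j_p(t)=|t|^{p-2}t$ ($j_p(0)=0$), the fractional $p$-Laplacian is the operator $(-\Delta)_p^s$ from $W^{s,p}_0(\Omega)$ to its dual given by $$\langle(-\Delta)_p^su,\varphi\rangle=\iint_{\mathbb{R}^N\times\mathbb{R}^N}\frac{j_p(u(x)-u(y))(\varphi(x)-\varphi(y))}{|x-y|^{N+ps}}\,dx\,dy .$$ A (weak) solution of (D) is a function $u\in W^{s,p}_0(\Omega)$ with $u>0$ a.e. in $\Omega$ such that for all $\varphi\in W^{s,p}_0(\Omega)$ one has $\langle(-\Delta)_p^su,\varphi\rangle=\int_\Omega f(x,u)\varphi\,dx$ (in particular the right-hand integral is well defined and finite). The limits $a_0(x)$, $a_\infty(x)$ exist in $\mathbb{R}\cup\{\pm\infty\}$ by (3). There is $C>0$ with $a_0\ge -C$ and $a_\infty\le C$ in $\Omega$, while $a_0=+\infty$ and $a_\infty=-\infty$ may occur on sets of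 positive measure. For a measurable function $a$ on $\Omega$, possibly taking one of the values $\pm\infty$ (but not both), set $$\lambda_1(a)=\inf_{v\in W^{s,p}_0(\Omega)\setminus\{0\}}\frac{\|v\|^p-\int_{\{v\ne0\}}a(x)|v|^p\,dx}{\|v\|_p^p}\in\mathbb{R}\cup\{\pm\infty\}.$$ *)

(* Defs.v *)
From HB Require Import structures.
From mathcomp Require Import all_boot all_order all_algebra.
From mathcomp Require Import all_classical all_reals all_analysis.

Set Implicit Arguments.
Unset Strict Implicit.
Unset Printing Implicit Defensive.

Import Order.TTheory GRing.Theory Num.Theory.
Import numFieldNormedType.Exports.

Local Open Scope classical_set_scope.
Local Open Scope ring_scope.

(* R^n is 'rV[R]_n.  Its measurable sets are generated by the coordinate
   projections (product Borel sets), as the library does for n.-tuple. *)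
Definition measure_rV_display : measure_display -> measure_display.
Proof. exact. Qed.

Section measurable_rV.
Context {R : realType} (n : nat).

Let coors : 'I_n -> 'rV[R]_n -> measurableTypeR R := fun i x => x ord0 i.

Let rV_set0 : g_sigma_preimage coors set0.
Proof. exact: sigma_algebra0. Qed.

Let rV_setC A : g_sigma_preimage coors A -> g_sigma_preimage coors (~` A).
Proof. exact: sigma_algebraC. Qed.

Let rV_bigcup (F : _^nat) : (forall i, g_sigma_preimage coors (F i)) ->
  g_sigma_preimage coors (\bigcup_i (F i)).
Proof. exact: sigma_algebra_bigcup. Qed.

HB.instance Definition _ := @isMeasurable.Build
  (measure_rV_display (R.-ocitv.-measurable).-sigma)
  'rV[R]_n (g_sigma_preimage coors) rV_set0 rV_setC rV_bigcup.

Lemma measurable_coor (i : 'I_n) :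
  measurable_fun [set: 'rV[R]_n] (fun x : 'rV[R]_n => x ord0 i : measurableTypeR R).
Proof.
move=> _ Y mY; rewrite setTI; apply: sub_sigma_algebra.
rewrite -bigcup_seq; exists i => /=; first by rewrite mem_index_enum.
by exists Y => //; rewrite setTI.
Qed.

Lemma measurable_rVP d (T : measurableType d) (f : T -> 'rV[R]_n) :
  (forall i, measurable_fun [set: T] (fun x => f x ord0 i : measurableTypeR R)) ->
  measurable_fun [set: T] f.
Proof.
move=> mf; apply: (@measurability _ _ _ _ setT f
  (\big[setU/set0]_(i < n) preimage_set_system setT (coors i) measurable) erefl).
move=> _ [B + <-]; rewrite -bigcup_seq => -[i _ [A mA <-]].
by rewrite !setTI; have := mf i measurableT A mA; rewrite setTI.
Qed.

End measurable_rV.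

Section lebesgue_rV_step.
Context {R : realType} (n : nat).
Variable m : {sigma_finite_measure set 'rV[R]_n -> \bar R}.

Definition rV_cons (z : measurableTypeR R * 'rV[R]_n) : 'rV[R]_n.+1 :=
  row_mx (const_mx z.1 : 'rV[R]_1) z.2.

Definition rV_uncons (x : 'rV[R]_n.+1) : measurableTypeR R * 'rV[R]_n :=
  (x ord0 ord0, rsubmx (x : 'rV[R]_(1 + n))).

Lemma rV_uncons_consK : cancel rV_cons rV_uncons.
Proof.
move=> [a y]; rewrite /rV_cons /rV_uncons /= row_mxKr; congr pair.
rewrite (_ : ord0 = lshift n (ord0 : 'I_1)); last exact: val_inj.
exact: etrans (row_mxEl _ _ _ _) (mxE _ _ _ _).
Qed.

Lemma measurable_rV_cons : measurable_fun setT rV_cons.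
Proof.
apply: measurable_rVP => i; rewrite /rV_cons.
case: (split_ordP (i : 'I_(1 + n))) => j ->.
  rewrite (_ : (fun _ => _) = fst); first exact: measurable_fst.
  by apply/funext => z; exact: etrans (row_mxEl _ _ _ _) (mxE _ _ _ _).
rewrite (_ : (fun _ => _) =
    (fun z : measurableTypeR R * 'rV[R]_n => z.2 ord0 j)); last first.
  by apply/funext => z; exact: row_mxEr.
by apply: (measurableT_comp (@measurable_coor R n j)); exact: measurable_snd.
Qed.

Lemma measurable_rV_uncons : measurable_fun setT rV_uncons.
Proof.
apply/measurable_fun_pairP; split; first exact: measurable_coor.
apply: measurable_rVP => i.
under eq_fun do rewrite /= mxE.
exact: measurable_coor.
Qed.

Definition lebesgue_rV_step : set 'rV[R]_n.+1 -> \bar R :=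
  pushforward (@lebesgue_measure R \x m)%E rV_cons.

Let step0 : (lebesgue_rV_step set0 = 0)%E.
Proof. by rewrite /lebesgue_rV_step /pushforward preimage_set0 measure0. Qed.

Let step_ge0 A : (0 <= lebesgue_rV_step A)%E.
Proof. by rewrite /lebesgue_rV_step /pushforward measure_ge0. Qed.

Let step_sigma_additive : semi_sigma_additive lebesgue_rV_step.
Proof.
move=> F mF tF mUF; rewrite /lebesgue_rV_step /pushforward preimage_bigcup.
apply: measure_semi_sigma_additive.
- move=> k; rewrite -[X in measurable X]setTI.
  exact: measurable_rV_cons.
- apply/trivIsetP => /= i j _ _ ij; rewrite -preimage_setI.
  by move/trivIsetP : tF => /(_ _ _ _ _ ij) ->//; rewrite preimage_set0.
- rewrite -preimage_bigcup -[X in measurable X]setTI.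
  exact: measurable_rV_cons.
Qed.

HB.instance Definition _ := isMeasure.Build _ _ _ lebesgue_rV_step
  step0 step_ge0 step_sigma_additive.

Let step_sigma_finite : sigma_finite setT lebesgue_rV_step.
Proof.
have /sigma_finiteP[F [TF ndF Foo]] := sigma_finiteT (@lebesgue_measure R).
have /sigma_finiteP[G [TG ndG Goo]] := sigma_finiteT m.
exists (fun k => rV_uncons @^-1` (F k `*` G k)).
  apply/seteqP; split => // x _.
  have : (\bigcup_k F k) (rV_uncons x).1 by rewrite -TF.
  have : (\bigcup_k G k) (rV_uncons x).2 by rewrite -TG.
  move=> [k _ Gk] [j _ Fj]; exists (maxn j k) => //; split.
  - by move: Fj; exact/subsetPset/ndF/leq_maxl.
  - by move: Gk; exact/subsetPset/ndG/leq_maxr.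
move=> k; have [mF Fk] := Foo k; have [mG Gk] := Goo k; split.
  rewrite -[X in measurable X]setTI.
  by apply: measurable_rV_uncons => //; exact: measurableX.
rewrite /lebesgue_rV_step /pushforward -comp_preimage.
rewrite (_ : rV_uncons \o rV_cons = id) ?preimage_id; last first.
  by apply/funext => z /=; rewrite rV_uncons_consK.
by rewrite product_measure1E// lte_mul_pinfty// ge0_fin_numE.
Qed.

HB.instance Definition _ := Measure_isSigmaFinite.Build _ _ _ lebesgue_rV_step
  step_sigma_finite.

End lebesgue_rV_step.

(* Lebesgue measure on R^n: the n-fold product of lebesgue_measure,
   transported along R * R^n ~ R^n.+1. *)
Fixpoint lebesgue_rV {R : realType} (n : nat) :
    {sigma_finite_measure set 'rV[R]_n -> \bar R} :=
  match n with
  | 0 => \d_(0 : 'rV[R]_0)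
  | n'.+1 => lebesgue_rV_step (lebesgue_rV n')
  end.

Lemma lebesgue_rV_box {R : realType} (n : nat) (A : 'I_n -> set (measurableTypeR R)) :
  (forall i, measurable (A i)) ->
  lebesgue_rV n [set x : 'rV[R]_n | forall i, A i (x ord0 i)] =
    (\prod_(i < n) lebesgue_measure (A i))%E.
Proof.
elim: n A => [|n IHn] A mA.
  by rewrite big_ord0 /= diracE mem_set// => -[].
have -> : lebesgue_rV n.+1 = lebesgue_rV_step (lebesgue_rV n) :> (set _ -> _) by [].
rewrite /lebesgue_rV_step /pushforward.
pose B := [set y : 'rV[R]_n | forall i, A (lift ord0 i) (y ord0 i)].
have mB : measurable B.
  rewrite (_ : B = \bigcap_(i in [set: 'I_n])
    (fun y : 'rV[R]_n => y ord0 i : measurableTypeR R) @^-1` A (lift ord0 i)).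
    apply: fin_bigcap_measurable => // i _.
    rewrite -[X in measurable X]setTI.
    exact: (measurable_coor i measurableT (mA _)).
  by apply/seteqP; split => y /= h i; [move=> _|]; exact: h.
rewrite (_ : _ @^-1` _ = A ord0 `*` B).
  rewrite product_measure1E// big_ord_recl.
  by rewrite (IHn (fun i => A (lift ord0 i))).
have cons0 z : rV_cons z ord0 (ord0 : 'I_n.+1) = z.1.
  by rewrite -[in RHS](rV_uncons_consK z).
have consS z i : rV_cons z ord0 (lift ord0 i : 'I_n.+1) = z.2 ord0 i.
  rewrite -[in RHS](rV_uncons_consK z) /= [RHS]mxE.
  by congr (rV_cons z _ _); exact: ord_inj.
apply/seteqP; split => z /=.
  move=> h; split; first by rewrite -cons0; exact: h.
  by move=> i; rewrite -consS; exact: h.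
move=> [h0 hS] i; case: (unliftP ord0 i) => [j ->|->].
  by rewrite consS; exact: hS.
by rewrite cons0.
Qed.

Definition enorm {R : realType} {n : nat} (x : 'rV[R]_n) : R :=
  Num.sqrt (\sum_i x ord0 i ^+ 2).

Definition C11 {R : realType} {n : nat} (g : 'rV[R]_n -> R^o) : Prop :=
  (forall y, differentiable g y) /\
  forall v, exists k : R, k.-lipschitz ('D_v g).

(* Near each boundary point, and after an orthogonal change x *m Q of the
   coordinates, Omega is the region above the graph of a C^{1,1} function of
   all coordinates but the i-th. *)
Definition C11_boundary {R : realType} {N : nat} (Omega : set 'rV[R]_N) : Prop :=
  forall x0, (closure Omega `\` Omega°) x0 ->
  exists r : R, exists Q : 'M[R]_N, exists i : 'I_N,
  exists g : 'rV[R]_(N.-1) -> R^o,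
  [/\ 0 < r, Q *m Q^T = 1%:M, C11 g &
    forall x, enorm (x - x0) < r ->
      (Omega x <-> g (col' i (x *m Q)) < (x *m Q) ord0 i)].

Definition bounded_C11_domain {R : realType} {N : nat} (Omega : set 'rV[R]_N)
    : Prop :=
  [/\ Omega !=set0, open Omega, connected Omega, bounded_set Omega &
      C11_boundary Omega].

Section fractional_p_laplacian.
Context {R : realType} {N : nat}.
Implicit Types (Omega D : set 'rV[R]_N) (s p : R) (u v phi : 'rV[R]_N -> R)
  (a : 'rV[R]_N -> \bar R).

Local Notation mu := (@lebesgue_rV R N).

(* measurable_fun refers to Borel sets; g is Lebesgue measurable iff it agrees
   almost everywhere with a Borel function. *)
Definition Lebesgue_measurable D (g : 'rV[R]_N -> R) : Prop :=
  exists2 h : 'rV[R]_N -> measurableTypeR R, measurable_fun D h &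
    {ae mu, forall x, D x -> g x = h x}.

Definition Lebesgue_integrable D (g : 'rV[R]_N -> R) : Prop :=
  Lebesgue_measurable D g /\ (\int[mu]_(x in D) `|g x|%:E < +oo)%E.

(* The norm of L^q(D), for 0 < q <= +oo. *)
Definition Lp_norm D (q : \bar R) u : \bar R :=
  ('N[mu]_q[(EFin \o u) \_ D])%E.

Definition in_Lp D (q : \bar R) u : Prop :=
  Lebesgue_measurable D u /\ (Lp_norm D q u < +oo)%E.

Definition gagliardo_kernel s p (z : 'rV[R]_N * 'rV[R]_N) : R :=
  enorm (z.1 - z.2) `^ (N%:R + p * s).

Definition gagliardo s p u : \bar R :=
  ((\int[mu \x mu]_z (`|u z.1 - u z.2| `^ p / gagliardo_kernel s p z)%:E) `^ p^-1)%E.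

Definition in_W s p u : Prop :=
  in_Lp setT p%:E u /\ (gagliardo s p u < +oo)%E.

Definition in_W0 s p Omega u : Prop :=
  in_W s p u /\ {ae mu, forall x, ~ Omega x -> u x = 0}.

Definition jp p (t : R) : R := `|t| `^ (p - 2) * t.

Definition fracplap s p u phi : \bar R :=
  (\int[mu \x mu]_z
     (jp p (u z.1 - u z.2) * (phi z.1 - phi z.2) / gagliardo_kernel s p z)%:E)%E.

Definition Caratheodory Omega (f : 'rV[R]_N -> R -> R) : Prop :=
  (forall t, 0 <= t -> Lebesgue_measurable Omega (f ^~ t)) /\
  {ae mu, forall x, Omega x -> {within `[0, +oo[, continuous (f x)}}.

Definition weak_solution s p Omega (f : 'rV[R]_N -> R -> R) u : Prop :=
  [/\ in_W0 s p Omega u,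
      {ae mu, forall x, Omega x -> 0 < u x} &
      forall phi, in_W0 s p Omega phi ->
        Lebesgue_integrable Omega (fun x => f x (u x) * phi x) /\
        fracplap s p u phi =
          (\int[mu]_(x in Omega) (f x (u x) * phi x)%:E)%E].

Definition a_zero p (f : 'rV[R]_N -> R -> R) (x : 'rV[R]_N) : \bar R :=
  lim ((f x t / t `^ (p - 1))%:E @[t --> 0^'+]).

Definition a_infty p (f : 'rV[R]_N -> R -> R) (x : 'rV[R]_N) : \bar R :=
  lim ((f x t / t `^ (p - 1))%:E @[t --> +oo]).

Definition lambda1 s p Omega a : \bar R :=
  ereal_inf [set r : \bar R | exists v,
    [/\ in_W0 s p Omega v, ~ {ae mu, forall x, v x = 0} &
     r = ((gagliardo s p v `^ p -
          \int[mu]_(x in Omega `&` [set x | v x <> 0%R])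
            (a x * (`|v x| `^ p)%:E))
         / Lp_norm Omega p%:E v `^ p)%E]].

End fractional_p_laplacian.

(* Main.v *)
(* The argument of Brezis and Oswald, arranged so that no regularity theory
   (boundedness, continuity, Hopf lemma) of solutions is needed.  It rests on
   the discrete Picone inequality
     j_p(a - b) (c^p / a^(p-1) - d^p / b^(p-1)) <= |c - d|^p.
   Uniqueness: testing the equation of u with (min(v,M) + e)^p / (u + e)^(p-1) - e
   and letting e -> 0 bounds the integral of f(x,u)/u^(p-1) min(v,M)^p by the
   energy of min(v,M); adding the symmetric inequality and letting M -> oo, the
   strict monotonicity of f(x,t)/t^(p-1) forces u = v.
   Necessity: testing with u gives lambda_1(a_0) < 0, and the same Picone bound
   together with compactness gives lambda_1(a_oo) > 0.
   Existence: the action energy(u)/p - \int F(x,u) is coercive because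
   lambda_1(a_oo) > 0 (compactness passes this to the bounded weights
   f(x,n)/n^(p-1) for large n) and negative somewhere because lambda_1(a_0) < 0.
   A minimiser u >= 0 satisfies the Euler-Lagrange equation first for bounded
   test functions vanishing where u is large, then by cutoff for all of them.
   It is positive by nonlocality: if u vanished on a set of positive measure, the
   test functions (1 - u/e)^+ psi would give a strict sign to the interaction
   between {u = 0} and {u > 0}.
   The embedding into L^p is compact since on a small cube a function of bounded
   energy is close in L^p to its value at a well-chosen point of the cube.
   Data that are only Lebesgue measurable are replaced by Borel ones; on the
   exceptional null set f becomes the constant c0, which satisfies (2) and (3). *)

Require Import Defs.
From mathcomp Require Import all_boot all_order all_algebra.
From mathcomp Require Import all_classical all_reals all_analysis.
From mathcomp Require Import measurable_realfun ring lra.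
Set Implicit Arguments.
Unset Strict Implicit.
Unset Printing Implicit Defensive.
Import Order.TTheory GRing.Theory Num.Theory.
Import numFieldNormedType.Exports.
Local Open Scope classical_set_scope.
Local Open Scope ring_scope.

(** * Power inequalities *)

(** There is no lower growth bound on [f]: [f(x,t)] may tend to -oo arbitrarily fast in t. So the
    integral of the primitive may be -oo, integrability of [f(x,u) phi] has to be proved, and limits
    in reaction terms are taken by Fatou, with control from one side only. On bounded ranges the
    monotone quotient makes up for this: on (0,n] it is at least its value at n, which (1) bounds
    below; letting t tend to 0 then gives [f(x,0) >= 0]. Weights may be infinite, so each weighted
    integral is shifted to a nonnegative integrand: by 2 c0 for a_oo, as [f(x,1) <= 2 c0] bounds the
    quotient for t >= 1, and by a lower bound of the quotient on (0,1] for a_0. The variational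
    argument runs over a sigma-finite measure space with a measurable nonnegative kernel, for
    functions vanishing at every point off the domain. The Gagliardo kernel contributes three facts:
    it is positive off the diagonal, it is large on small cubes (compactness), and some bounded
    function positive exactly on Omega has finite energy (the capped distance to the complement). *)

Section real_inequalities.
Context {R : realType}.
Implicit Types (p a b c d t : R).

Lemma ler_wpowR p a b : 0 <= p -> 0 <= a -> a <= b -> a `^ p <= b `^ p.
Proof.
move=> p0 a0 ab; apply: ge0_ler_powR => //; rewrite nnegrE //.
exact: le_trans ab.
Qed.

Lemma ltr_wpowR p a b : 0 < p -> 0 <= a -> a < b -> a `^ p < b `^ p.
Proof.
move=> p0 a0 ab; apply: gt0_ltr_powR => //; rewrite nnegrE //.
exact: ltW (le_lt_trans a0 ab).
Qed.

Lemma powRV p a : 0 <= a -> a^-1 `^ p = (a `^ p)^-1.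
Proof. by move=> a0; rewrite -powR_inv1// powRAC powR_inv1// powR_ge0. Qed.

Lemma ge0_jp p t : 1 < p -> 0 <= t -> jp p t = t `^ (p - 1).
Proof.
move=> p1 t0; rewrite /jp ger0_norm// mulrC -(@mulr_powRB1 _ t (p - 1))//.
  by congr (_ * _ `^ _); ring.
by rewrite subr_gt0.
Qed.

Lemma jpN p t : jp p (- t) = - jp p t.
Proof. by rewrite /jp normrN mulrN. Qed.

Lemma le0_jp p t : 1 < p -> t <= 0 -> jp p t = - (- t) `^ (p - 1).
Proof. by move=> p1 t0; rewrite -[t in LHS]opprK jpN ge0_jp ?oppr_ge0. Qed.

Lemma normr_jp p t : 1 < p -> `|jp p t| = `|t| `^ (p - 1).
Proof.
move=> p1; have [t0|/ltW t0] := leP 0 t.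
  by rewrite ge0_jp// ger0_norm ?powR_ge0// ger0_norm.
by rewrite le0_jp// normrN ger0_norm ?powR_ge0// ler0_norm.
Qed.

Lemma jp_mul p t : 1 < p -> jp p t * t = `|t| `^ p.
Proof.
move=> p1; have p0 : 0 < p by lra.
have [t0|/ltW t0] := leP 0 t.
  by rewrite ge0_jp// mulrC mulr_powRB1// ger0_norm.
by rewrite le0_jp// mulNr -mulrN mulrC mulr_powRB1 ?oppr_ge0// ler0_norm.
Qed.

(** Young's inequality with conjugate exponents p/(p-1) and p, multiplied by p to clear
    denominators. *)
Lemma powR_young p a b : 1 < p -> 0 <= a -> 0 <= b ->
  p * (a `^ (p - 1) * b) <= (p - 1) * a `^ p + b `^ p.
Proof.
move=> p1 a0 b0; have p0 : 0 < p by lra.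
have pm : 0 < p - 1 by lra.
have := @conjugate_powR _ (a `^ (p - 1)) b (p / (p - 1)) p (powR_ge0 _ _) b0
  (divr_gt0 p0 pm) p0.
have -> : (p / (p - 1))^-1 + p^-1 = 1 by field; lra.
move=> /(_ erefl); rewrite -powRrM (_ : (p - 1) * (p / (p - 1)) = p); last by field; lra.
rewrite -(ler_pM2l p0) => /le_trans; apply.
by rewrite le_eqVlt; apply/orP; left; apply/eqP; field; lra.
Qed.

Lemma jp_young p a b : 1 < p -> p * (jp p a * b) <= (p - 1) * `|a| `^ p + `|b| `^ p.
Proof.
move=> p1; apply: le_trans (powR_young p1 (normr_ge0 a) (normr_ge0 b)).
rewrite ler_pM2l; last by lra.
by rewrite -normr_jp// -normrM ler_norm.
Qed.

(** |t|^p lies above its tangent at [a]. The bound follows from Young's inequality and [jp_mul], so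
    nothing is differentiated. *)
Lemma jp_convex p a b : 1 < p -> `|a| `^ p + p * (jp p a * (b - a)) <= `|b| `^ p.
Proof.
move=> p1; have := jp_young a b p1; have := jp_mul a p1.
by rewrite mulrBr => ->; lra.
Qed.

Lemma normr_jpM p a b : 1 < p -> `|jp p a * b| <= `|a| `^ p + `|b| `^ p.
Proof.
move=> p1; rewrite normrM normr_jp//.
have := powR_young p1 (normr_ge0 a) (normr_ge0 b).
have := powR_ge0 `|b| p; have := powR_ge0 `|a| p => a0 b0.
set x := _ * _ => h; rewrite -(@ler_pM2l _ p); last lra.
by apply: (le_trans h); nra.
Qed.

Lemma powR_normD p a b : 0 <= p ->
  `|a + b| `^ p <= 2 `^ p * (`|a| `^ p + `|b| `^ p).
Proof.
move=> p0; wlog ab : a b / `|a| <= `|b|.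
  move=> h; have [/h//|/ltW/h] := leP `|a| `|b|.
  by rewrite (addrC b) (addrC (_ `^ _)).
apply: (@le_trans _ _ ((2 * `|b|) `^ p)).
  apply: ler_wpowR => //; apply: (le_trans (ler_normD _ _)); lra.
rewrite powRM// ler_wpM2l ?powR_ge0// lerDr powR_ge0//.
Qed.

(** Convexity at a + b = (1-t) (a/(1-t)) + t (b/t): the tangent inequalities based at a + b are
    averaged and their linear terms cancel. The exponent 1 - p appears when the weights are pulled
    out of the powers. *)
Lemma powR_convex2 p a b t : 1 < p -> 0 <= a -> 0 <= b -> 0 < t < 1 ->
  (a + b) `^ p <= (1 - t) `^ (1 - p) * a `^ p + t `^ (1 - p) * b `^ p.
Proof.
move=> p1 a0 b0 /andP[t0 t1]; have t1' : 0 < 1 - t by lra.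
have key x y : 0 <= x -> 0 <= y -> x `^ p + p * (x `^ (p - 1) * (y - x)) <= y `^ p.
  by move=> x0 y0; have := jp_convex x y p1; rewrite ge0_jp// !ger0_norm.
have := key (a + b) (a / (1 - t)) (addr_ge0 a0 b0) (divr_ge0 a0 (ltW t1')).
have := key (a + b) (b / t) (addr_ge0 a0 b0) (divr_ge0 b0 (ltW t0)).
have e x y : 0 <= x -> 0 < y -> y `^ (1 - p) * x `^ p = y * (x / y) `^ p.
  move=> x0 y0; rewrite powRM ?invr_ge0// ?(ltW y0)//.
  rewrite powRD ?(gt_eqF y0) ?implybT// powRr1 ?(ltW y0)//.
  by rewrite powRV ?(ltW y0)// powRN; ring.
rewrite !e//; set X := (b / t) `^ p; set Y := (a / _) `^ p; set S := (a + b) `^ (p - 1).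
move=> h1 h2.
have {}h1 := ler_wpM2l (ltW t0) h1; have {}h2 := ler_wpM2l (ltW t1') h2.
apply: le_trans (lerD h2 h1); rewrite le_eqVlt; apply/orP; left; apply/eqP.
by field; lra.
Qed.

(** For c <= d the left side is nonpositive. Otherwise c = (c-d) + d is split by [powR_convex2] with
    t = b/a; the coefficients become a^(p-1)/(a-b)^(p-1) and a^(p-1)/b^(p-1), and multiplying by
    (a-b)^(p-1)/a^(p-1) gives the claim. *)
Lemma picone_ge p a b c d : 1 < p -> 0 < b -> b <= a -> 0 <= c -> 0 <= d ->
  (a - b) `^ (p - 1) * (c `^ p / a `^ (p - 1) - d `^ p / b `^ (p - 1))
    <= `|c - d| `^ p.
Proof.
move=> p1 b0 ba c0 d0; have a0 : 0 < a by lra.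
have [cd|dc] := leP c d.
  apply: (@le_trans _ _ 0); last exact: powR_ge0.
  apply: mulr_ge0_le0; first exact: powR_ge0.
  rewrite subr_le0 ler_pM ?powR_ge0 ?invr_ge0 ?powR_ge0//.
    by apply: ler_wpowR => //; lra.
  rewrite lef_pV2 ?posrE ?powR_gt0//; apply: ler_wpowR; lra.
(* The weight t = b/a must be below 1, so equality is treated apart; there the factor (a-b)^(p-1) is
   0. *)
have [eab|nab] := eqVneq a b.
  rewrite eab subrr powR0 ?mul0r ?powR_ge0//; lra.
have ab : b < a by rewrite lt_neqAle eq_sym nab.
have t01 : 0 < b / a < 1 by rewrite divr_gt0//= ltr_pdivrMr// mul1r.
have cd0 : 0 <= c - d by lra.
have := powR_convex2 p1 cd0 d0 t01; rewrite subrK => h.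
rewrite ger0_norm//; set e := (a - b) `^ (p - 1).
have e0 : 0 < e by rewrite powR_gt0//; lra.
have A0 : 0 < a `^ (p - 1) by rewrite powR_gt0.
have B0 : 0 < b `^ (p - 1) by rewrite powR_gt0.
have E1 : (1 - b / a) `^ (1 - p) = a `^ (p - 1) / e.
  rewrite (_ : 1 - p = - (p - 1)); last ring.
  rewrite powRN (_ : 1 - b / a = (a - b) * a^-1); last by field; lra.
  rewrite powRM ?invr_ge0//; [|lra|lra].
  by rewrite powRV ?(ltW a0)// invfM invrK mulrC.
have E2 : (b / a) `^ (1 - p) = a `^ (p - 1) / b `^ (p - 1).
  rewrite (_ : 1 - p = - (p - 1)); last ring.
  rewrite powRN powRM ?invr_ge0//; [|lra|lra].
  by rewrite powRV ?(ltW a0)// invfM invrK mulrC.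
rewrite E1 E2 in h.
have {}h := ler_wpM2l (ltW (divr_gt0 e0 A0)) h.
rewrite -(lerD2r (e / b `^ (p - 1) * d `^ p)).
move: h; set X := c `^ p; set Y := d `^ p; set Z := (c - d) `^ p; move=> h.
have h1 : e / a `^ (p - 1) * (a `^ (p - 1) / e * Z + a `^ (p - 1) / b `^ (p - 1) * Y)
  = Z + e / b `^ (p - 1) * Y by field; lra.
rewrite h1 in h; apply: le_trans h.
rewrite le_eqVlt; apply/orP; left; apply/eqP; field; lra.
Qed.

Lemma picone p a b c d : 1 < p -> 0 < a -> 0 < b -> 0 <= c -> 0 <= d ->
  jp p (a - b) * (c `^ p / a `^ (p - 1) - d `^ p / b `^ (p - 1)) <= `|c - d| `^ p.
Proof.
move=> p1 a0 b0 c0 d0; have [ba|ab] := leP b a.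
  by rewrite ge0_jp ?subr_ge0//; exact: picone_ge.
rewrite le0_jp ?subr_le0 ?(ltW ab)// opprB mulNr -mulrN opprB distrC.
by apply: picone_ge => //; exact: ltW.
Qed.

End real_inequalities.

(** * Continuity and Lipschitz bounds for powers *)

Section continuity.
Context {R : realType}.
Implicit Types (p q a b c d t : R).

Lemma continuous_normr_powR q : 0 < q -> continuous (fun t => `|t| `^ q).
Proof.
(* For q < 1 the power is not differentiable at 0; continuity there is checked directly with radius
   e^(1/q). *)
move=> q0 t; have [->|t0] := eqVneq t 0.
  apply/cvgrPdist_lt => e e0.
  have e0' : 0 < e `^ q^-1 by rewrite powR_gt0.
  rewrite normr0 powR0 ?gt_eqF//.
  have : \forall x \near (0 : R), `|x| < e `^ q^-1 by exact: nbhs0_lt.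
  apply: filterS => x; rewrite sub0r normrN (ger0_norm (powR_ge0 _ _)) => h.
  rewrite -[e]powRr1 ?ltW// -(@mulVf _ q) ?gt_eqF// powRrM.
  exact: ltr_wpowR.
apply: (@continuous_comp _ _ _ (fun x : R => `|x|) (fun x => x `^ q)).
  exact: norm_continuous.
apply: (@differentiable_continuous R R^o R^o); apply/derivable1_diffP.
by apply: (@derivable_powR R 1 q); rewrite in_itv/= andbT normr_gt0.
Qed.

Lemma cvg_normr_powR q (u : nat -> R) t : 0 < q -> u @ \oo --> t ->
  (fun n => `|u n| `^ q) @ \oo --> `|t| `^ q.
Proof.
move=> q0 ut; apply: (@continuous_cvg _ _ _ _ _ u (fun t => `|t| `^ q) t); last exact: ut.
exact: continuous_normr_powR.
Qed.

Lemma continuous_powR_ge0 q : 0 < q -> continuous (fun t => (Num.max 0 t) `^ q).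
Proof.
move=> q0 t; rewrite (_ : (fun _ => _) = (fun t => `|t| `^ q) \o Num.max 0); last first.
  by apply/funext => x /=; rewrite ger0_norm// le_max lexx.
apply: continuous_comp; last exact: continuous_normr_powR.
by apply: continuous_max; [exact: cvg_cst|exact: cvg_id].
Qed.

Lemma cvg_powR q (u : nat -> R) t : 0 < q -> (forall n, 0 <= u n) -> u @ \oo --> t ->
  (fun n => u n `^ q) @ \oo --> t `^ q.
Proof.
move=> q0 u0 ut.
have t0 : 0 <= t.
  by rewrite -(cvg_lim (@Rhausdorff R) ut); apply: limr_ge; [exact: cvgP ut|exact: nearW].
have := cvg_normr_powR q0 ut; rewrite (ger0_norm t0).
by rewrite (_ : (fun n => _) = (fun n => u n `^ q))//; apply/funext => n; rewrite ger0_norm.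
Qed.

(** For p < 2 the factor |t|^(p-2) is singular at 0. Writing [jp] as the difference of the (p-1)-th
    powers of the positive and negative parts removes the singularity. *)
Lemma continuous_jp p : 1 < p -> continuous (jp p : R -> R).
Proof.
move=> p1; have p0 : 0 < p - 1 by lra.
rewrite (_ : jp p = (fun t => (Num.max 0 t) `^ (p - 1) - (Num.max 0 (- t)) `^ (p - 1))).
  move=> t; apply: (@cvgB _ _ _ _ _ (fun t => (Num.max 0 t) `^ (p - 1))
    (fun t => (Num.max 0 (- t)) `^ (p - 1))); first exact: continuous_powR_ge0.
  apply: (@continuous_comp _ _ _ -%R (fun t => (Num.max 0 t) `^ (p - 1))).
    exact: opp_continuous.
  exact: continuous_powR_ge0.
apply/funext => t; have [t0|/ltW t0] := leP 0 t.
  by rewrite ge0_jp// (@max_l _ _ 0 (- t)) ?oppr_le0// powR0 ?subr0// gt_eqF.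
by rewrite le0_jp// (@max_r _ _ 0 (- t)) ?oppr_ge0// powR0 ?sub0r// gt_eqF.
Qed.

Lemma cvg_jp p (u : nat -> R) t : 1 < p -> u @ \oo --> t ->
  (fun n => jp p (u n)) @ \oo --> jp p t.
Proof.
move=> p1 ut; apply: (@continuous_cvg _ _ _ _ _ u (jp p) t); last exact: ut.
exact: continuous_jp.
Qed.

(** By convexity the slope at the larger point bounds the secant. *)
Lemma powR_lipschitz p M a b : 1 < p -> 0 <= a <= M -> 0 <= b <= M ->
  `|a `^ p - b `^ p| <= p * M `^ (p - 1) * `|a - b|.
Proof.
move=> p1; wlog ba : a b / b <= a.
  move=> h ha hb; have [ba|/ltW ab] := leP b a; first exact: h.
  by rewrite distrC (distrC a); exact: h.
move=> /andP[a0 aM] /andP[b0 bM].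
have h1 : b `^ p <= a `^ p by apply: ler_wpowR => //; lra.
rewrite !ger0_norm ?subr_ge0//.
have := jp_convex a b p1; rewrite ge0_jp// !ger0_norm// => h.
have hM : a `^ (p - 1) <= M `^ (p - 1) by apply: ler_wpowR => //; lra.
apply: (@le_trans _ _ (p * (a `^ (p - 1) * (a - b)))).
  by rewrite -(opprB b a) !mulrN; lra.
rewrite -mulrA ler_wpM2l//; first lra.
by rewrite ler_wpM2r// subr_ge0.
Qed.

(** As p - 1 may be below 1, the inverse power is rewritten as x/x^p and [powR_lipschitz] is applied
    to the p-th powers. In the constant, the 1 comes from the numerator and the p from the
    denominator. *)
Lemma powR_pred_lipschitz p e a b : 1 < p -> 0 < e -> e <= a -> e <= b ->
  `|(a `^ (p - 1))^-1 - (b `^ (p - 1))^-1| <= (p + 1) / e `^ p * `|a - b|.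
Proof.
move=> p1 e0; wlog ba : a b / b <= a.
  move=> h ha hb; have [ba|/ltW ab] := leP b a; first exact: h.
  by rewrite distrC (distrC a); exact: h.
move=> ea eb; have a0 : 0 < a by lra.
have b0 : 0 < b by lra.
have p0 : 0 < p by lra.
have E x : 0 < x -> (x `^ (p - 1))^-1 = x / x `^ p.
  move=> x0; rewrite -(@mulr_powRB1 _ x p) ?(ltW x0)// invfM mulrA divff ?mul1r ?gt_eqF//.
have Ea : 0 < a `^ p by rewrite powR_gt0.
have Eb : 0 < b `^ p by rewrite powR_gt0.
have Ee : 0 < e `^ p by rewrite powR_gt0.
have eEa : e `^ p <= a `^ p by apply: ler_wpowR; lra.
have eEb : e `^ p <= b `^ p by apply: ler_wpowR; lra.
rewrite !E// (_ : a / a `^ p - b / b `^ p =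
  (a - b) / a `^ p - b / b `^ p * ((a `^ p - b `^ p) / a `^ p)); last by field; lra.
apply: (le_trans (ler_normB _ _)).
rewrite (_ : (p + 1) / e `^ p * `|a - b| = `|a - b| / e `^ p + p / e `^ p * `|a - b|); last ring.
apply: lerD.
  rewrite normrM ler_wpM2l// normfV ger0_norm ?powR_ge0// lef_pV2//.
have hL := @powR_lipschitz p a a b p1.
have {}hL : `|a `^ p - b `^ p| <= p * a `^ (p - 1) * `|a - b| by apply: hL; lra.
rewrite -(E _ b0) !normrM !normfV !(ger0_norm (powR_ge0 _ _)).
apply: (@le_trans _ _ ((b `^ (p - 1))^-1 * ((p * a `^ (p - 1) * `|a - b|) / a `^ p))).
  by rewrite ler_wpM2l ?invr_ge0 ?powR_ge0// ler_wpM2r ?invr_ge0 ?powR_ge0.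
rewrite -!mulrA (mulrCA _ p) ler_wpM2l; [|lra|] => //.
rewrite mulrCA [X in _ <= X]mulrC [X in _ <= X]mulrC.
rewrite -(@mulr_powRB1 _ a p) ?(ltW a0)// -(@mulr_powRB1 _ e p) ?(ltW e0)//.
have A1 : 0 < a `^ (p - 1) by rewrite powR_gt0.
have B1 : 0 < b `^ (p - 1) by rewrite powR_gt0.
have E1 : 0 < e `^ (p - 1) by rewrite powR_gt0.
rewrite (_ : a `^ (p - 1) * _ = `|a - b| * (a * b `^ (p - 1))^-1); last by field; lra.
rewrite [leLHS]mulrC ler_wpM2r// lef_pV2 ?posrE ?mulr_gt0//.
by apply: ler_pM; [lra|exact: ltW|lra|apply: ler_wpowR; lra].
Qed.

End continuity.

(** * Integration *)

Section real_integrals.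
Context d (T : measurableType d) (R : realType).
Variable m : {measure set T -> \bar R}.
Local Notation intg f := (m.-integrable setT (EFin \o (f : T -> R))).
Implicit Types f g : T -> R.

Lemma EFin_Rintegral f : intg f -> (\int[m]_x (f x)%:E)%E = (\int[m]_x f x)%:E.
Proof. by move=> mf; rewrite /Rintegral fineK//; exact: integrable_fin_num. Qed.

Lemma integrable_measurable f : intg f -> measurable_fun setT f.
Proof. by move=> /integrableP[/measurable_EFinP]. Qed.

Lemma integrable_le f g : measurable_fun setT f -> (forall x, `|f x| <= g x) ->
  intg g -> intg f.
Proof.
move=> mf fg; apply: le_integrable => //; first exact/measurable_EFinP.
by move=> x _ /=; rewrite lee_fin (le_trans (fg x))// ler_norm.
Qed.

Lemma integrable_addR f g : intg f -> intg g -> intg (fun x => f x + g x).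
Proof. by move=> mf mg; exact: (integrableD measurableT mf mg). Qed.

Lemma integrable_oppR f : intg f -> intg (fun x => - f x).
Proof. by move=> mf; exact: (integrableN mf). Qed.

Lemma integrable_subR f g : intg f -> intg g -> intg (fun x => f x - g x).
Proof. by move=> mf mg; exact: (integrableB measurableT mf mg). Qed.

Lemma integrable_mulRl c f : intg f -> intg (fun x => c * f x).
Proof. by move=> mf; exact: (integrableZl measurableT c mf). Qed.

Lemma integrable_eqR f g : (forall x, f x = g x) -> intg f -> intg g.
Proof. by move=> /funext ->. Qed.

Lemma integrable_normR f : intg f -> intg (fun x => `|f x|).
Proof. exact: integrable_norm. Qed.

Lemma ge0_integrable_lt f : measurable_fun setT f -> (forall x, 0 <= f x) ->
  (\int[m]_x (f x)%:E < +oo)%E -> intg f.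
Proof.
move=> mf f0 foo; apply/integrableP; split; first exact/measurable_EFinP.
by under eq_integral => x _ do rewrite /= ger0_norm//.
Qed.

Lemma ler_Rintegral f g : intg f -> intg g -> (forall x, f x <= g x) ->
  \int[m]_x f x <= \int[m]_x g x.
Proof. by move=> mf mg fg; apply: le_Rintegral => // x _; exact: fg. Qed.

Lemma RintegralDT f g : intg f -> intg g ->
  \int[m]_x (f x + g x) = \int[m]_x f x + \int[m]_x g x.
Proof. exact: RintegralD. Qed.

Lemma RintegralBT f g : intg f -> intg g ->
  \int[m]_x (f x - g x) = \int[m]_x f x - \int[m]_x g x.
Proof. exact: RintegralB. Qed.

Lemma RintegralZT c f : intg f -> \int[m]_x (c * f x) = c * \int[m]_x f x.
Proof. exact: RintegralZl. Qed.

Lemma RintegralNT f : intg f -> \int[m]_x (- f x) = - \int[m]_x f x.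
Proof.
move=> mf; rewrite -mulN1r -RintegralZT//.
by apply: eq_Rintegral => x _; rewrite mulN1r.
Qed.

Lemma Rintegral_ge0T f : (forall x, 0 <= f x) -> 0 <= \int[m]_x f x.
Proof. by move=> f0; apply: Rintegral_ge0. Qed.

Lemma dominated_cvgR (X : nat -> T -> R) (Y G : T -> R) :
  (forall n, measurable_fun setT (X n)) -> measurable_fun setT Y -> intg G ->
  {ae m, forall x, forall n, `|X n x| <= G x} ->
  {ae m, forall x, X^~ x @ \oo --> Y x} ->
  intg Y /\ \int[m]_x X n x @[n --> \oo] --> \int[m]_x Y x.
Proof.
move=> mX mY iG XG XY.
have mXE n : measurable_fun setT (EFin \o X n) by exact/measurable_EFinP.
have mYE : measurable_fun setT (EFin \o Y) by exact/measurable_EFinP.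
have XYE : {ae m, forall x, setT x -> (EFin \o X n) x @[n --> \oo] --> (EFin \o Y) x}.
  by apply: filterS XY => x h _; apply/cvg_EFin => //; exact: nearW.
have XGE : {ae m, forall x n, setT x -> (`|(EFin \o X n) x| <= (EFin \o G) x)%E}.
  by apply: filterS XG => x h n _; rewrite /= lee_fin.
have [iY _ cY] := dominated_convergence measurableT mXE mYE XYE iG XGE.
split=> //; by move: cY; rewrite (EFin_Rintegral iY) => /fine_cvgP[].
Qed.

(** Fatou's lemma for [X n + G], with the integrals controlled from above. Integrability of the
    limit is part of the conclusion: this is how reaction terms without an integrable majorant are
    shown to be integrable. *)
Lemma real_fatou (X : nat -> T -> R) (Y G : T -> R) (c : nat -> R) (l : R) :
  (forall n, intg (X n)) -> measurable_fun setT Y -> intg G ->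
  (forall n x, - G x <= X n x) ->
  {ae m, forall x, X^~ x @ \oo --> Y x} ->
  (forall n, \int[m]_x X n x <= c n) -> c @ \oo --> l ->
  intg Y /\ \int[m]_x Y x <= l.
Proof.
move=> iX mY iG GX XY Xc cl.
have mG := integrable_measurable iG.
pose Z n x := (X n x + G x)%:E; pose W x := (Y x + G x)%:E.
have iZ n : intg (fun x => X n x + G x) by apply: integrable_addR.
have mZ n : measurable_fun setT (Z n) by apply/measurable_EFinP/integrable_measurable.
have Z0 n x : setT x -> (0 <= Z n x)%E by move=> _; rewrite lee_fin -lerBlDr sub0r.
have mW : measurable_fun setT W by apply/measurable_EFinP/measurable_funD.
have ZW : {ae m, forall x, setT x -> limn_einf (Z ^~ x) = W x}.
  apply: filterS XY => x h _; have : (Z ^~ x) @ \oo --> W x.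
    by apply/cvg_EFin; [exact: nearW|apply: cvgD h _; exact: cvg_cst].
  by move=> /cvg_limn_einf_sup[].
have mL : measurable_fun setT (fun x => limn_einf (Z ^~ x)).
  rewrite (_ : (fun _ => _) = (fun x => - limn_esup (fun n => - Z n x))%E); last first.
    apply/funext => x; rewrite -limn_einfN; congr limn_einf.
    by apply/funext => n; rewrite /comp oppeK.
  apply: measurableT_comp => //; apply: measurable_fun_limn_esup => n.
  by apply: measurableT_comp => //.
have := fatou m measurableT mZ Z0.
rewrite (ae_eq_integral _ _ measurableT mL mW ZW).
have cZ : (fun n => \int[m]_x Z n x)%E = (fun n => (\int[m]_x X n x + \int[m]_x G x)%:E).
  by apply/funext => n; rewrite /Z (EFin_Rintegral (iZ n)) RintegralDT.
rewrite cZ => h1.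
have h2 : (limn_einf (fun n => (\int[m]_x X n x + \int[m]_x G x)%:E) <=
   (l + \int[m]_x G x)%:E)%E.
  have cc : (c n + \int[m]_x G x)%:E @[n --> \oo] --> (l + \int[m]_x G x)%:E.
    apply/cvg_EFin; first exact: nearW.
    by apply: cvgD cl _; exact: cvg_cst.
  have <- := (cvg_limn_einf_sup cc).1.
  rewrite !limn_einf_lim; apply: lee_lim; [exact: is_cvg_einfs..|].
  apply: nearW => n; apply: le_ereal_inf_tmp => _ [k /= nk <-].
  apply: (@le_trans _ _ (\int[m]_x X k x + \int[m]_x G x)%:E).
    by apply: ereal_inf_lbound; exists k.
  by rewrite lee_fin lerD2r.
have WE : {ae m, forall x, setT x -> (0 <= W x)%E}.
  apply: filterS ZW => x h _; rewrite -h// limn_einf_lim; apply: lime_ge; first exact: is_cvg_einfs.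
  apply: nearW => n; apply: le_ereal_inf_tmp => _ [k /= nk <-]; exact: Z0.
have iW : intg (fun x => Y x + G x).
  apply/integrableP; split=> //.
  rewrite (_ : (\int[m]_x `|_|)%E = (\int[m]_x W x)%E).
    by apply: (le_lt_trans (le_trans h1 h2)); exact: ltry.
  apply: ae_eq_integral => //; first exact: measurableT_comp.
  by apply: filterS WE => x h _; rewrite gee0_abs// h.
have iY : intg Y.
  by apply: (integrable_eqR _ (integrable_subR iW iG)) => x; rewrite addrK.
split=> //; move: (le_trans h1 h2).
by rewrite (EFin_Rintegral iW) lee_fin RintegralDT// lerD2r.
Qed.

End real_integrals.

(** * Lower limits, null sets and strict inequalities between integrals *)

Section liminf.
Context {R : realType}.
Local Open Scope ereal_scope.

Lemma limn_einf_le (u v : (\bar R)^nat) : (forall n, u n <= v n) ->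
  limn_einf u <= limn_einf v.
Proof.
move=> uv; rewrite !limn_einf_lim; apply: lee_lim; [exact: is_cvg_einfs..|].
apply: nearW => n; apply: le_ereal_inf_tmp => _ [k /= nk <-].
by apply: (le_trans _ (uv k)); apply: ereal_inf_lbound; exists k.
Qed.

Lemma limn_einf_ge0 (u : (\bar R)^nat) : (forall n, 0 <= u n) -> 0 <= limn_einf u.
Proof.
move=> u0; rewrite limn_einf_lim; apply: lime_ge; first exact: is_cvg_einfs.
by apply: nearW => n; apply: le_ereal_inf_tmp => _ [k /= nk <-].
Qed.

Lemma limn_einf_superadd (u v : (\bar R)^nat) : (forall n, 0 <= u n) ->
  (forall n, 0 <= v n) -> limn_einf u + limn_einf v <= limn_einf (u \+ v).
Proof.
move=> u0 v0; have := limn_einf_ge0 u0; have := limn_einf_ge0 v0.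
rewrite !limn_einf_lim => v1 u1.
rewrite -limeD; [|exact: is_cvg_einfs..|exact: ge0_adde_def].
apply: lee_lim; first apply: is_cvgeD; [exact: ge0_adde_def|exact: is_cvg_einfs..|].
apply: nearW => n; apply: le_ereal_inf_tmp => _ [k /= nk <-].
by apply: leeD; apply: ereal_inf_lbound; exists k.
Qed.

End liminf.

Section ae_lemmas.
Local Open Scope ereal_scope.

Lemma measurable_limn_einf d (T : measurableType d) (R : realType) (X : nat -> T -> \bar R) :
  (forall n, measurable_fun setT (X n)) ->
  measurable_fun setT (fun x => limn_einf (X ^~ x)).
Proof.
move=> mX; rewrite (_ : (fun _ => _) = (fun x => - limn_esup (fun n => - X n x))).
  apply: measurableT_comp => //; apply: measurable_fun_limn_esup => n.
  exact: measurableT_comp.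
by apply/funext => x; rewrite -limn_einfN; congr limn_einf; apply/funext => n; rewrite /comp oppeK.
Qed.

(** Only [Y <= liminf] is asked, not equality: where a limit function vanishes, its product with an
    infinite weight is 0 by convention, while the lower limit of the products can be positive. *)
Lemma fatou_ae d (T : measurableType d) (R : realType) (m : {measure set T -> \bar R})
    (X : nat -> T -> \bar R) (Y : T -> \bar R) :
  (forall n, measurable_fun setT (X n)) -> measurable_fun setT Y ->
  (forall n x, 0 <= X n x) -> (forall x, 0 <= Y x) ->
  {ae m, forall x, Y x <= limn_einf (X ^~ x)} ->
  \int[m]_x Y x <= limn_einf (fun n => \int[m]_x X n x).
Proof.
move=> mX mY X0 Y0 XY; apply: le_trans (fatou m measurableT mX (fun n x _ => X0 n x)).
apply: ae_ge0_le_integral => //.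
- by move=> x _; exact: limn_einf_ge0.
- exact: measurable_limn_einf.
- by apply: filterS XY => x h _.
Qed.

Lemma ae_prod d1 d2 (T1 : measurableType d1) (T2 : measurableType d2) (R : realType)
    (m1 : {sigma_finite_measure set T1 -> \bar R})
    (m2 : {sigma_finite_measure set T2 -> \bar R}) (P : set T1) (Q : set T2) :
  {ae m1, forall x, P x} -> {ae m2, forall x, Q x} ->
  {ae (m1 \x m2), forall z, P z.1 /\ Q z.2}.
Proof.
move=> [N1 [mN1 N10 sN1]] [N2 [mN2 N20 sN2]].
exists ((N1 `*` setT) `|` (setT `*` N2)); split.
- by apply: measurableU; exact: measurableX.
- apply/eqP; rewrite eq_le measure_ge0 andbT.
  apply: (@le_trans _ _ ((m1 \x m2) (N1 `*` setT) + (m1 \x m2) (setT `*` N2))).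
    by apply: measureU2; exact: measurableX.
  have -> : (m1 \x m2) (N1 `*` setT) = 0.
    rewrite product_measure1E//; apply/eqP; rewrite mule_eq0; apply/orP; left.
    by apply/eqP; exact: N10.
  have -> : (m1 \x m2) (setT `*` N2) = 0.
    rewrite product_measure1E//; apply/eqP; rewrite mule_eq0; apply/orP; right.
    by apply/eqP; exact: N20.
  by rewrite adde0.
- move=> z /= /not_andP[nP|nQ]; [left|right]; split=> //=.
    by apply: sN1.
  by apply: sN2.
Qed.

End ae_lemmas.

Section strict_integral.
Context d (T : measurableType d) (R : realType) (m : {measure set T -> \bar R}).
Local Open Scope ereal_scope.

(** A positive function has positive integral over a set of positive measure; this is applied to h -
    f. If its integral is infinite, the negative part of [h] is still dominated by that of [f], so
    the integral of [h] is +oo. *)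
Lemma lt_integral (D : set T) (f : T -> R) (h : T -> \bar R) : measurable D ->
  m D != 0 -> m.-integrable D (EFin \o f) -> measurable_fun D h ->
  (forall x, D x -> (f x)%:E < h x) -> \int[m]_(x in D) (f x)%:E < \int[m]_(x in D) h x.
Proof.
move=> mD D0 fi mh fh; have mf := measurable_int _ fi.
pose e x := h x - (f x)%:E.
have me : measurable_fun D e by apply: emeasurable_funB.
have e0 x : D x -> 0 < e x by move=> Dx; rewrite sube_gt0; exact: fh.
have e0' x : D x -> 0 <= e x by move=> /e0/ltW.
have Ie : 0 < \int[m]_(x in D) e x.
  rewrite lt_neqAle integral_ge0// andbT; apply/eqP => /esym I0.
  have : \int[m]_(x in D) `|e x| = 0.
    by rewrite -[RHS]I0; apply: eq_integral => x /set_mem Dx; rewrite gee0_abs// e0'.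
  move=> /(ae_eq_integral_abs _ mD me)[N [mN N0 DN]].
  move/negP: D0; apply; rewrite eq_le measure_ge0 andbT -[leRHS]N0.
  apply: le_measure; rewrite ?inE// => x Dx; apply: DN => /= /(_ Dx) ex.
  by have := e0 x Dx; rewrite ex ltxx.
have hE x : D x -> h x = e x + (f x)%:E by move=> Dx; rewrite /e subeK.
have [Ioo|Ifin] := eqVneq (\int[m]_(x in D) e x) +oo.
  have hneg : \int[m]_(x in D) h^\- x < +oo.
    apply: le_lt_trans (integral_funeneg_lt_pinfty mD fi).
    apply: ge0_le_integral => //; [exact: measurable_funeneg..|].
    move=> x Dx; rewrite !funenegE; have := ltW (fh x Dx); rewrite -leeN2 => fhx.
    by rewrite ge_max !le_max fhx lexx !orbT.
  have hpos : \int[m]_(x in D) h^\+ x = +oo.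
    have : \int[m]_(x in D) e x <= \int[m]_(x in D) (h^\+ x + (EFin \o f)^\- x).
      apply: ge0_le_integral => //.
      - apply: emeasurable_funD; first exact: measurable_funepos.
        by apply: measurable_funeneg; exact: (measurable_int _ fi).
      - move=> x Dx; rewrite /e funeposE funenegE; apply: leeD; rewrite le_max lexx//.
    rewrite Ioo ge0_integralD//; [|exact: measurable_funepos|exact: measurable_funeneg].
    have := integral_funeneg_lt_pinfty mD fi.
    case: (\int[m]_(x in D) (EFin \o f)^\- x) => [r _|//|]; last first.
      by case: (\int[m]_(x in D) h^\+ x) => [s| |] //= _; rewrite leye_eq.
    by case: (\int[m]_(x in D) h^\+ x) => [s| |] //=; rewrite leye_eq.
  rewrite [ltRHS]integralE hpos.
  have hn : \int[m]_(x in D) h^\- x \is a fin_num.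
    by rewrite ge0_fin_numE// integral_ge0.
  rewrite -(fineK hn) /=.
  by have := integrable_fin_num mD fi; case/fin_numP => _ fy; rewrite ltey.
have ie : m.-integrable D e.
  apply/integrableP; split=> //.
  rewrite (_ : \int[m]_(x in D) `|_| = \int[m]_(x in D) e x); first by rewrite ltey.
  by apply: eq_integral => x /set_mem Dx; rewrite gee0_abs// e0'.
rewrite (_ : \int[m]_(x in D) h x = \int[m]_(x in D) (e x + (f x)%:E)); last first.
  by apply: eq_integral => x /set_mem Dx; rewrite hE.
by rewrite integralD// lteDr//; exact: integrable_fin_num.
Qed.

End strict_integral.

(** * The energy space *)

Section energy_space.
Context d (T : measurableType d) (R : realType).
Variable mu : {sigma_finite_measure set T -> \bar R}.
Variables (Om : set T) (k : T * T -> R) (p : R).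
Implicit Types (u v w phi : T -> R).

Definition energy_density u (z : T * T) : R := `|u z.1 - u z.2| `^ p * k z.

Definition energy u : R := \int[(mu \x mu)%E]_z energy_density u z.

Definition form_density u phi (z : T * T) : R :=
  jp p (u z.1 - u z.2) * (phi z.1 - phi z.2) * k z.

Definition form u phi : R := \int[(mu \x mu)%E]_z form_density u phi z.

(** Members are functions rather than classes, and vanish at every point off [Om], so truncations
    and quotients can be handled pointwise. Representatives of Sobolev functions are chosen only at
    the end. *)
Definition energy_space u : Prop :=
  [/\ measurable_fun setT u, (forall x, ~ Om x -> u x = 0),
      mu.-integrable setT (EFin \o (fun x => `|u x| `^ p)) &
      (mu \x mu)%E.-integrable setT (EFin \o energy_density u)].

Hypothesis p1 : 1 < p.
Hypothesis mk : measurable_fun setT k.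
Hypothesis k0 : forall z, 0 <= k z.

Let p0 : 0 < p. Proof. exact: lt_trans ltr01 p1. Qed.

Lemma measurable_incr u : measurable_fun setT u ->
  measurable_fun setT (fun z : T * T => u z.1 - u z.2).
Proof.
move=> mu_; apply: measurable_funB.
  exact: (measurableT_comp mu_ measurable_fst).
exact: (measurableT_comp mu_ measurable_snd).
Qed.

Lemma measurable_normr_powR d' (T' : measurableType d') (f : T' -> R) q :
  measurable_fun setT f -> measurable_fun setT (fun x => `|f x| `^ q).
Proof.
move=> mf; apply: (measurableT_comp (measurable_powR q)).
exact: (measurableT_comp (@normr_measurable R setT)).
Qed.

Lemma measurable_energy_density u : measurable_fun setT u ->
  measurable_fun setT (energy_density u).
Proof.
move=> mu_; apply: measurable_funM => //.
by apply: measurable_normr_powR; exact: measurable_incr.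
Qed.

Lemma measurable_form_density u phi : measurable_fun setT u ->
  measurable_fun setT phi -> measurable_fun setT (form_density u phi).
Proof.
move=> mu_ mphi; apply: measurable_funM => //; apply: measurable_funM.
  apply: (measurableT_comp (continuous_measurable_fun (continuous_jp p1))).
  exact: measurable_incr.
exact: measurable_incr.
Qed.

Lemma energy_density_ge0 u z : 0 <= energy_density u z.
Proof. by rewrite /energy_density mulr_ge0 ?powR_ge0 ?k0. Qed.

Lemma energy_ge0 u : 0 <= energy u.
Proof. by apply: Rintegral_ge0T => z; exact: energy_density_ge0. Qed.

Lemma form_density_le u phi z :
  `|form_density u phi z| <= energy_density u z + energy_density phi z.
Proof.
rewrite /form_density normrM (ger0_norm (k0 z)) -mulrDl ler_wpM2r//.
exact: normr_jpM.
Qed.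

Lemma integrable_form_density u phi : energy_space u -> energy_space phi ->
  (mu \x mu)%E.-integrable setT (EFin \o form_density u phi).
Proof.
move=> [mu_ _ _ iu] [mphi _ _ iphi].
apply: (integrable_le _ (form_density_le u phi)); first exact: measurable_form_density.
exact: integrable_addR.
Qed.

(** The single closure principle of the energy space: truncations, linear combinations, cutoffs and
    Picone quotients are all controlled, in size and in increments, by at most two members. *)
Lemma energy_space_lip u1 u2 w C : 0 <= C -> energy_space u1 -> energy_space u2 ->
  measurable_fun setT w ->
  (forall x, `|w x| <= C * (`|u1 x| + `|u2 x|)) ->
  (forall x y, `|w x - w y| <= C * (`|u1 x - u1 y| + `|u2 x - u2 y|)) ->
  energy_space w.
Proof.
move=> C0 [m1 z1 i1 e1] [m2 z2 i2 e2] mw w0 w1.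
have key a b c : `|c| <= C * (`|a| + `|b|) ->
    `|c| `^ p <= (C `^ p * 2 `^ p) * (`|a| `^ p + `|b| `^ p).
  move=> h; apply: (@le_trans _ _ ((C * (`|a| + `|b|)) `^ p)).
    by apply: ler_wpowR => //; exact: ltW.
  rewrite powRM ?addr_ge0// -mulrA ler_wpM2l ?powR_ge0//.
  have := powR_normD `|a| `|b| (ltW p0).
  by rewrite ger0_norm ?addr_ge0// !normr_id.
split => //.
- move=> x Ox; apply/normr0_eq0/le_anti; rewrite normr_ge0 andbT.
  by apply: (le_trans (w0 x)); rewrite z1// z2// normr0 addr0 mulr0.
- apply: (@integrable_le _ _ _ _ _ (fun x => (C `^ p * 2 `^ p) * (`|u1 x| `^ p + `|u2 x| `^ p))).
  + exact: measurable_normr_powR.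
  + by move=> x; rewrite ger0_norm ?powR_ge0//; exact: key.
  + exact/integrable_mulRl/integrable_addR.
- apply: (@integrable_le _ _ _ _ _
     (fun z => (C `^ p * 2 `^ p) * (energy_density u1 z + energy_density u2 z))).
  + exact: measurable_energy_density.
  + move=> z; rewrite ger0_norm ?energy_density_ge0// /energy_density.
    by rewrite -mulrDl mulrA ler_wpM2r//; exact: key.
  + exact/integrable_mulRl/integrable_addR.
Qed.

Lemma energy_space0 : energy_space (fun=> 0).
Proof.
have e0 : energy_density (fun=> 0) = fun=> 0.
  by apply/funext => z; rewrite /energy_density subrr normr0 powR0 ?mul0r// gt_eqF.
split=> //; last by rewrite e0; exact: integrable0.
rewrite (_ : (fun=> _) = (fun=> 0)); first exact: integrable0.
by apply/funext => z; rewrite normr0 powR0// gt_eqF.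
Qed.

Lemma energy_space_contr u w : energy_space u -> measurable_fun setT w ->
  (forall x, `|w x| <= `|u x|) -> (forall x y, `|w x - w y| <= `|u x - u y|) ->
  energy_space w.
Proof.
move=> Wu mw w0 w1; apply: (@energy_space_lip u (fun=> 0) _ 1) => //.
- exact: energy_space0.
- by move=> x; rewrite mul1r normr0 addr0.
- by move=> x y; rewrite mul1r subrr normr0 addr0.
Qed.

Lemma energy_contr u w : energy_space u -> energy_space w ->
  (forall x y, `|w x - w y| <= `|u x - u y|) -> energy w <= energy u.
Proof.
move=> [_ _ _ iu] [_ _ _ iw] wu; apply: ler_Rintegral => // z.
by rewrite ler_wpM2r// ler_wpowR// ltW.
Qed.

Lemma energy_spaceD u v t : energy_space u -> energy_space v ->
  energy_space (fun x => u x + t * v x).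
Proof.
move=> Wu Wv; apply: (@energy_space_lip u v _ (1 + `|t|)) => //.
- case: Wu => mu_ _ _ _; case: Wv => mv _ _ _.
  by apply: measurable_funD => //; exact: measurable_funM.
- move=> x; apply: (le_trans (ler_normD _ _)); rewrite normrM.
  by have := normr_ge0 (u x); have := normr_ge0 (v x); have := normr_ge0 t; nra.
- move=> x y; rewrite (_ : _ - _ = (u x - u y) + t * (v x - v y)); last ring.
  apply: (le_trans (ler_normD _ _)); rewrite normrM.
  by have := normr_ge0 (u x - u y); have := normr_ge0 (v x - v y); have := normr_ge0 t; nra.
Qed.

Lemma energy_spaceZ t u : energy_space u -> energy_space (fun x => t * u x).
Proof.
move=> Wu; have := energy_spaceD t energy_space0 Wu.
by rewrite (_ : (fun x => _) = (fun x => t * u x))//; apply/funext => x; rewrite add0r.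
Qed.

Lemma energyZ t u : energy_space u -> energy (fun x => t * u x) = `|t| `^ p * energy u.
Proof.
move=> [_ _ _ iu]; rewrite /energy -RintegralZT//; apply: eq_Rintegral => z _.
by rewrite /energy_density -mulrBr normrM powRM// mulrA.
Qed.

Lemma energy_space_norm u : energy_space u -> energy_space (fun x => `|u x|).
Proof.
move=> Wu; apply: (energy_space_contr Wu) => [||x y]; last exact: ler_dist_dist.
  by case: Wu => mu_ _ _ _; exact: measurableT_comp.
by move=> x; rewrite normr_id.
Qed.

Lemma energy_space_max0 u : energy_space u -> energy_space (fun x => Num.max 0 (u x)).
Proof.
move=> Wu; apply: (energy_space_contr Wu).
- by case: Wu => mu_ _ _ _; exact: measurable_maxr.
- by move=> x; case: (leP 0 (u x)) => [//|?]; rewrite normr0.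
- move=> x y; case: (leP 0 (u x)) => ?; case: (leP 0 (u y)) => ?; rewrite ?subr0 ?sub0r ?normrN//.
  + by rewrite !ger0_norm; lra.
  + by rewrite distrC !ger0_norm; lra.
  + by rewrite normr0.
Qed.

Lemma minr_contr (a b c : R) : `|Num.min a c - Num.min b c| <= `|a - b|.
Proof.
wlog ab : a b / b <= a.
  by move=> h; have [/h//|/ltW/h] := leP b a; rewrite distrC (distrC b).
rewrite [leRHS]ger0_norm ?subr_ge0//.
by case: (leP a c) => ?; case: (leP b c) => ?; rewrite ger0_norm; lra.
Qed.

Lemma energy_space_min u c : 0 <= c -> energy_space u -> (forall x, 0 <= u x) ->
  energy_space (fun x => Num.min (u x) c).
Proof.
move=> c0 Wu u0; apply: (energy_space_contr Wu) => [||x y].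
- by case: Wu => mu_ _ _ _; exact: measurable_minr.
- by move=> x; have := u0 x; case: (leP (u x) c) => // ? ?; rewrite !ger0_norm; lra.
- exact: minr_contr.
Qed.

(** Truncation is nondecreasing and 1-Lipschitz, so its increment has the sign of that of [u] and is
    no larger; the p-th power of the smaller increment is then below the mixed product. *)
Lemma energy_min_le_form u c : 0 <= c -> energy_space u -> (forall x, 0 <= u x) ->
  energy (fun x => Num.min (u x) c) <= form u (fun x => Num.min (u x) c).
Proof.
move=> c0 Wu u0; have Wm := energy_space_min c0 Wu u0.
have [_ _ _ im] := Wm; apply: ler_Rintegral => //; first exact: integrable_form_density.
move=> z; rewrite ler_wpM2r//.
move: (u z.1) (u z.2) => a b.
wlog ab : a b / b <= a.
  move=> h; have [/h//|/ltW/h] := leP b a.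
  by rewrite distrC -(opprB a b) jpN -(opprB (Num.min a c)) mulrNN.
have h : 0 <= Num.min a c - Num.min b c <= a - b.
  by case: (leP a c) => ?; case: (leP b c) => ?; lra.
case/andP: h => h0 h1; rewrite ge0_jp ?subr_ge0// ger0_norm//.
have p1_ := p1; rewrite -(mulr_powRB1 h0 p0) mulrC ler_wpM2r//; apply: ler_wpowR => //; lra.
Qed.

(** The tangent is taken at the displaced function u + t w and evaluated at [u]. This bounds the
    energy for every t > 0 without differentiating it; t tends to 0 later, inside the form. *)
Lemma energyD_le u w t : 0 < t -> energy_space u -> energy_space w ->
  energy (fun x => u x + t * w x)
    <= energy u + p * (t * form (fun x => u x + t * w x) w).
Proof.
move=> t0 Wu Ww; have Wt := energy_spaceD t Wu Ww.
have [_ _ _ iu] := Wu; have [_ _ _ it] := Wt.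
have i_f := integrable_form_density Wt Ww.
rewrite /form -RintegralZT// -RintegralZT; last exact: integrable_mulRl.
rewrite -RintegralDT//; last exact/integrable_mulRl/integrable_mulRl.
apply: ler_Rintegral => //; first exact/integrable_addR/integrable_mulRl/integrable_mulRl.
move=> z; rewrite /energy_density /form_density.
have := jp_convex (u z.1 + t * w z.1 - (u z.2 + t * w z.2)) (u z.1 - u z.2) p1.
move: (jp p _) (`|u z.1 - u z.2| `^ p) (_ `^ p) => j Y X h.
rewrite (_ : Y * k z + _ = (Y + p * (t * (j * (w z.1 - w z.2)))) * k z); last ring.
rewrite ler_wpM2r// -lerBlDr; apply: le_trans h; rewrite lerD2l le_eqVlt.
by apply/orP; left; apply/eqP; ring.
Qed.

(** Subtracting [e] leaves increments unchanged and makes the value 0 wherever [u] and [v] vanish,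
    since e^p/e^(p-1) = e. *)
Definition picone_test u v (e : R) x := (v x + e) `^ p / (u x + e) `^ (p - 1) - e.

Lemma energy_space_picone u v e M : 0 < e -> 0 <= M -> energy_space u -> energy_space v ->
  (forall x, 0 <= u x) -> (forall x, 0 <= v x <= M) -> energy_space (picone_test u v e).
Proof.
have p1_ := p1; move=> e0 M0 Wu Wv u0 v0M.
(* The two-variable quotient is Lipschitz on a >= 0, 0 <= b <= M: the shift [e] keeps the
   denominator away from 0 and the bound [M] keeps the p-th power Lipschitz. [C1] and [C2] are the
   constants in the second and first variable. *)
pose G (a b : R) := (b + e) `^ p / (a + e) `^ (p - 1).
have E0 : 0 < e `^ (p - 1) by rewrite powR_gt0.
pose C1 := p * (M + e) `^ (p - 1) / e `^ (p - 1).
pose C2 := (M + e) `^ p * ((p + 1) / e `^ p).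
have C10 : 0 <= C1 by rewrite divr_ge0 ?mulr_ge0 ?powR_ge0// ltW.
have C20 : 0 <= C2 by rewrite mulr_ge0 ?divr_ge0 ?powR_ge0//; lra.
have lipG a b a' b' : 0 <= a -> 0 <= b <= M -> 0 <= a' -> 0 <= b' <= M ->
    `|G a b - G a' b'| <= (C1 + C2) * (`|a - a'| + `|b - b'|).
  move=> a0 /andP[b0 bM] a'0 /andP[b'0 b'M].
  have A0 : (a + e) `^ (p - 1) != 0 by rewrite gt_eqF// powR_gt0//; lra.
  have A0' : (a' + e) `^ (p - 1) != 0 by rewrite gt_eqF// powR_gt0//; lra.
  have -> : G a b - G a' b' =
      ((b + e) `^ p - (b' + e) `^ p) / (a + e) `^ (p - 1) +
      (b' + e) `^ p * (((a + e) `^ (p - 1))^-1 - ((a' + e) `^ (p - 1))^-1).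
    by rewrite /G; field; rewrite A0 A0'.
  apply: (le_trans (ler_normD _ _)).
  have h1 : `|((b + e) `^ p - (b' + e) `^ p) / (a + e) `^ (p - 1)| <= C1 * `|b - b'|.
    rewrite normrM /C1 mulrAC; apply: ler_pM => //.
      have := @powR_lipschitz _ p (M + e) (b + e) (b' + e) p1.
      by rewrite (_ : b + e - (b' + e) = b - b'); [apply; lra|ring].
    rewrite normfV (ger0_norm (powR_ge0 _ _)) lef_pV2 ?posrE//.
      by apply: ler_wpowR; lra.
    by rewrite powR_gt0//; lra.
  have h2 : `|(b' + e) `^ p * (((a + e) `^ (p - 1))^-1 - ((a' + e) `^ (p - 1))^-1)|
      <= C2 * `|a - a'|.
    rewrite normrM (ger0_norm (powR_ge0 _ _)) /C2 -mulrA.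
    apply: ler_pM => //; first exact: powR_ge0.
      by apply: ler_wpowR; lra.
    have := @powR_pred_lipschitz _ p e (a + e) (a' + e) p1 e0.
    by rewrite (_ : a + e - (a' + e) = a - a'); [apply; lra|ring].
  apply: (le_trans (lerD h1 h2)).
  by have := normr_ge0 (b - b'); have := normr_ge0 (a - a'); nra.
have G0 : G 0 0 = e.
  by rewrite /G !add0r -(@mulr_powRB1 _ e p) ?(ltW e0)// mulfK// gt_eqF.
apply: (@energy_space_lip u v _ (C1 + C2)) => //; first by rewrite addr_ge0.
- case: Wu => mu_ _ _ _; case: Wv => mv _ _ _.
  apply: measurable_funB => //; apply: measurable_funM.
    apply: (measurableT_comp (measurable_powR p)); exact: measurable_funD.
  rewrite (_ : (fun x => _) = (fun x => (u x + e) `^ (- (p - 1)))).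
    apply: (measurableT_comp (measurable_powR (- (p - 1)))); exact: measurable_funD.
  by apply/funext => x; rewrite powRN.
- move=> x; have := @lipG (u x) (v x) 0 0; rewrite G0 !subr0; apply => //.
  by rewrite lexx.
- move=> x y; rewrite (_ : _ - _ = G (u x) (v x) - G (u y) (v y)); first exact: lipG.
  by rewrite /picone_test /G; ring.
Qed.

Lemma form_picone u v e M : 0 < e -> 0 <= M -> energy_space u -> energy_space v ->
  (forall x, 0 <= u x) -> (forall x, 0 <= v x <= M) ->
  form u (picone_test u v e) <= energy v.
Proof.
have p1_ := p1; move=> e0 M0 Wu Wv u0 v0M; have Wp := energy_space_picone e0 M0 Wu Wv u0 v0M.
have [_ _ _ iv] := Wv; apply: ler_Rintegral => //; first exact: integrable_form_density.
move=> z; rewrite ler_wpM2r//.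
have hu x : 0 < u x + e by have := u0 x; lra.
have hv x : 0 <= v x + e by have := v0M x; lra.
have := picone p1 (hu z.1) (hu z.2) (hv z.1) (hv z.2).
rewrite (_ : u z.1 + e - (u z.2 + e) = u z.1 - u z.2); last ring.
rewrite (_ : v z.1 + e - (v z.2 + e) = v z.1 - v z.2); last ring.
by apply: le_trans; rewrite /picone_test le_eqVlt; apply/orP; left; apply/eqP; ring.
Qed.

End energy_space.

(** * Reaction terms *)

Section caratheodory_functions.
Context d (T : measurableType d) (R : realType).

(** Rounding t down to a multiple of 1/(n+1) turns preimages into countable unions of rectangles;
    continuity in t recovers [g] in the limit. *)
Lemma measurable_caratheodory (g : T -> R -> R) :
  (forall t, measurable_fun setT (g ^~ t)) -> (forall x, continuous (g x)) ->
  measurable_fun setT (fun z : T * measurableTypeR R => g z.1 z.2).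
Proof.
move=> mg cg.
pose q n (t : R) : R := (Num.floor (t * n.+1%:R))%:~R / n.+1%:R.
apply: (@measurable_fun_cvg _ _ _ setT
    (fun n (z : T * measurableTypeR R) => g z.1 (q n z.2))).
  move=> n _ B mB; rewrite setTI.
  rewrite (_ : _ @^-1` B = \bigcup_(j : int)
     (((g ^~ (j%:~R / n.+1%:R)) @^-1` B) `*`
      [set t : R | Num.floor (t * n.+1%:R) = j])); last first.
    apply/seteqP; split=> z /=.
      by move=> Bz; exists (Num.floor (z.2 * n.+1%:R)).
    by move=> [j _ [/= Bz jz]]; rewrite /q jz.
  apply: countable_bigcupT_measurable => // j; apply: measurableX.
    by rewrite -[X in measurable X]setTI; exact: mg.
  rewrite (_ : [set _ | _] = `[j%:~R / n.+1%:R, (j + 1)%:~R / n.+1%:R[%classic).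
    exact: measurable_itv.
  have n0 : 0 < n.+1%:R :> R by rewrite ltr0n.
  apply/seteqP; split=> t /=; rewrite in_itv /= ler_pdivrMr// ltr_pdivlMr//.
    by move=> <-; rewrite floor_itv.
  by move=> h; apply: floor_def.
move=> z _; apply: (@continuous_cvg _ _ _ _ _ (fun n => q n z.2) (g z.1)); first exact: cg.
move: z.2 => t.
apply/cvgrPdist_le => e e0; near=> n.
have n0 : 0 < n.+1%:R :> R by rewrite ltr0n.
have /andP[h1 h2] := floor_itv (t * n.+1%:R).
rewrite /q; set j := Num.floor _ in h1 h2 *.
rewrite -ler_pdivrMr// in h1.
have {}h2 : t < (j%:~R + 1) / n.+1%:R by rewrite ltr_pdivlMr//; rewrite intrD in h2.
rewrite ger0_norm ?subr_ge0//.
have : n.+1%:R^-1 < e.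
  by near: n; exact: (near_infty_natSinv_lt (PosNum e0)).
by move: h2; rewrite mulrDl mul1r; move: (_ / _) => a; move: (_^-1) => b ? ?; lra.
Unshelve. all: by end_near. Qed.

Lemma measurable_superposition (g : T -> R -> R) u :
  (forall t, measurable_fun setT (g ^~ t)) -> (forall x, continuous (g x)) ->
  measurable_fun setT u -> measurable_fun setT (fun x => g x (u x)).
Proof.
move=> mg cg mu_.
apply: (@measurableT_comp _ _ _ _ _ _ (fun z : T * measurableTypeR R => g z.1 z.2)
  _ (fun x => (x, u x))); first exact: measurable_caratheodory.
apply/measurable_fun_pairP; split; [exact: measurable_id|exact: mu_].
Qed.

Lemma ge0_Rintegral_eq0 (m : {measure set T -> \bar R}) (f : T -> R) :
  m.-integrable setT (EFin \o f) -> (forall x, 0 <= f x) -> \int[m]_x f x <= 0 ->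
  {ae m, forall x, f x = 0}.
Proof.
move=> mf f0 If.
have : (\int[m]_x `|(f x)%:E| = 0)%E.
  under eq_integral => x _ do rewrite abse_EFin ger0_norm//.
  rewrite EFin_Rintegral//; congr EFin; apply/le_anti; rewrite If/=.
  exact: Rintegral_ge0T.
have mfE : measurable_fun setT (EFin \o f) by exact: measurable_int mf.
move=> /(ae_eq_integral_abs _ measurableT mfE).
by apply: filterS => x /(_ Logic.I)/= [].
Qed.

End caratheodory_functions.

(** The hypotheses on f once null sets have been repaired: they hold at every point, and the
    function is constant for t <= 0, so that variations of a nonnegative function may become
    negative. Bounds at positive integers suffice, by monotonicity of the quotient. *)
Record reaction d (T : measurableType d) (R : realType) (p c0 : R) (g : T -> R -> R)
    : Prop := Reaction {
  reaction_measurable : forall t, measurable_fun setT (g ^~ t);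
  reaction_continuous : forall x, continuous (g x);
  reaction_neg : forall x t, t <= 0 -> g x t = g x 0;
  reaction_le : forall x t, 0 <= t -> g x t <= c0 * (1 + t `^ (p - 1));
  reaction_decr : forall x t1 t2, 0 < t1 -> t1 < t2 ->
    g x t2 / t2 `^ (p - 1) < g x t1 / t1 `^ (p - 1);
  reaction_bounded : forall n : nat, exists C : R, forall x, `|g x n.+1%:R| <= C }.

Section reaction_theory.
Context d (T : measurableType d) (R : realType) (p c0 : R) (g : T -> R -> R).
Hypothesis p1 : 1 < p.
Hypothesis c00 : 0 < c0.
Hypothesis hg : reaction p c0 g.

Definition quotient x t : R := g x t / t `^ (p - 1).

Lemma quotient_le x t1 t2 : 0 < t1 -> t1 <= t2 -> quotient x t2 <= quotient x t1.
Proof.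
move=> t10; rewrite le_eqVlt => /orP[/eqP->//|t12].
exact/ltW/(reaction_decr hg).
Qed.

Lemma quotientK x t : 0 < t -> quotient x t * t `^ (p - 1) = g x t.
Proof. by move=> t0; rewrite /quotient divfK// gt_eqF// powR_gt0. Qed.

Lemma quotientM x t : 0 < t -> quotient x t * t `^ p = g x t * t.
Proof.
move=> t0; rewrite -(@mulr_powRB1 _ t p) ?ltW//; last exact: lt_trans ltr01 p1.
by rewrite mulrCA quotientK// mulrC.
Qed.

Lemma measurable_reaction u : measurable_fun setT u ->
  measurable_fun setT (fun x => g x (u x)).
Proof.
apply: measurable_superposition.
  exact: reaction_measurable hg.
exact: reaction_continuous hg.
Qed.

(** The quotient decreases in t, so the bound at the right end n+1 serves the whole interval. *)
Lemma quotient_ge (n : nat) : exists2 C : R, 0 <= C &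
  forall x t, 0 < t -> t <= n.+1%:R -> - C <= quotient x t.
Proof.
have [C hC] := reaction_bounded hg n.
have n0 : 0 < n.+1%:R :> R by rewrite ltr0n.
exists (`|C| / n.+1%:R `^ (p - 1)); first by rewrite divr_ge0 ?powR_ge0.
move=> x t t0 tn; apply: le_trans (quotient_le x t0 tn).
rewrite /quotient -mulNr ler_wpM2r ?invr_ge0 ?powR_ge0//.
by have := hC x; have := ler_norm C; rewrite ler_norml; lra.
Qed.

(** At t = 1/(n+1) the reaction is at least -C t^(p-1), and both sides pass to the limit. *)
Lemma reaction_ge0 x : 0 <= g x 0.
Proof.
have [C C0 hC] := quotient_ge 0.
have cvg0 : (fun n : nat => n.+1%:R^-1 : R) @ \oo --> (0 : R).
  apply/cvgrPdist_lt => e e0; near=> n.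
  rewrite sub0r normrN ger0_norm ?invr_ge0//.
  by near: n; exact: (near_infty_natSinv_lt (PosNum e0)).
have h1 : (fun n : nat => g x n.+1%:R^-1) @ \oo --> g x 0.
  by apply: (@continuous_cvg _ _ _ _ _ (fun n : nat => n.+1%:R^-1 : R) (g x) 0) => //;
    exact: reaction_continuous hg x 0.
have pm : 0 < p - 1 by rewrite subr_gt0.
have h2 : (fun n : nat => - C * (n.+1%:R^-1 : R) `^ (p - 1)) @ \oo --> (0 : R).
  rewrite -[X in _ --> X](mulr0 (- C)); apply: cvgM; first exact: cvg_cst.
  have i0 (n : nat) : 0 <= n.+1%:R^-1 :> R by rewrite invr_ge0.
  by have := cvg_powR pm i0 cvg0; rewrite powR0 ?gt_eqF//.
apply: (ler_cvg_to h2 h1); apply: nearW => n.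
have n0 : 0 < n.+1%:R^-1 :> R by rewrite invr_gt0.
rewrite -(quotientK x n0) ler_wpM2r ?powR_ge0//; apply: hC => //.
by rewrite invf_le1// ler1n.
Unshelve. all: by end_near. Qed.

Lemma reaction_ge (n : nat) : exists2 C : R, 0 <= C &
  forall x t, 0 <= t -> t <= n.+1%:R -> - (C * t `^ (p - 1)) <= g x t.
Proof.
have [C C0 hC] := quotient_ge n; exists C => // x t.
rewrite le_eqVlt => /orP[/eqP<- _|t0 tn].
  rewrite powR0 ?mulr0 ?oppr0 ?reaction_ge0// gt_eqF// subr_gt0//.
rewrite -mulNr -(quotientK x t0) ler_wpM2r ?powR_ge0//; exact: hC.
Qed.

Lemma reaction_abs_le (n : nat) : exists2 C : R, 0 <= C &
  forall x t, t <= n.+1%:R -> `|g x t| <= C.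
Proof.
have [C C0 hC] := reaction_ge n.
have pm : 0 <= p - 1 by rewrite subr_ge0 ltW.
pose D := n.+1%:R `^ (p - 1) : R; have D0 : 0 <= D by exact: powR_ge0.
exists (C * D + c0 * (1 + D)).
  by rewrite addr_ge0 ?mulr_ge0 ?addr_ge0 ?(ltW c00).
move=> x t; wlog t0 : t / 0 <= t.
  move=> h tn; have [/h/(_ tn)//|/ltW t0] := leP 0 t.
  by rewrite (reaction_neg hg)//; exact: h.
move=> tn; have h1 := hC x t t0 tn; have h2 := reaction_le hg x t0.
have h3 : t `^ (p - 1) <= D by apply: ler_wpowR.
have h4 : C * t `^ (p - 1) <= C * D by rewrite ler_wpM2l.
have h5 : c0 * (1 + t `^ (p - 1)) <= c0 * (1 + D) by rewrite ler_wpM2l ?(ltW c00)// lerD2l.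
have h6 : 0 <= c0 * (1 + D) by rewrite mulr_ge0 ?addr_ge0 ?(ltW c00).
have h7 : 0 <= C * D by rewrite mulr_ge0.
by rewrite ler_norml; lra.
Qed.

End reaction_theory.

(** * Positive solutions *)

Section positive_solutions.
Context d (T : measurableType d) (R : realType).
Variable mu : {sigma_finite_measure set T -> \bar R}.
Variables (Om : set T) (k : T * T -> R) (p c0 : R) (g : T -> R -> R).
Hypothesis p1 : 1 < p.
Hypothesis c00 : 0 < c0.
Hypothesis mOm : measurable Om.
Hypothesis fOm : (mu Om < +oo)%E.
Hypothesis mk : measurable_fun setT k.
Hypothesis k0 : forall z, 0 <= k z.
Hypothesis hg : reaction p c0 g.
Local Notation intg f := (mu.-integrable setT (EFin \o (f : T -> R))).
Local Notation W := (energy_space mu Om k p).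
Local Notation Q := (quotient p g).
Implicit Types (u v w phi : T -> R).

(** Positivity is required at every point of [Om], so that powers of [u] can be divided by
    pointwise. *)
Definition positive_solution u : Prop :=
  [/\ W u, (forall x, Om x -> 0 < u x) &
    forall phi, W phi -> intg (fun x => g x (u x) * phi x) /\
      form mu k p u phi = \int[mu]_x (g x (u x) * phi x)].

Let p0 : 0 < p. Proof. exact: lt_trans ltr01 p1. Qed.
Let pm : 0 < p - 1. Proof. by rewrite subr_gt0. Qed.

Lemma integrable_ind : intg (\1_Om : T -> R).
Proof.
apply: ge0_integrable_lt => [|x|].
- exact: (@measurable_indic _ _ R setT Om mOm).
- by rewrite indicE.
- by rewrite integral_indic// setIT.
Qed.

Lemma measurable_ind : measurable_fun setT (\1_Om : T -> R).
Proof. exact: (@measurable_indic _ _ R setT Om mOm). Qed.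

Lemma indE x : (Om x -> \1_Om x = 1 :> R) /\ (~ Om x -> \1_Om x = 0 :> R).
Proof.
by split=> Ox; rewrite indicE; [rewrite mem_set|rewrite memNset].
Qed.

Lemma measurable_pow q u : measurable_fun setT u -> measurable_fun setT (fun x => u x `^ q).
Proof. by move=> mu_; apply: (measurableT_comp (measurable_powR q)). Qed.

Lemma measurable_inv_pow q u : measurable_fun setT u ->
  measurable_fun setT (fun x => (u x `^ q)^-1).
Proof.
move=> mu_; rewrite (_ : (fun x => _) = (fun x => u x `^ (- q))).
  exact: measurable_pow.
by apply/funext => x; rewrite powRN.
Qed.

Lemma measurable_quotient u : measurable_fun setT u ->
  measurable_fun setT (fun x => Q x (u x)).
Proof.
move=> mu_; apply: measurable_funM; first exact: (measurable_reaction hg).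
exact: measurable_inv_pow.
Qed.

Lemma cvg_invS : (fun n : nat => n.+1%:R^-1 : R) @ \oo --> (0 : R).
Proof.
apply/cvgrPdist_lt => e e0; near=> n.
rewrite sub0r normrN ger0_norm ?invr_ge0//.
by near: n; exact: (near_infty_natSinv_lt (PosNum e0)).
Unshelve. all: by end_near. Qed.

Lemma cvg_min_nat (a : R) : (fun n : nat => Num.min a n.+1%:R) @ \oo --> a.
Proof.
apply/cvgrPdist_lt => e e0; near=> n.
rewrite min_l ?subrr ?normr0//.
have /ltW h := archi_boundP (normr_ge0 a).
apply: (le_trans (ler_norm a)); apply: (le_trans h).
rewrite ler_nat; apply: leqW.
by near: n; exists (Num.bound `|a|).
Unshelve. all: by end_near. Qed.

(** The solution is its own test function: where u > 1 the product g(x,u) u dominates g(x,u), and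
    where u <= 1 the reaction is bounded. *)
Lemma weak_rhs_integrable u : positive_solution u ->
  intg (fun x => `|g x (u x)| * \1_Om x).
Proof.
move=> [Wu u0 hu]; have [mu_ uz _ _] := Wu.
have [igu _] := hu u Wu.
have [C C0 hC] := reaction_abs_le p1 c00 hg 0.
apply: (@integrable_le _ _ _ _ _ (fun x => C * \1_Om x + `|g x (u x) * u x|)).
- apply: measurable_funM; last exact: measurable_ind.
  by apply: measurableT_comp => //; exact: (measurable_reaction hg).
- move=> x; have [i1 i0] := indE x; have [Ox|nOx] := pselect (Om x); last first.
    by rewrite i0// !mulr0 normr0 add0r.
  rewrite i1// !mulr1 normr_id; have [u1|u1] := leP (u x) 1.
    by apply: (le_trans (hC x _ u1)); rewrite lerDl.
  rewrite normrM (gtr0_norm (u0 x Ox)); apply: (@le_trans _ _ (`|g x (u x)| * u x)).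
    by rewrite ler_peMr// ltW.
  by rewrite lerDr.
- by apply: integrable_addR; [exact/integrable_mulRl/integrable_ind|exact: integrable_normR].
Qed.

(* Test with the Picone function of min v M and let the shift tend to 0; only
   the part of the reaction term below the axis needs to be dominated. *)
Lemma picone_le u v M : positive_solution u -> W v -> (forall x, 0 <= v x <= M) ->
  intg (fun x => Q x (u x) * v x `^ p) /\
  \int[mu]_x (Q x (u x) * v x `^ p) <= energy mu k p v.
Proof.
have p1_ := p1; move=> su Wv v0M; have iO := weak_rhs_integrable su; have [Wu u0 hu] := su.
have [mu_ uz _ _] := Wu; have [mv vz _ _] := Wv.
have u0' x : 0 <= u x.
  by have [/u0/ltW//|/uz->] := pselect (Om x).
(* A point of the space is needed to see that [M] is nonnegative; on an empty space everything is
   0. *)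
have [[x0]|eT] := pselect (inhabited T); last first.
  have E f : f = (fun _ : T => 0 : R).
    by apply/funext => x; exfalso; apply: eT; constructor.
  rewrite (E (fun x => Q x (u x) * v x `^ p)); split; first exact: integrable0.
  rewrite [X in X <= _](_ : _ = 0); first exact: energy_ge0.
  by rewrite /Rintegral integral0.
have M0 : 0 <= M by have /andP[/le_trans h /h] := v0M x0.
pose e n : R := n.+1%:R^-1.
have e0 n : 0 < e n by rewrite invr_gt0.
have e1 n : e n <= 1 by rewrite invf_le1// ler1n.
pose X n x := g x (u x) * picone_test p u v (e n) x.
have WX n := energy_space_picone p1 mk k0 (e0 n) M0 Wu Wv u0' v0M.
have iX n : intg (X n) by exact: (hu _ (WX n)).1.
have IX n : \int[mu]_x X n x <= energy mu k p v.
  by rewrite -(hu _ (WX n)).2; exact: (form_picone p1 mk k0 (e0 n) M0 Wu Wv u0' v0M).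
have [C C0 hC] := reaction_ge p1 hg 0.
pose D := (M + 1) `^ p.
have D0 : 0 <= D by exact: powR_ge0.
have Ptest n x : ~ Om x -> picone_test p u v (e n) x = 0 by have [_ + _ _] := WX n; exact.
apply: (@real_fatou _ _ _ _ X _ (fun x => D * C * \1_Om x + (D + 1) * (`|g x (u x)| * \1_Om x))
   (fun=> energy mu k p v)) => //; last exact: cvg_cst.
- apply: measurable_funM; first exact: measurable_quotient.
  exact: measurable_pow.
- apply: integrable_addR; first exact/integrable_mulRl/integrable_ind.
  exact: integrable_mulRl.
- move=> n x; have [i1 i0] := indE x; have [Ox|nOx] := pselect (Om x); last first.
    by rewrite i0// /X Ptest// !mulr0 addr0 oppr0.
  rewrite i1// !mulr1 /X /picone_test.
  have ux := u0 x Ox; have en := e0 n; have en1 := e1 n.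
  have /andP[vx0 vxM] := v0M x.
  set A := _ / _; rewrite mulrBr.
  have A0 : 0 <= A by rewrite divr_ge0 ?powR_ge0.
  have Nle : (v x + e n) `^ p <= D by apply: ler_wpowR; lra.
  (* A nonnegative reaction needs no bound. For u <= 1 the lower bound -C u^(p-1) compensates the
     denominator of [A]; for u > 1 that denominator exceeds 1, and |g(x,u)|, integrable over [Om],
     dominates. *)
  have h1 : - (D * C + D * `|g x (u x)|) <= g x (u x) * A.
    have [g0|/ltW g0] := leP 0 (g x (u x)).
      apply: (@le_trans _ _ 0); last by rewrite mulr_ge0.
      by rewrite oppr_le0 addr_ge0 ?mulr_ge0.
    have [u1|u1] := leP (u x) 1.
      have h := hC x (u x) (ltW ux) u1.
      have h' : u x `^ (p - 1) * A <= D.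
        rewrite /A mulrCA -[leRHS]mulr1; apply: ler_pM; rewrite ?powR_ge0//.
          by rewrite mulr_ge0 ?invr_ge0 ?powR_ge0.
        rewrite ler_pdivrMr ?powR_gt0 ?mul1r//; last lra.
        by apply: ler_wpowR; lra.
      apply: (@le_trans _ _ (- (C * u x `^ (p - 1)) * A)); last by rewrite ler_wpM2r.
      have h3 : C * (u x `^ (p - 1) * A) <= C * D by rewrite ler_wpM2l.
      have h4 : 0 <= D * `|g x (u x)| by rewrite mulr_ge0.
      by rewrite mulNr lerN2 -mulrA (mulrC D C); lra.
    have h' : A <= D.
      rewrite /A -[leRHS]mulr1; apply: ler_pM; rewrite ?powR_ge0 ?invr_ge0 ?powR_ge0//.
      rewrite invf_le1 ?powR_gt0//; last lra.
      have := @ler_wpowR _ (p - 1) 1 (u x + e n) (ltW pm) ler01.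
      by rewrite powR1; apply; lra.
    rewrite (ler0_norm g0); have : 0 <= D * C by rewrite mulr_ge0.
    have : 0 <= (D - A) * (- g x (u x)) by apply: mulr_ge0; lra.
    by lra.
  have h2 : g x (u x) * e n <= `|g x (u x)|.
    apply: (@le_trans _ _ (`|g x (u x)| * e n)).
      by rewrite ler_wpM2r ?ler_norm// ltW.
    by rewrite ler_piMr.
  by move: h1 h2; lra.
- apply: aeW => x; have [Ox|nOx] := pselect (Om x); last first.
    rewrite (_ : (fun n => X n x) = (fun=> 0)); last first.
      by apply/funext => n; rewrite /X Ptest ?mulr0.
    by rewrite vz// powR0 ?mulr0 ?gt_eqF//; exact: cvg_cst.
  have ux := u0 x Ox; have /andP[vx0 vxM] := v0M x.
  have c1 (a : R) : (fun n => a + e n) @ \oo --> a.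
    by rewrite -[X in _ --> X]addr0; apply: cvgD; [exact: cvg_cst|exact: cvg_invS].
  rewrite /X /picone_test /quotient -mulrA (mulrC _^-1) -[X in _ --> g x (u x) * X]subr0.
  apply: cvgM; first exact: cvg_cst.
  apply: cvgB; last exact: cvg_invS.
  have nn a (a0 : 0 <= a) n : 0 <= a + e n by rewrite addr_ge0// ltW.
  apply: cvgM; first exact: (cvg_powR p0 (nn _ vx0) (c1 _)).
  apply: cvgV; first by rewrite gt_eqF// powR_gt0.
  exact: (cvg_powR pm (nn _ (ltW ux)) (c1 _)).
Qed.

Lemma positive_solution_ge0 u x : positive_solution u -> 0 <= u x.
Proof. by move=> [[_ uz _ _] u0 _]; have [/u0/ltW//|/uz->] := pselect (Om x). Qed.

End positive_solutions.

(** * Uniqueness *)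

Section uniqueness_of_solutions.
Context d (T : measurableType d) (R : realType).
Variable mu : {sigma_finite_measure set T -> \bar R}.
Variables (Om : set T) (k : T * T -> R) (p c0 : R) (g : T -> R -> R).
Hypothesis p1 : 1 < p.
Hypothesis c00 : 0 < c0.
Hypothesis mOm : measurable Om.
Hypothesis fOm : (mu Om < +oo)%E.
Hypothesis mk : measurable_fun setT k.
Hypothesis k0 : forall z, 0 <= k z.
Hypothesis hg : reaction p c0 g.
Local Notation intg f := (mu.-integrable setT (EFin \o (f : T -> R))).
Local Notation W := (energy_space mu Om k p).
Local Notation Q := (quotient p g).
Implicit Types (u v w phi : T -> R).

Local Notation positive_solution := (positive_solution mu Om k p g).

Let p0 : 0 < p. Proof. exact: lt_trans ltr01 p1. Qed.
Let pm : 0 < p - 1. Proof. by rewrite subr_gt0. Qed.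

Lemma uniqueness u v : positive_solution u -> positive_solution v ->
  {ae mu, forall x, u x = v x}.
Proof.
have p1_ := p1; move=> su sv; have [Wu u0 hu] := su; have [Wv v0 hv] := sv.
have [mu_ uz _ _] := Wu; have [mv vz _ _] := Wv.
have u0' x := positive_solution_ge0 x su; have v0' x := positive_solution_ge0 x sv.
pose un n x := Num.min (u x) n.+1%:R; pose vn n x := Num.min (v x) n.+1%:R.
have n0 (n : nat) : 0 <= n.+1%:R :> R by rewrite ler0n.
have Wun n : W (un n) := energy_space_min p1 mk k0 (n0 n) Wu u0'.
have Wvn n : W (vn n) := energy_space_min p1 mk k0 (n0 n) Wv v0'.
have bd (a : R) n : 0 <= a -> 0 <= Num.min a n.+1%:R <= n.+1%:R.
  by move=> a0; rewrite le_min a0 n0 ge_min lexx orbT.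
have Pu n := picone_le p1 c00 mOm fOm mk k0 hg su (Wvn n) (fun x => bd _ n (v0' x)).
have Pv n := picone_le p1 c00 mOm fOm mk k0 hg sv (Wun n) (fun x => bd _ n (u0' x)).
(* [X n] collects the two Picone terms minus the two tested equations, all with truncations, because
   [picone_le] asks for a bounded function. Its limit [Y] factors into a product of sign-definite
   differences. *)
pose X n x := Q x (u x) * vn n x `^ p + Q x (v x) * un n x `^ p
  - (g x (u x) * un n x + g x (v x) * vn n x).
pose Y x := Q x (u x) * v x `^ p + Q x (v x) * u x `^ p
  - (g x (u x) * u x + g x (v x) * v x).
have iX n : intg (X n).
  apply: integrable_subR; apply: integrable_addR.
  - exact: (Pu n).1.
  - exact: (Pv n).1.
  - exact: (hu _ (Wun n)).1.
  - exact: (hv _ (Wvn n)).1.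
(* Each Picone term is at most the energy of a truncation, hence at most the form of the untruncated
   solution against it, which the equation turns into the subtracted reaction term. *)
have IX n : \int[mu]_x X n x <= 0.
  have [iu1 Iu1] := Pu n; have [iv1 Iv1] := Pv n.
  have [iu2 Iu2] := hu _ (Wun n); have [iv2 Iv2] := hv _ (Wvn n).
  rewrite RintegralBT; [|exact: integrable_addR..].
  rewrite !RintegralDT// -Iu2 -Iv2.
  rewrite subr_le0 addrC; apply: lerD.
    by apply: (le_trans Iv1); exact: (energy_min_le_form p1 mk k0 (n0 n) Wu u0').
  by apply: (le_trans Iu1); exact: (energy_min_le_form p1 mk k0 (n0 n) Wv v0').
have YE x : Om x -> Y x = (Q x (u x) - Q x (v x)) * (v x `^ p - u x `^ p).
  by move=> Ox; rewrite /Y -(quotientM g p1 x (u0 x Ox)) -(quotientM g p1 x (v0 x Ox)); ring.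
have Yz x : ~ Om x -> Y x = 0.
  by move=> Ox; rewrite /Y uz// vz// powR0 ?gt_eqF//; ring.
have Y0 x : 0 <= Y x.
  have [Ox|/Yz->//] := pselect (Om x); rewrite YE//.
  have ux := u0 x Ox; have vx := v0 x Ox; have [uv|/ltW vu] := leP (u x) (v x).
    rewrite mulr_ge0 ?subr_ge0//; first exact: (quotient_le hg).
    by apply: ler_wpowR; lra.
  rewrite mulr_le0 ?subr_le0//; first exact: (quotient_le hg).
  by apply: ler_wpowR; lra.
have [iY IY] : intg Y /\ \int[mu]_x Y x <= 0.
  apply: (@real_fatou _ _ _ _ X _
    (fun x => `|g x (u x) * u x| + `|g x (v x) * v x|) (fun=> 0)) => //; last exact: cvg_cst.
  - apply: measurable_funB; apply: measurable_funD; apply: measurable_funM => //;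
      try exact: measurable_pow; try exact: (measurable_quotient hg);
      exact: (measurable_reaction hg).
  - apply: integrable_addR; apply: integrable_normR.
      exact: (hu _ Wu).1.
    exact: (hv _ Wv).1.
  - move=> n x; have [Ox|nOx] := pselect (Om x); last first.
      rewrite /X /un /vn uz// vz// min_l// powR0 ?gt_eqF// !mulr0 normr0 !addr0.
      by rewrite subr0 oppr0.
    have ux := u0 x Ox; have vx := v0 x Ox.
    have unx := bd _ n (u0' x); have vnx := bd _ n (v0' x).
    (* With b = min(a, n+1) the difference of the two sides is Q(a) (a^(p-1) b - b^p) up to sign,
       and the bracket lies between 0 and a^p; the absolute value of g(x,a) a therefore pays for
       it. *)
    have key a : 0 < a -> g x a * Num.min a n.+1%:R <=
        Q x a * Num.min a n.+1%:R `^ p + `|g x a * a|.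
      move=> a0; set b := Num.min a _.
      have b0 : 0 <= b by rewrite le_min (ltW a0) n0.
      have ba : b <= a by rewrite ge_min lexx.
      have h1 : b `^ p <= a `^ (p - 1) * b.
        rewrite -(mulr_powRB1 b0 p0) mulrC ler_wpM2r//; apply: ler_wpowR => //.
        exact: ltW.
      rewrite -(quotientK p g x a0) normrM normrM (gtr0_norm (powR_gt0 _ a0)).
      rewrite (gtr0_norm a0); move: (Q x a) => q.
      have h2 : a `^ (p - 1) * b <= a `^ (p - 1) * a by rewrite ler_wpM2l ?powR_ge0.
      move: h1 h2 (powR_ge0 b p); rewrite -!mulrA.
      move: (b `^ p) (a `^ (p - 1) * b) (a `^ (p - 1) * a) => B1 B2 B3 h1 h2 q0.
      rewrite -lerBlDl -mulrBr; have : q * (B2 - B1) <= `|q * (B2 - B1)|.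
        exact: ler_norm.
      move=> h; apply: (le_trans h); rewrite normrM ler_wpM2l// ger0_norm ?subr_ge0//.
      by rewrite lerBlDr (le_trans h2)// lerDl.
    (* Truncation preserves the order of [u] and [v]. This exchanges the mixed terms for the
       diagonal ones, to which [key] applies. *)
    have kmon : 0 <= (Q x (u x) - Q x (v x)) * (vn n x `^ p - un n x `^ p).
      have [uv|/ltW vu] := leP (u x) (v x).
        rewrite mulr_ge0 ?subr_ge0//; first exact: (quotient_le hg).
        apply: ler_wpowR => //; first exact: ltW. by case/andP: unx.
        by rewrite /un /vn le_min !ge_min uv lexx orbT.
      rewrite mulr_le0 ?subr_le0//; first exact: (quotient_le hg).
      apply: ler_wpowR => //; first exact: ltW. by case/andP: vnx.
      by rewrite /un /vn le_min !ge_min vu lexx orbT.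
    have := key _ ux; have := key _ vx; rewrite /X -/(un n x) -/(vn n x).
    by move: kmon; rewrite mulrBr !mulrBl; lra.
  - apply: aeW => x.
    have cu := @cvg_min_nat R (u x); have cv := @cvg_min_nat R (v x).
    have nn (a : R) (a0 : 0 <= a) (n : nat) : 0 <= Num.min a n.+1%:R by rewrite le_min a0 n0.
    apply: cvgB; apply: cvgD; apply: cvgM; try exact: cvg_cst; try exact: cu; try exact: cv.
      exact: (cvg_powR p0 (nn _ (v0' x)) cv).
    exact: (cvg_powR p0 (nn _ (u0' x)) cu).
apply: filterS (ge0_Rintegral_eq0 iY Y0 IY) => x Yx0.
have [Ox|nOx] := pselect (Om x); last by rewrite uz// vz.
have ux := u0 x Ox; have vx := v0 x Ox; move: Yx0; rewrite YE//.
have [uv|vu|//] := ltgtP (u x) (v x) => /eqP; rewrite mulf_eq0 !subr_eq0 => /orP[]/eqP.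
- by have := reaction_decr hg x ux uv; rewrite -/(Q x _) -/(Q x _) => /lt_eqF/eqP; congruence.
- by have := ltr_wpowR p0 (ltW ux) uv => /lt_eqF/eqP; congruence.
- by have := reaction_decr hg x vx vu; rewrite -/(Q x _) -/(Q x _) => /lt_eqF/eqP; congruence.
- by have := ltr_wpowR p0 (ltW vx) vu => /lt_eqF/eqP; congruence.
Qed.

End uniqueness_of_solutions.

(** * Compactness and the spectral gap *)

Section compactness.
Context d (T : measurableType d) (R : realType).
Variable mu : {sigma_finite_measure set T -> \bar R}.
Variables (Om : set T) (k : T * T -> R) (p c0 : R) (g : T -> R -> R).
Hypothesis p1 : 1 < p.
Hypothesis mk : measurable_fun setT k.
Hypothesis k0 : forall z, 0 <= k z.
Local Notation intg f := (mu.-integrable setT (EFin \o (f : T -> R))).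
Local Notation W := (energy_space mu Om k p).
Implicit Types (u v w phi : T -> R).


Let p0 : 0 < p. Proof. exact: lt_trans ltr01 p1. Qed.

(** The form of compactness that the limits use: almost everywhere convergence together with a
    common majorant of the p-th powers. The index map need only satisfy [n <= f n], which already
    carries limits at infinity along it. *)
Definition compact_embedding : Prop := forall (w : nat -> T -> R) (M : R),
  (forall n, W (w n)) -> (forall n, \int[mu]_x (`|w n x| `^ p) <= M) ->
  (forall n, energy mu k p (w n) <= M) ->
  exists (f : nat -> nat) (u H : T -> R),
    [/\ (forall n, (n <= f n)%N),
        measurable_fun setT u /\ (forall x, ~ Om x -> u x = 0), intg H,
        {ae mu, forall x n, `|w (f n) x| `^ p <= H x} &
        {ae mu, forall x, (fun n => w (f n) x) @ \oo --> u x}].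

(** Fatou on the product space for the energy, dominated convergence for the norm. *)
Lemma energy_lsc (w : nat -> T -> R) (u H : T -> R) : (forall n, W (w n)) ->
  measurable_fun setT u -> (forall x, ~ Om x -> u x = 0) -> intg H ->
  {ae mu, forall x n, `|w n x| `^ p <= H x} ->
  {ae mu, forall x, w ^~ x @ \oo --> u x} ->
  (limn_einf (fun n => (energy mu k p (w n))%:E) < +oo)%E ->
  [/\ W u, ((energy mu k p u)%:E <= limn_einf (fun n => (energy mu k p (w n))%:E))%E &
    \int[mu]_x (`|w n x| `^ p) @[n --> \oo] --> \int[mu]_x (`|u x| `^ p)].
Proof.
move=> Ww mu_ uz iH wH wu loo.
have mw n : measurable_fun setT (w n) by case: (Ww n).
have [iu Iu] : intg (fun x => `|u x| `^ p) /\
    \int[mu]_x (`|w n x| `^ p) @[n --> \oo] --> \int[mu]_x (`|u x| `^ p).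
  apply: (dominated_cvgR (G := H)) => //.
  - by move=> n; exact: measurable_normr_powR.
  - exact: measurable_normr_powR.
  - by apply: filterS wH => x h n; rewrite ger0_norm ?powR_ge0.
  - by apply: filterS wu => x h; exact: cvg_normr_powR.
have dE n : (\int[mu \x mu]_z (energy_density k p (w n) z)%:E)%E = (energy mu k p (w n))%:E.
  by rewrite EFin_Rintegral//; case: (Ww n).
have le : (\int[mu \x mu]_z (energy_density k p u z)%:E <=
    limn_einf (fun n => (energy mu k p (w n))%:E))%E.
  rewrite -(funext dE); apply: fatou_ae.
  - by move=> n; apply/measurable_EFinP; exact: measurable_energy_density.
  - by apply/measurable_EFinP; exact: measurable_energy_density.
  - by move=> n z; rewrite lee_fin energy_density_ge0.
  - by move=> z; rewrite lee_fin energy_density_ge0.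
  - apply: filterS (ae_prod wu wu) => z [h1 h2].
    have : (energy_density k p (w n) z)%:E @[n --> \oo] --> (energy_density k p u z)%:E.
      apply/cvg_EFin; [exact: nearW|apply: cvgM; last exact: cvg_cst].
      by apply: cvg_normr_powR => //; exact: cvgB.
    by move=> /cvg_limn_einf_sup[->].
have Wu : W u.
  split=> //; apply: ge0_integrable_lt.
  - exact: measurable_energy_density.
  - by move=> z; exact: energy_density_ge0.
  - exact: le_lt_trans le loo.
by split=> //; rewrite -EFin_Rintegral//; case: Wu.
Qed.

Lemma ge0_weighted_integral (b : T -> \bar R) v : (forall x, (0 <= b x)%E) ->
  (0 <= \int[mu]_x (b x * (`|v x| `^ p)%:E))%E.
Proof. by move=> b0; apply: integral_ge0 => x _; rewrite mule_ge0// lee_fin powR_ge0. Qed.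

Lemma measurable_weighted (b : T -> \bar R) v : measurable_fun setT b ->
  measurable_fun setT v -> measurable_fun setT (fun x => (b x * (`|v x| `^ p)%:E)%E).
Proof.
by move=> mb mv; apply: emeasurable_funM => //; exact/measurable_EFinP/measurable_normr_powR.
Qed.

(** All terms are homogeneous of degree p, so scaling by s^(-1/p) gives norm 1. *)
Lemma normalise (C : R) (b : T -> \bar R) v : measurable_fun setT b ->
  (forall x, (0 <= b x)%E) -> W v ->
  ((energy mu k p v)%:E + \int[mu]_x (b x * (`|v x| `^ p)%:E)
     < (C * \int[mu]_x (`|v x| `^ p))%:E)%E ->
  exists w, [/\ W w, \int[mu]_x (`|w x| `^ p) = 1 &
    ((energy mu k p w)%:E + \int[mu]_x (b x * (`|w x| `^ p)%:E) <= C%:E)%E].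
Proof.
move=> mb b0 Wv hv; have [mv vz iv ev] := Wv.
set s := \int[mu]_x _ in hv.
(* The left side of the strict inequality is nonnegative, so a zero norm would make it read 0 <
   0. *)
have s0 : 0 < s.
  have := le_lt_trans (adde_ge0 _ (ge0_weighted_integral v b0)) hv.
  rewrite lee_fin lte_fin => /(_ (energy_ge0 _ p k0 v)) Cs.
  have : 0 <= s by apply: Rintegral_ge0T => x; exact: powR_ge0.
  by rewrite le_eqVlt => /orP[/eqP s0|//]; rewrite -s0 mulr0 ltxx in Cs.
pose t := s `^ (- p^-1).
have tp : `|t| `^ p = s^-1.
  rewrite ger0_norm ?powR_ge0// -powRrM mulNr mulVf ?gt_eqF// powR_inv1 ?ltW//.
exists (fun x => t * v x); split.
- exact: (energy_spaceZ p1 mk k0 t Wv).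
- under eq_Rintegral => x _ do rewrite normrM powRM//.
  by rewrite RintegralZT// tp mulVf// gt_eqF.
rewrite (energyZ t Wv) tp.
have -> : (\int[mu]_x (b x * (`|t * v x| `^ p)%:E) =
    s^-1%:E * \int[mu]_x (b x * (`|v x| `^ p)%:E))%E.
  rewrite -ge0_integralZl//.
  - by apply: eq_integral => x _; rewrite normrM powRM// tp EFinM muleCA.
  - exact: measurable_weighted.
  - by move=> x _; rewrite mule_ge0// lee_fin powR_ge0.
  - by rewrite lee_fin invr_ge0 ltW.
rewrite EFinM -ge0_muleDr ?lee_fin ?(energy_ge0 _ p k0)//; last exact: ge0_weighted_integral.
rewrite lee_pdivrMl// -EFinM mulrC; exact: ltW.
Qed.

(** If no weight of the sequence had a gap, normalised functions violating the inequality with gap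
    1/(n+1) would have, by compactness, a limit of norm 1 that contradicts strict positivity for the
    limit weight. It is used with a constant sequence for necessity and with weights
    [2 * c0 - Q x n.+1%:R] for existence. *)
Lemma spectral_gap (C : R) (b_ : nat -> T -> \bar R) (b : T -> \bar R) :
  compact_embedding -> 0 <= C ->
  (forall n, measurable_fun setT (b_ n)) -> measurable_fun setT b ->
  (forall n x, (0 <= b_ n x)%E) -> (forall x, (0 <= b x)%E) ->
  (forall x, Om x -> b_ ^~ x @ \oo --> b x) ->
  (forall v, W v -> ~ {ae mu, forall x, v x = 0} ->
     ((C * \int[mu]_x (`|v x| `^ p))%:E <
       (energy mu k p v)%:E + \int[mu]_x (b x * (`|v x| `^ p)%:E))%E) ->
  exists n (dl : R), 0 < dl /\ forall v, W v ->
    (((C + dl) * \int[mu]_x (`|v x| `^ p))%:E <=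
       (energy mu k p v)%:E + \int[mu]_x (b_ n x * (`|v x| `^ p)%:E))%E.
Proof.
move=> cpt C0 mb_ mb b_0 b0 bb hb; apply: contrapT => nex.
have /choice[w hw] : forall n : nat, exists w, [/\ W w, \int[mu]_x (`|w x| `^ p) = 1 &
    ((energy mu k p w)%:E + \int[mu]_x (b_ n x * (`|w x| `^ p)%:E)
       <= (C + n.+1%:R^-1)%:E)%E].
  move=> n; apply: contrapT => nw; apply: nex; exists n, n.+1%:R^-1.
  split; first by rewrite invr_gt0.
  move=> v Wv; rewrite leNgt; apply/negP => hv; apply: nw.
  exact: (normalise (mb_ n) (b_0 n) Wv hv).
have n1 (n : nat) : n.+1%:R^-1 <= 1 :> R by rewrite invf_le1// ler1n.
have Ew n : energy mu k p (w n) <= C + 1.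
  have [_ _ h] := hw n; rewrite -lee_fin; apply: (@le_trans _ _ (C + n.+1%:R^-1)%:E).
    by apply: le_trans h; rewrite leeDl// ge0_weighted_integral.
  by rewrite lee_fin lerD2l.
have [f [u [H [fn [mu_ uz] iH wH wu]]]] : exists (f : nat -> nat) (u H : T -> R),
    [/\ (forall n, (n <= f n)%N),
        measurable_fun setT u /\ (forall x, ~ Om x -> u x = 0), intg H,
        {ae mu, forall x n, `|w (f n) x| `^ p <= H x} &
        {ae mu, forall x, (fun n => w (f n) x) @ \oo --> u x}].
  apply: (cpt w (C + 1)) => [n|n|//]; first by have [] := hw n.
  by have [_ -> _] := hw n; rewrite lerDr.
have Ww n : W (w (f n)) by have [] := hw (f n).
have loo : (limn_einf (fun n => (energy mu k p (w (f n)))%:E) < +oo)%E.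
  apply: (@le_lt_trans _ _ (C + 1)%:E); last exact: ltry.
  have c1 : (fun _ : nat => (C + 1)%:E) @ \oo --> (C + 1)%:E by exact: cvg_cst.
  have [<- _] := cvg_limn_einf_sup c1.
  by apply: limn_einf_le => n; rewrite lee_fin.
have [Wu Eu Iu] := energy_lsc Ww mu_ uz iH wH wu loo.
have Iu1 : \int[mu]_x (`|u x| `^ p) = 1.
  rewrite -(cvg_lim (@Rhausdorff R) Iu) (_ : (fun n => _) = (fun=> 1)) ?lim_cst//.
  by apply/funext => n; have [] := hw (f n).
have u0 : ~ {ae mu, forall x, u x = 0}.
  move=> u0; have [_ _ iu _] := Wu.
  have : (\int[mu]_x (`|u x| `^ p)%:E = \int[mu]_x (0 : R)%:E)%E.
    apply: ae_eq_integral => //; first exact: measurable_int iu.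
    by apply: filterS u0 => x -> _; rewrite normr0 powR0// gt_eqF.
  rewrite EFin_Rintegral// Iu1 integral0 => /eqP; rewrite eqe oner_eq0//.
have := hb u Wu u0; rewrite Iu1 mulr1 ltNge => /negP; apply.
have fB : (\int[mu]_x (b x * (`|u x| `^ p)%:E) <=
    limn_einf (fun n => \int[mu]_x (b_ (f n) x * (`|w (f n) x| `^ p)%:E)))%E.
  apply: fatou_ae.
  - by move=> n; apply: measurable_weighted; [exact: mb_|case: (Ww n)].
  - exact: measurable_weighted.
  - by move=> n x; rewrite mule_ge0// lee_fin powR_ge0.
  - by move=> x; rewrite mule_ge0// lee_fin powR_ge0.
  (* Where the limit vanishes the integrand is 0 even for an infinite weight; elsewhere the point
     lies in [Om] and the products converge, since a nonzero factor excludes 0 times +oo. *)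
  - apply: filterS wu => x h; have [ux0|ux0] := eqVneq (u x) 0.
      rewrite ux0 normr0 powR0 ?gt_eqF// mule0; apply: limn_einf_ge0 => n.
      by rewrite mule_ge0// lee_fin powR_ge0.
    have Ox : Om x by apply: contrapT => /uz/eqP; rewrite (negPf ux0).
    have cb : (fun n => b_ (f n) x) @ \oo --> b x.
      apply: (@cvg_comp _ _ _ f (b_ ^~ x) _ \oo); last exact: bb.
      move=> A [N _ NA]; exists N => // n /= Nn; apply: NA => /=.
      exact: leq_trans Nn (fn n).
    have cw : (`|w (f n) x| `^ p)%:E @[n --> \oo] --> (`|u x| `^ p)%:E.
      by apply/cvg_EFin; [exact: nearW|exact: cvg_normr_powR].
    have up0 : 0 < `|u x| `^ p by rewrite powR_gt0// normr_gt0.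
    have md : mule_def (b x) (`|u x| `^ p)%:E.
      rewrite mule_defE.
      have -> : ((`|u x| `^ p)%:E == 0)%E = false by apply/negbTE; rewrite gt_eqF// lte_fin.
      by rewrite andFb orbF andbF.
    by have [-> _] := cvg_limn_einf_sup (cvgeM md cb cw).
apply: (le_trans (leeD Eu fB)).
apply: (le_trans (limn_einf_superadd _ _)) => [n|n|].
- by rewrite lee_fin energy_ge0.
- exact: ge0_weighted_integral.
have cC : (C + (f n).+1%:R^-1)%:E @[n --> \oo] --> C%:E.
  apply/cvg_EFin; first exact: nearW.
  rewrite -[X in _ --> X]addr0; apply: cvgD; first exact: cvg_cst.
  apply: (@cvg_comp _ _ _ f (fun n => n.+1%:R^-1) _ \oo); last exact: cvg_invS.
  move=> A [N _ NA]; exists N => // n /= Nn; apply: NA => /=.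
  exact: leq_trans Nn (fn n).
have [<- _] := cvg_limn_einf_sup cC.
by apply: limn_einf_le => n; have [] := hw (f n).
Qed.

End compactness.

(** * Necessary conditions *)

Section necessary_conditions.
Context d (T : measurableType d) (R : realType).
Variable mu : {sigma_finite_measure set T -> \bar R}.
Variables (Om : set T) (k : T * T -> R) (p c0 : R) (g : T -> R -> R).
Hypothesis p1 : 1 < p.
Hypothesis c00 : 0 < c0.
Hypothesis mOm : measurable Om.
Hypothesis fOm : (mu Om < +oo)%E.
Hypothesis mk : measurable_fun setT k.
Hypothesis k0 : forall z, 0 <= k z.
Hypothesis hg : reaction p c0 g.
Local Notation intg f := (mu.-integrable setT (EFin \o (f : T -> R))).
Local Notation W := (energy_space mu Om k p).
Local Notation Q := (quotient p g).
Implicit Types (u v w phi : T -> R).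

Local Notation positive_solution := (positive_solution mu Om k p g).

Let p0 : 0 < p. Proof. exact: lt_trans ltr01 p1. Qed.

Local Notation compact_embedding := (compact_embedding mu Om k p).

Lemma form_diag u : W u -> form mu k p u u = energy mu k p u.
Proof.
move=> _; apply: eq_Rintegral => z _.
by rewrite /form_density jp_mul.
Qed.

Lemma lambda_zero_necessary (a : T -> \bar R) u : positive_solution u ->
  mu Om != 0%E -> measurable_fun Om a ->
  (forall x t, Om x -> 0 < t -> ((Q x t)%:E < a x)%E) ->
  ((energy mu k p u)%:E < \int[mu]_(x in Om) (a x * (`|u x| `^ p)%:E))%E.
Proof.
move=> su Om0 ma Qa; have [Wu u0 hu] := su; have [mu_ uz iu eu] := Wu.
have [ig Ig] := hu u Wu.
rewrite -(form_diag Wu) Ig -EFin_Rintegral//.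
have -> : (\int[mu]_x (g x (u x) * u x)%:E = \int[mu]_(x in Om) (g x (u x) * u x)%:E)%E.
  rewrite [RHS]integral_mkcond; apply: eq_integral => x _; rewrite patchE.
  by case: ifPn => //; rewrite notin_setE => /uz ->; rewrite mulr0.
apply: lt_integral => //.
- by apply: integrableS ig.
- apply: emeasurable_funM => //; apply/measurable_EFinP.
  by apply: measurable_funTS; exact: measurable_normr_powR.
- move=> x Ox; have ux := u0 x Ox.
  rewrite -(quotientM g p1 x ux) (gtr0_norm ux) EFinM.
  by rewrite lte_pmul2r// ?lte_fin ?powR_gt0//; exact: Qa.
Qed.

(** The Picone bound gives a non-strict inequality with the weight Q(x,u). Since [a] lies strictly
    below Q(x,u), the inequality for [a] is strict for every nonzero [v], and [spectral_gap] turns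
    strictness into a uniform gap. *)
Lemma lambda_infty_necessary (a : T -> \bar R) (C : R) u : positive_solution u ->
  compact_embedding -> 0 <= C -> measurable_fun setT a ->
  (forall x t, 0 < t -> (a x < (Q x t)%:E)%E) -> (forall x, (a x < C%:E)%E) ->
  exists2 dl : R, 0 < dl & forall v, W v ->
    (((C + dl) * \int[mu]_x (`|v x| `^ p))%:E <=
       (energy mu k p v)%:E + \int[mu]_x ((C%:E - a x) * (`|v x| `^ p)%:E))%E.
Proof.
move=> su cpt C0 ma aQ aC; have [Wu u0 hu] := su; have [mu_ uz iu eu] := Wu.
have mb : measurable_fun setT (fun x => C%:E - a x)%E by exact: emeasurable_funB.
have b0 x : (0 <= C%:E - a x)%E by rewrite ltW// sube_gt0.
have [||||||n [dl [dl0 hdl]]] := @spectral_gap _ _ _ mu Om k p p1 mk k0 C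
  (fun=> (fun x => C%:E - a x)%E) (fun x => C%:E - a x)%E cpt C0 => //.
  by move=> x _; exact: cvg_cst.
2: by exists dl.
move=> v Wv v0; have [mv vz iv ev] := Wv.
(* The cap at [C] keeps C - al nonnegative. As [a] is strictly below both Q(x,u) and [C], it stays
   strictly below [al] in [Om]. *)
pose al x := Num.min (Q x (u x)) C.
pose be x := C - al x.
have be0 x : 0 <= be x by rewrite subr_ge0 ge_min lexx orbT.
have mal : measurable_fun setT al.
  by apply: measurable_minr => //; exact: (measurable_quotient hg).
have mbe : measurable_fun setT be by exact: measurable_funB.
have mvp : measurable_fun setT (fun x => `|v x| `^ p) by exact: measurable_normr_powR.
have beb x : Om x -> ((be x)%:E < C%:E - a x)%E.
  move=> Ox; have : (a x < (al x)%:E)%E.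
    by rewrite /al; case: (leP (Q x (u x)) C) => _; [exact/aQ/u0|exact: aC].
  rewrite /be; case: (a x) => [r| |] //=; last by rewrite /= ltry.
  by rewrite -EFinB !lte_fin ltrD2l ltrN2.
pose D := Om `&` [set x | v x != 0].
have mD : measurable D.
  apply: measurableI => //; rewrite -[X in measurable X]setTI.
  rewrite (_ : [set x | v x != 0] = v @^-1` (~` [set 0])).
    by apply: mv => //; exact: measurableC.
  by apply/seteqP; split=> x /= /eqP.
have D0 : mu D != 0%E.
  apply/eqP => D0; apply: v0; exists D; split=> // x /= vx.
  have {}vx : v x != 0 by apply/eqP.
  by split=> //; apply: contrapT => /vz /eqP; rewrite (negPf vx).
have restr (c : T -> \bar R) : (\int[mu]_x (c x * (`|v x| `^ p)%:E) =
    \int[mu]_(x in D) (c x * (`|v x| `^ p)%:E))%E.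
  rewrite [RHS]integral_mkcond; apply: eq_integral => x _; rewrite patchE.
  case: ifPn => //; rewrite notin_setE => nD.
  have -> : v x = 0.
    by apply: contrapT => /eqP vx; apply: nD; split=> //; apply: contrapT => /vz/eqP;
      rewrite (negPf vx).
  by rewrite normr0 powR0 ?gt_eqF// mule0.
have key : intg (fun x => be x * `|v x| `^ p) ->
    C * \int[mu]_x (`|v x| `^ p) <= energy mu k p v + \int[mu]_x (be x * `|v x| `^ p).
  (* The Picone bound needs a bounded nonnegative function. Truncating |v| does not raise the
     energy, nor the integral with the nonnegative weight [be]. *)
  move=> ibe; pose vn n x := Num.min `|v x| n.+1%:R.
  have n0 (n : nat) : 0 <= n.+1%:R :> R by rewrite ler0n.
  have Wn := energy_space_norm p1 mk k0 Wv.
  have Wvn n : W (vn n) by apply: energy_space_min.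
  have vn0 n x : 0 <= vn n x by rewrite le_min normr_ge0 n0.
  have vnv n x : vn n x <= `|v x| by rewrite ge_min lexx.
  have bd n x : 0 <= vn n x <= n.+1%:R by rewrite vn0 ge_min lexx orbT.
  have Pn n := picone_le p1 c00 mOm fOm mk k0 hg su (Wvn n) (bd n).
  have En n : energy mu k p (vn n) <= energy mu k p v.
    apply: (energy_contr p1 k0 Wv (Wvn n)) => x y.
    by apply: (le_trans (minr_contr _ _ _)); exact: ler_dist_dist.
  have ivn n : intg (fun x => vn n x `^ p).
    have [_ _ + _] := Wvn n; apply: integrable_eqR => x.
    by rewrite ger0_norm.
  have ibn n : intg (fun x => be x * vn n x `^ p).
    apply: integrable_le ibe.
      by apply: measurable_funM => //; exact: (integrable_measurable (ivn n)).
    move=> x; rewrite ger0_norm ?mulr_ge0 ?powR_ge0//.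
    by rewrite ler_wpM2l// ler_wpowR// ltW.
  have bn n : C * \int[mu]_x (vn n x `^ p) <=
      energy mu k p v + \int[mu]_x (be x * `|v x| `^ p).
    have [iP IP] := Pn n.
    rewrite -RintegralZT//.
    apply: (@le_trans _ _ (\int[mu]_x (Q x (u x) * vn n x `^ p + be x * vn n x `^ p))).
      apply: ler_Rintegral; [exact: integrable_mulRl|exact: integrable_addR|].
      move=> x; rewrite -mulrDl ler_wpM2r ?powR_ge0//.
      by rewrite /be addrCA lerDl subr_ge0 ge_min lexx.
    rewrite (RintegralDT iP (ibn n)); apply: lerD; first exact: le_trans IP (En n).
    apply: ler_Rintegral => // x.
    by rewrite ler_wpM2l// ler_wpowR// ltW.
  have [_ cI] : intg (fun x => `|v x| `^ p) /\
      \int[mu]_x (vn n x `^ p) @[n --> \oo] --> \int[mu]_x (`|v x| `^ p).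
    apply: (dominated_cvgR (G := fun x => `|v x| `^ p)) => //.
    - by move=> n; exact: (integrable_measurable (ivn n)).
    - apply: aeW => x n; rewrite ger0_norm ?powR_ge0//.
      by rewrite ler_wpowR// ltW.
    - apply: aeW => x; apply: (cvg_powR p0 (fun n => vn0 n x)).
      exact: (@cvg_min_nat R).
  have cI' : C * \int[mu]_x (vn n x `^ p) @[n --> \oo] --> C * \int[mu]_x (`|v x| `^ p).
    by apply: cvgM => //; exact: cvg_cst.
  rewrite -(cvg_lim (@Rhausdorff R) cI'); apply: limr_le; first exact: cvgP cI'.
  exact: nearW.
have mbev : measurable_fun setT (fun x => be x * `|v x| `^ p) by exact: measurable_funM.
have bev0 x : 0 <= be x * `|v x| `^ p by rewrite mulr_ge0 ?powR_ge0.
(* An infinite integral for the weight [be] forces the one for the larger weight C - a to be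
   infinite, and the inequality is trivial. *)
have [Ioo|Ioo] := eqVneq (\int[mu]_x (be x * `|v x| `^ p)%:E)%E +oo%E.
  have -> : (\int[mu]_x ((C%:E - a x) * (`|v x| `^ p)%:E) = +oo)%E.
    apply/eqP; rewrite -leye_eq -Ioo; under eq_integral => x _ do rewrite EFinM.
    rewrite (restr (fun x => (be x)%:E)) (restr (fun x => C%:E - a x)%E).
    apply: ge0_le_integral => //.
    - by move=> x _; rewrite mule_ge0// lee_fin ?powR_ge0.
    - apply: measurable_funTS; apply: emeasurable_funM; exact/measurable_EFinP.
    - apply: measurable_funTS; apply: emeasurable_funM => //; exact/measurable_EFinP.
    - move=> x [Ox _]; rewrite lee_wpmul2r// ?lee_fin ?powR_ge0//.
      by apply: ltW; exact: beb.
  by rewrite addey// ltry.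
have ibe : intg (fun x => be x * `|v x| `^ p).
  by apply: ge0_integrable_lt => //; rewrite ltey.
apply: (@le_lt_trans _ _ ((energy mu k p v)%:E + \int[mu]_x (be x * `|v x| `^ p)%:E)%E).
  by rewrite EFin_Rintegral// lee_fin; exact: key.
rewrite lteD2lE//; under eq_integral => x _ do rewrite EFinM.
rewrite (restr (fun x => (be x)%:E)) (restr (fun x => C%:E - a x)%E).
under eq_integral => x _ do rewrite -EFinM.
apply: lt_integral => //.
- by apply: integrableS ibe.
- apply: measurable_funTS; apply: emeasurable_funM => //; exact/measurable_EFinP.
- move=> x [Ox vx]; rewrite EFinM lte_pmul2r//; first exact: beb.
  by rewrite lte_fin powR_gt0// normr_gt0.
Qed.

End necessary_conditions.

(** * Minimisation *)

Section primitive.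
Context d (T : measurableType d) (R : realType) (p c0 : R) (g : T -> R -> R).
Hypothesis hg : reaction p c0 g.
Local Notation leb := (@lebesgue_measure R).

(* Starting the integral at -1 makes the primitive two-sided differentiable at
   the origin, where g is constant on the left. *)
Definition primitive x (t : R) : R :=
  \int[leb]_(tau in `[-1, t]) g x tau - g x 0.

Lemma reaction_integrable x u : leb.-integrable `[-1, u] (EFin \o g x).
Proof.
apply: continuous_compact_integrable; first exact: segment_compact.
by apply: continuous_subspaceT => z; exact: (reaction_continuous hg).
Qed.

Lemma primitive_derive x (t : R) : - 1 < t -> is_derive t (1 : R) (primitive x) (g x t).
Proof.
move=> t1; have tt1 : t < t + 1 by rewrite ltrDl.
have cg : {for t, continuous (g x)} by exact: (reaction_continuous hg).
have [d1 d2] := continuous_FTC1_closed tt1 (@reaction_integrable x _) t1 cg.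
rewrite derive1E in d2.
have h := DeriveDef d1 d2.
by rewrite -[g x t]subr0; apply: is_deriveB h _.
Qed.

Lemma primitive0 x : primitive x 0 = 0.
Proof.
apply/eqP; rewrite subr_eq0 (@eq_Rintegral _ _ _ _ _ (fun=> g x 0)); last first.
  by move=> t; rewrite inE /= in_itv/= => /andP[_ t0]; rewrite (reaction_neg hg).
rewrite Rintegral_cst; last exact: measurable_itv.
have e1 : fine (leb `[-1, 0]%classic) = 1.
  by rewrite lebesgue_measure_itv /= lte_fin ltrN10 /= sub0r opprK.
by rewrite [X in _ * X]e1 mulr1.
Qed.

Lemma primitive_MVT x a b : - 1 < a -> - 1 < b -> exists xi,
  [/\ Num.min a b <= xi, xi <= Num.max a b &
    primitive x b - primitive x a = g x xi * (b - a)].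
Proof.
wlog ab : a b / a <= b.
  move=> h a1 b1; have [ab|/ltW ba] := leP a b.
    by have := h a b ab a1 b1; rewrite min_l// max_r.
  have [xi [h1 h2 h3]] := h b a ba b1 a1; exists xi; split.
  - by move: h1; rewrite min_l.
  - by move: h2; rewrite max_r.
  - by rewrite -opprB h3 -mulrN opprB.
move=> a1 b1; rewrite min_l// max_r//.
have dv z : z \in `]a, b[ -> is_derive z (1 : R) (primitive x) (g x z).
  by rewrite in_itv/= => /andP[az _]; apply: primitive_derive; lra.
have cv : {within `[a, b], continuous (primitive x)}.
  apply: derivable_within_continuous => z; rewrite in_itv/= => /andP[az _].
  have z1 : - 1 < z by lra.
  by have [] := primitive_derive x z1.
have [c] := MVT_segment ab dv cv.
by rewrite in_itv/= => /andP[h1 h2] h3; exists c.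
Qed.

(** The primitive is concave as a function of t^p: p F(x,t) - Q(x,a) t^p has derivative p t^(p-1)
    (Q(x,t) - Q(x,a)), positive before [a] and negative after, so its maximum is at [a]. *)
Lemma primitive_quotient x a b : 1 < p -> 0 < a -> 0 <= b ->
  p * (primitive x b - primitive x a) <= quotient p g x a * (b `^ p - a `^ p).
Proof.
move=> p1 a0 b0; have p0 : 0 < p by lra.
have pm : 0 < p - 1 by lra.
set q := quotient p g x a.
(* The positive part makes the power continuous across 0, as the mean value theorem on [0,a]
   requires. *)
pose psi t := p * primitive x t - q * (Num.max 0 t) `^ p.
have dpsi (z : R) : 0 < z -> is_derive z (1 : R) psi
    (p * g x z - q * (p * z `^ (p - 1))).
  move=> z0; apply: is_deriveB.
    by apply: is_deriveZ; apply: primitive_derive; lra.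
  apply: is_deriveZ; apply: (@near_eq_is_derive _ _ _ (fun t : R => t `^ p)).
    near=> t; rewrite max_r//; near: t.
    by exists z => // t /=; rewrite ltr_norml; lra.
  apply: DeriveDef; first by apply: (@derivable_powR R 1 p); rewrite in_itv/= andbT.
  by rewrite -derive1E (@powR_derive1 _ p z)// in_itv/= andbT.
have cpsi (u v : R) : 0 <= u -> {within `[u, v], continuous psi}.
  move=> u0; apply: continuous_in_subspaceT => z; rewrite inE /= in_itv/= => /andP[uz _].
  apply: cvgB; apply: cvgM; try exact: cvg_cst; last exact: continuous_powR_ge0.
  have z1 : - 1 < z by lra.
  have [d1 _] := primitive_derive x z1.
  apply: (@differentiable_continuous R R^o R^o); exact/derivable1_diffP.
have mono (u v : R) : 0 <= u -> u < v -> exists2 z, z \in `]u, v[ &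
    psi v - psi u = p * (quotient p g x z - q) * z `^ (p - 1) * (v - u).
  move=> u0 uv.
  have dz z : z \in `]u, v[ -> is_derive z (1 : R) psi (p * g x z - q * (p * z `^ (p - 1))).
    by rewrite in_itv/= => /andP[uz _]; apply: dpsi; lra.
  have [z zuv zE] := MVT uv dz (cpsi u v u0).
  exists z => //; rewrite zE -(@quotientK _ _ _ p g x z); first by ring.
  by move: zuv; rewrite in_itv/= => /andP[]; lra.
have psia : psi a = p * primitive x a - q * a `^ p by rewrite /psi max_r// ltW.
have psib : psi b = p * primitive x b - q * b `^ p by rewrite /psi max_r.
suff : psi b <= psi a by rewrite psia psib; lra.
have [ab|ba|->//] := ltgtP a b.
- have [z] := mono a b (ltW a0) ab; rewrite in_itv/= => /andP[az zb] E.
  rewrite -subr_le0 E pmulr_lle0 ?subr_gt0// pmulr_lle0 ?powR_gt0//; last lra.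
  by rewrite pmulr_rle0// subr_le0; apply: (quotient_le hg) => //; exact: ltW.
- have [z] := mono b a b0 ba; rewrite in_itv/= => /andP[bz za] E.
  have z0 : 0 < z by lra.
  rewrite -subr_ge0 E pmulr_lge0 ?subr_gt0// pmulr_lge0 ?powR_gt0//.
  by rewrite pmulr_rge0// subr_ge0; apply: (quotient_le hg) => //; exact: ltW.
Unshelve. all: by end_near. Qed.

(** An integral with moving end point becomes an integral over the whole line of g times the
    indicator of the region between -1 and u(x); Tonelli's measurability applies to its positive and
    negative parts. *)
Lemma measurable_primitive u : measurable_fun setT u ->
  measurable_fun setT (fun x => primitive x (u x)).
Proof.
move=> mu_.
have mg0 : measurable_fun setT (fun x => g x 0) by exact: (reaction_measurable hg).
apply: measurable_funB => //.
pose S := [set z : T * measurableTypeR R | - 1 <= z.2] `&`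
  [set z : T * measurableTypeR R | z.2 <= u z.1].
have mS : measurable S.
  apply: measurableI; rewrite -[X in measurable X]setTI; apply: measurable_fun_le => //.
  exact: (measurableT_comp mu_ measurable_fst).
pose G (z : T * measurableTypeR R) : \bar R := (g z.1 z.2 * \1_S z)%:E.
have mG : measurable_fun setT G.
  apply/measurable_EFinP; apply: measurable_funM.
    apply: measurable_caratheodory; [exact: reaction_measurable hg|exact: reaction_continuous hg].
  exact: (@measurable_indic _ _ R setT S mS).
have GE x : (EFin \o g x) \_ `[-1, u x]%classic = (fun tau => G (x, tau)).
  apply/funext => tau; rewrite /patch /G /= indicE.
  case: ifPn => [|]; rewrite ?inE ?notin_setE /= in_itv/=.
    by move=> h; rewrite mem_set ?mulr1//=; apply/andP.
  by move=> h; rewrite memNset ?mulr0//= => h'; apply: h; apply/andP.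
rewrite (_ : (fun x => _) = (fun x => fine (\int[leb]_tau (G^\+ (x, tau)) -
    \int[leb]_tau (G^\- (x, tau)))%E)); last first.
  apply/funext => x; rewrite /Rintegral integral_mkcond GE integralE.
  by congr (fine (_ - _)%E); apply: eq_integral => tau _; rewrite ?funeposE ?funenegE.
apply: (measurableT_comp (fine_measurable measurableT)); apply: emeasurable_funB.
  have mp := measurable_funepos mG.
  exact: (measurable_fun_fubini_tonelli_F _ mp (funepos_ge0 G)).
have mn := measurable_funeneg mG.
exact: (measurable_fun_fubini_tonelli_F _ mn (funeneg_ge0 G)).
Qed.

End primitive.

Section minimisation.
Context d (T : measurableType d) (R : realType).
Variable mu : {sigma_finite_measure set T -> \bar R}.
Variables (Om : set T) (k : T * T -> R) (p c0 : R) (g : T -> R -> R).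
Hypothesis p1 : 1 < p.
Hypothesis c00 : 0 < c0.
Hypothesis mOm : measurable Om.
Hypothesis fOm : (mu Om < +oo)%E.
Hypothesis mk : measurable_fun setT k.
Hypothesis k0 : forall z, 0 <= k z.
Hypothesis hg : reaction p c0 g.
Local Notation intg f := (mu.-integrable setT (EFin \o (f : T -> R))).
Local Notation W := (energy_space mu Om k p).
Implicit Types (u v w phi : T -> R).


Let p0 : 0 < p. Proof. exact: lt_trans ltr01 p1. Qed.
Let pm : 0 < p - 1. Proof. by rewrite subr_gt0. Qed.

Local Notation compact_embedding := (compact_embedding mu Om k p).
Local Notation F := (primitive g).

Lemma primitive_le x t : 0 <= t -> F x t <= c0 * (1 + 2 * t `^ p).
Proof.
move=> t0; have t1 : - 1 < t by lra.
have [xi [h1 h2 h3]] := primitive_MVT hg x (ltrN10 R) t1.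
rewrite (primitive0 hg) !subr0 in h3; rewrite h3.
rewrite min_l// in h1; rewrite max_r// in h2.
have hx := reaction_le hg x h1.
have hxp : xi `^ (p - 1) <= t `^ (p - 1) by apply: ler_wpowR => //; exact: ltW.
have h4 : g x xi * t <= c0 * (1 + t `^ (p - 1)) * t.
  rewrite ler_wpM2r// (le_trans hx)// ler_wpM2l ?lerD2l//; exact: ltW.
apply: (le_trans h4); rewrite -mulrA ler_wpM2l ?(ltW c00)// mulrDl mul1r mulrC mulr_powRB1//.
(* This absorbs the linear term t + t^p of the mean value bound and accounts for the factor 2. *)
have tp : t <= 1 + t `^ p.
  have [t2|/ltW t2] := leP t 1; first by rewrite (le_trans t2)// lerDl powR_ge0.
  by rewrite (@le_trans _ _ (t `^ p)) ?lerDr// le1r_powR// ltW.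
by move: tp; move: (t `^ p) => z; lra.
Qed.

Lemma primitive_abs_le (n : nat) : exists2 C : R, 0 <= C &
  forall x t, - 1 < t -> t <= n.+1%:R -> `|F x t| <= C * `|t|.
Proof.
have [C C0 hC] := reaction_abs_le p1 c00 hg n; exists C => // x t t1 tn.
have [xi [h1 h2 h3]] := primitive_MVT hg x (ltrN10 R) t1.
rewrite (primitive0 hg) !subr0 in h3; rewrite h3 normrM ler_wpM2r//; apply: hC.
by rewrite (le_trans h2)// ge_max tn ler0n.
Qed.

Lemma primitive_neg x t : - 1 < t -> t <= 0 -> F x t <= 0.
Proof.
move=> t1 t0; have [xi [h1 h2 h3]] := primitive_MVT hg x (ltrN10 R) t1.
rewrite (primitive0 hg) !subr0 in h3; rewrite h3.
rewrite max_l// in h2; rewrite (reaction_neg hg)//.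
by rewrite mulr_ge0_le0//; exact: (reaction_ge0 p1 hg).
Qed.

(** Integrability of the primitive is a genuine restriction: from below it has no growth bound. *)
Definition admissible u : Prop :=
  [/\ W u, (forall x, 0 <= u x) & intg (fun x => F x (u x))].

Definition action u : R := energy mu k p u - p * \int[mu]_x F x (u x).

(** The upper growth bound of the primitive minus the primitive. It is nonnegative, so Fatou applies
    to it, while the bound itself depends on [u] only through the norm, which is continuous along
    the minimising sequence. *)
Definition excess u x : R := c0 * (\1_Om x + 2 * `|u x| `^ p) - F x (u x).

Lemma excess_ge0 u x : (forall x, ~ Om x -> u x = 0) -> (forall x, 0 <= u x) ->
  0 <= excess u x.
Proof.
move=> uz u0; rewrite subr_ge0; have [i1 i0] := indE R Om x; have [Ox|nOx] := pselect (Om x).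
  by rewrite i1// ger0_norm//; exact: primitive_le.
by rewrite i0// uz// (primitive0 hg) normr0 powR0 ?gt_eqF// mulr0 addr0 mulr0.
Qed.

Lemma integrable_bound u : intg (fun x => `|u x| `^ p) ->
  intg (fun x => c0 * (\1_Om x + 2 * `|u x| `^ p)).
Proof.
move=> iu; apply/integrable_mulRl/integrable_addR; first exact: integrable_ind.
exact: integrable_mulRl.
Qed.

Lemma Rintegral_bound u : intg (fun x => `|u x| `^ p) ->
  \int[mu]_x (c0 * (\1_Om x + 2 * `|u x| `^ p)) =
  c0 * (\int[mu]_x (\1_Om x : R) + 2 * \int[mu]_x (`|u x| `^ p)).
Proof.
move=> iu; have iO := integrable_ind mOm fOm.
rewrite RintegralZT ?RintegralDT ?RintegralZT//; first exact: integrable_mulRl.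
exact/integrable_addR/integrable_mulRl.
Qed.

Lemma integral_excess u : admissible u -> intg (excess u) /\
  energy mu k p u + p * \int[mu]_x excess u x = action u +
    p * (c0 * (\int[mu]_x (\1_Om x : R) + 2 * \int[mu]_x (`|u x| `^ p))).
Proof.
move=> [[_ uz iu _] u0 iF]; have ib := integrable_bound iu.
split; first exact: integrable_subR.
by rewrite RintegralBT// Rintegral_bound// /action; ring.
Qed.

Lemma primitive_integral_le u : admissible u ->
  \int[mu]_x F x (u x) <= c0 * (\int[mu]_x (\1_Om x : R) + 2 * \int[mu]_x (`|u x| `^ p)).
Proof.
move=> au; have [[_ uz iu _] u0 iF] := au; have [ie _] := integral_excess au.
rewrite -Rintegral_bound//; apply: ler_Rintegral => //; first exact: integrable_bound.
by move=> x; rewrite -subr_ge0; exact: excess_ge0.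
Qed.

(** Direct method. Coercivity bounds the norms, the growth bound of the primitive then bounds the
    energies, and energy plus p times the excess is lower semicontinuous. *)
Lemma minimiser (dl K : R) : compact_embedding -> 0 < dl ->
  (forall u, admissible u -> dl * \int[mu]_x (`|u x| `^ p) - K <= action u) ->
  (exists2 u, admissible u & action u < 0) ->
  exists u, [/\ admissible u, action u < 0 & forall v, admissible v -> action u <= action v].
Proof.
move=> cpt dl0 coer [v0 av0 v0neg].
pose S := [set r : R | exists2 u, admissible u & r = action u].
have S0 : S !=set0 by exists (action v0); exists v0.
have lbS : lbound S (- K).
  move=> _ [u au ->]; apply: le_trans (coer u au); rewrite lerDr mulr_ge0 ?(ltW dl0)//.
  by apply: Rintegral_ge0T => x; exact: powR_ge0.
have hS : has_inf S by split=> //; exists (- K).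
set m := inf S.
have mS v : admissible v -> m <= action v.
  by move=> av; apply: ge_inf; [exists (- K)|exists v].
have /choice[w hw] : forall n : nat, exists u, admissible u /\ action u < m + n.+1%:R^-1.
  move=> n; have n0 : 0 < n.+1%:R^-1 :> R by rewrite invr_gt0.
  by have [_ [u au ->] h] := inf_adherent n0 hS; exists u.
have n1 (n : nat) : n.+1%:R^-1 <= 1 :> R by rewrite invf_le1// ler1n.
pose M1 := (m + 1 + K) / dl.
have IM n : \int[mu]_x (`|w n x| `^ p) <= M1.
  have [aw hn] := hw n; rewrite ler_pdivlMr// mulrC -lerBlDr.
  apply: (le_trans (coer _ aw)); apply/ltW; apply: (lt_le_trans hn).
  by rewrite lerD2l.
pose M2 := m + 1 + p * (c0 * (\int[mu]_x (\1_Om x : R) + 2 * M1)).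
have EM n : energy mu k p (w n) <= M2.
  have [aw hn] := hw n; have hF := primitive_integral_le aw.
  have hF2 : p * \int[mu]_x F x (w n x) <= p * (c0 * (\int[mu]_x (\1_Om x : R) + 2 * M1)).
    rewrite ler_pM2l//; apply: (le_trans hF); rewrite ler_pM2l// lerD2l ler_wpM2l//.
  rewrite -[leLHS](subrK (p * \int[mu]_x F x (w n x))); apply: lerD => //.
  by apply/ltW; apply: (lt_le_trans hn); rewrite lerD2l.
have [f [u [H [fn [mu_ uz] iH wH wu]]]] : exists (f : nat -> nat) (u H : T -> R),
    [/\ (forall n, (n <= f n)%N),
        measurable_fun setT u /\ (forall x, ~ Om x -> u x = 0), intg H,
        {ae mu, forall x n, `|w (f n) x| `^ p <= H x} &
        {ae mu, forall x, (fun n => w (f n) x) @ \oo --> u x}].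
  apply: (cpt w (Num.max M1 M2)) => [n|n|n]; first by have [[]] := hw n.
    by rewrite le_max IM.
  by rewrite le_max EM orbT.
have Ww n : W (w (f n)) by have [[]] := hw (f n).
have w0 n x : 0 <= w (f n) x by have [[]] := hw (f n).
(* The limit is nonnegative almost everywhere; its positive part is so at every point, as
   [admissible] demands. *)
pose u' x := Num.max 0 (u x).
have mu' : measurable_fun setT u' by exact: measurable_maxr.
have u'z x : ~ Om x -> u' x = 0 by move=> nO; rewrite /u' uz// maxxx.
have u'0 x : 0 <= u' x by rewrite le_max lexx.
have wu' : {ae mu, forall x, (fun n => w (f n) x) @ \oo --> u' x}.
  apply: filterS wu => x h; rewrite /u' max_r//.
  by rewrite -(cvg_lim (@Rhausdorff R) h); apply: limr_ge; [exact: cvgP h|exact: nearW].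
have loo : (limn_einf (fun n => (energy mu k p (w (f n)))%:E) < +oo)%E.
  apply: (@le_lt_trans _ _ M2%:E); last exact: ltry.
  have c1 : (fun _ : nat => M2%:E) @ \oo --> M2%:E by exact: cvg_cst.
  rewrite -(cvg_limn_einf_sup c1).1.
  by apply: limn_einf_le => n; rewrite lee_fin.
have [Wu' Eu' Iu'] := energy_lsc p1 mk k0 Ww mu' u'z iH wH wu' loo.
have [_ _ iu' _] := Wu'.
have mex v : measurable_fun setT v -> measurable_fun setT (excess v).
  move=> mv; apply: measurable_funB; last exact: (measurable_primitive hg).
  apply: measurable_funM => //; apply: measurable_funD; first exact: measurable_ind.
  by apply: measurable_funM => //; exact: measurable_normr_powR.
pose L := \int[mu]_x (\1_Om x : R).
have fex : (\int[mu]_x (p * excess u' x)%:E <=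
    limn_einf (fun n => \int[mu]_x (p * excess (w (f n)) x)%:E))%E.
  apply: fatou_ae.
  - move=> n; apply/measurable_EFinP; apply: measurable_funM => //; apply: mex.
    by case: (Ww n).
  - by apply/measurable_EFinP; apply: measurable_funM => //; exact: mex.
  - move=> n x; rewrite lee_fin mulr_ge0 ?(ltW p0)//; apply: excess_ge0 => //.
    by case: (Ww n).
  - by move=> x; rewrite lee_fin mulr_ge0 ?(ltW p0)//; exact: excess_ge0.
  - apply: filterS wu' => x h.
    suff : (p * excess (w (f n)) x)%:E @[n --> \oo] --> (p * excess u' x)%:E.
      by move=> /cvg_limn_einf_sup[->].
    apply/cvg_EFin; [exact: nearW|apply: cvgM; first exact: cvg_cst].
    apply: cvgB.
      apply: cvgM; first exact: cvg_cst; apply: cvgD; first exact: cvg_cst.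
      by apply: cvgM; [exact: cvg_cst|exact: cvg_normr_powR].
    apply: (@continuous_cvg _ _ _ _ _ (fun n => w (f n) x) (F x)) => //.
    have u1 : - 1 < u' x by apply: lt_le_trans (u'0 x); exact: ltrN10.
    have [d1 _] := primitive_derive hg x u1.
    by apply: (@differentiable_continuous R R^o R^o); exact/derivable1_diffP.
(* Adding the excess removes the primitive: what remains besides the action is a norm term that
   converges. *)
have tot n : ((energy mu k p (w (f n)))%:E + \int[mu]_x (p * excess (w (f n)) x)%:E =
    (action (w (f n)) + p * (c0 * (L + 2 * \int[mu]_x (`|w (f n) x| `^ p))))%:E)%E.
  have [aw _] := hw (f n); have [ie <-] := integral_excess aw.
  by rewrite EFin_Rintegral ?RintegralZT//; exact: integrable_mulRl.
have cm : m + (f n).+1%:R^-1 @[n --> \oo] --> m.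
  rewrite -[X in _ --> X]addr0; apply: cvgD; first exact: cvg_cst.
  apply: (@cvg_comp _ _ _ f (fun n => n.+1%:R^-1) _ \oo); last exact: cvg_invS.
  move=> A [N _ NA]; exists N => // n /= Nn; apply: NA => /=.
  exact: leq_trans Nn (fn n).
have ctot : (m + (f n).+1%:R^-1 + p * (c0 * (L + 2 * \int[mu]_x (`|w (f n) x| `^ p))))%:E
    @[n --> \oo] --> (m + p * (c0 * (L + 2 * \int[mu]_x (`|u' x| `^ p))))%:E.
  apply/cvg_EFin; [exact: nearW|apply: cvgD => //].
  apply: cvgM; first exact: cvg_cst; apply: cvgM; first exact: cvg_cst.
  by apply: cvgD; [exact: cvg_cst|apply: cvgM => //; exact: cvg_cst].
have final : ((energy mu k p u')%:E + \int[mu]_x (p * excess u' x)%:E <=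
    (m + p * (c0 * (L + 2 * \int[mu]_x (`|u' x| `^ p))))%:E)%E.
  rewrite -(cvg_limn_einf_sup ctot).1.
  apply: (le_trans (leeD Eu' fex)); apply: (le_trans (limn_einf_superadd _ _)).
  - by move=> n; rewrite lee_fin energy_ge0.
  - move=> n; apply: integral_ge0 => x _; rewrite lee_fin mulr_ge0 ?(ltW p0)//.
    by apply: excess_ge0 => //; case: (Ww n).
  - apply: limn_einf_le => n /=; rewrite tot lee_fin lerD2r ltW//.
    by have [] := hw (f n).
have ipe : intg (fun x => p * excess u' x).
  apply: ge0_integrable_lt.
  - by apply: measurable_funM => //; exact: mex.
  - by move=> x; rewrite mulr_ge0 ?(ltW p0)//; exact: excess_ge0.
  - apply: le_lt_trans (ltry (m + p * (c0 * (L + 2 * \int[mu]_x (`|u' x| `^ p))))).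
    by apply: le_trans final; rewrite leeDr// lee_fin energy_ge0.
have ie : intg (excess u').
  apply: (integrable_eqR _ (integrable_mulRl p^-1 ipe)) => x.
  by rewrite mulrA mulVf ?mul1r// gt_eqF.
(* Fatou bounded the integral of the excess of the limit, which gives back integrability of the
   primitive. *)
have iF : intg (fun x => F x (u' x)).
  apply: (integrable_eqR _ (integrable_subR (integrable_bound iu') ie)) => x.
  by rewrite /excess subKr.
have au' : admissible u' by [].
have um : action u' <= m.
  have [_ E] := integral_excess au'.
  move: final; rewrite EFin_Rintegral// RintegralZT// -EFinD lee_fin E lerD2r.
  exact.
exists u'; split; first exact: au'.
  exact: le_lt_trans (le_trans um (mS _ av0)) v0neg.
by move=> v av; exact: le_trans um (mS _ av).
Qed.

End minimisation.

(** * Coercivity and negativity of the action *)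

Section coercivity.
Context d (T : measurableType d) (R : realType).
Variable mu : {sigma_finite_measure set T -> \bar R}.
Variables (Om : set T) (k : T * T -> R) (p c0 : R) (g : T -> R -> R).
Hypothesis p1 : 1 < p.
Hypothesis c00 : 0 < c0.
Hypothesis mOm : measurable Om.
Hypothesis fOm : (mu Om < +oo)%E.
Hypothesis mk : measurable_fun setT k.
Hypothesis k0 : forall z, 0 <= k z.
Hypothesis hg : reaction p c0 g.
Local Notation intg f := (mu.-integrable setT (EFin \o (f : T -> R))).
Local Notation W := (energy_space mu Om k p).
Local Notation Q := (quotient p g).
Implicit Types (u v w phi : T -> R).


Let p0 : 0 < p. Proof. exact: lt_trans ltr01 p1. Qed.

Local Notation F := (primitive g).
Local Notation admissible := (admissible mu Om k p g).
Local Notation action := (action mu k p g).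

(** Origin of 2 c0: the growth bound at t = 1, carried to larger t by monotonicity. *)
Lemma quotient_le2 x (n : nat) : Q x n.+1%:R <= 2 * c0.
Proof.
apply: (@le_trans _ _ (Q x 1)); first by apply: (quotient_le hg); rewrite ?ltr01 ?ler1n.
have := reaction_le hg x ler01; rewrite /quotient powR1 divr1 => /le_trans; apply.
by rewrite mulrC.
Qed.

Fact coercive_arith (C dl i e q K f : R) :
  f <= q + K -> (C + dl) * i <= e + (C * i - q) -> dl * i - K <= e - f.
Proof. by lra. Qed.

(** Concavity in t^p at the point n+1 bounds p F(x,t) by Q(x,n+1) t^p plus a constant; the spectral
    gap for that weight leaves the surplus [dl]. *)
Lemma action_coercive (n : nat) (dl : R) :
  (forall v, W v -> (((2 * c0 + dl) * \int[mu]_x (`|v x| `^ p))%:E <=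
       (energy mu k p v)%:E +
       \int[mu]_x ((2 * c0 - Q x n.+1%:R)%:E * (`|v x| `^ p)%:E))%E) ->
  exists K, forall u, admissible u -> dl * \int[mu]_x (`|u x| `^ p) - K <= action u.
Proof.
move=> gap.
have [C C0 hC] := quotient_ge hg n.
have n0 : 0 < n.+1%:R :> R by rewrite ltr0n.
pose Tp : R := n.+1%:R `^ p; have Tp0 : 0 <= Tp by exact: powR_ge0.
(* The first summand bounds p F(x,n+1), the second bounds -Q(x,n+1) (n+1)^p. *)
pose K := p * (c0 * (1 + 2 * Tp)) + C * Tp.
have pF x t : 0 <= t -> p * F x t <= Q x n.+1%:R * t `^ p + K.
  move=> t0; have := primitive_quotient hg x p1 n0 t0.
  have h1 : p * F x n.+1%:R <= p * (c0 * (1 + 2 * Tp)).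
    by rewrite ler_pM2l//; apply: (primitive_le p1 c00 hg) => //; exact: ltW.
  have h2 : - (Q x n.+1%:R) * Tp <= C * Tp.
    by rewrite ler_wpM2r// lerNl; exact: hC.
  by rewrite -/Tp /K; lra.
exists (K * \int[mu]_x (\1_Om x : R)) => u [Wu u0 iF].
have [mu_ uz iu eu] := Wu; have iO := integrable_ind mOm fOm.
have mQ : measurable_fun setT (fun x => Q x n.+1%:R).
  exact: (measurable_quotient hg (measurable_cst _)).
pose A := 2 * c0 + C.
have iA : intg (fun x => A * `|u x| `^ p) by exact: integrable_mulRl.
have c0' := c00.
have iQ : intg (fun x => Q x n.+1%:R * `|u x| `^ p).
  apply: (integrable_le _ _ iA).
    by apply: measurable_funM => //; exact: measurable_normr_powR.
  move=> x; rewrite normrM (ger0_norm (powR_ge0 _ _)) ler_wpM2r ?powR_ge0//.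
  have := quotient_le2 x n; have := hC x _ n0 (lexx _).
  by rewrite ler_norml /A => *; lra.
have ib : intg (fun x => (2 * c0 - Q x n.+1%:R) * `|u x| `^ p).
  apply: (integrable_eqR _ (integrable_subR (integrable_mulRl (2 * c0) iu) iQ)) => x.
  by rewrite mulrBl.
have Eb : \int[mu]_x ((2 * c0 - Q x n.+1%:R) * `|u x| `^ p) =
    2 * c0 * \int[mu]_x (`|u x| `^ p) - \int[mu]_x (Q x n.+1%:R * `|u x| `^ p).
  rewrite -RintegralZT// -RintegralBT//; last exact: integrable_mulRl.
  by apply: eq_Rintegral => x _; rewrite mulrBl.
have := gap u Wu; under eq_integral => x _ do rewrite -EFinM.
rewrite EFin_Rintegral// -EFinD lee_fin Eb.
have : p * \int[mu]_x F x (u x) <=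
    \int[mu]_x (Q x n.+1%:R * `|u x| `^ p) + K * \int[mu]_x (\1_Om x : R).
  rewrite -!RintegralZT// -RintegralDT//; last exact: integrable_mulRl.
  apply: ler_Rintegral; [exact: integrable_mulRl|exact/integrable_addR/integrable_mulRl|].
  move=> x; have [i1 i0] := indE R Om x; have [Ox|nOx] := pselect (Om x).
    by rewrite i1// mulr1 ger0_norm//; exact: pF.
  by rewrite i0// uz// (primitive0 hg) normr0 powR0 ?gt_eqF// !mulr0 addr0.
move=> h2 h1; exact: (coercive_arith h2 h1).
Qed.

(** Small multiples t of truncations of |v| are inserted. If every such action were nonnegative,
    division by t^p and concavity of the primitive would bound the integral of Q(x, t v) v^p by the
    energy of [v]; Fatou with the shift [C], as Q(x, t v) tends to [a], would contradict the
    hypothesis. *)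
Lemma action_negative (a : T -> \bar R) (C : R) v : W v -> 0 <= C ->
  measurable_fun setT a -> (forall x, (0 <= a x + C%:E)%E) ->
  (forall x t, 0 < t -> t <= 1 -> - C <= Q x t) ->
  (forall x (t : nat -> R), Om x -> (forall n, 0 < t n) -> t @ \oo --> (0 : R) ->
     (Q x (t n))%:E @[n --> \oo] --> a x) ->
  ((energy mu k p v + C * \int[mu]_x (`|v x| `^ p))%:E <
     \int[mu]_x ((a x + C%:E) * (`|v x| `^ p)%:E))%E ->
  exists2 u, admissible u & action u < 0.
Proof.
move=> Wv C0 ma aC QC Qa hv; have [mv vz iv ev] := Wv.
have n0 (n : nat) : 0 <= n.+1%:R :> R by rewrite ler0n.
have n0' (n : nat) : 0 < n.+1%:R :> R by rewrite ltr0n.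
pose vn n x := Num.min `|v x| n.+1%:R.
have Wn := energy_space_norm p1 mk k0 Wv.
have Wvn n : W (vn n) by apply: energy_space_min.
have vn0 n x : 0 <= vn n x by rewrite le_min normr_ge0 n0.
have vnv n x : vn n x <= `|v x| by rewrite ge_min lexx.
(* The square makes t times the truncation at height n+1 at most 1/(n+1), uniformly in x. *)
pose t n : R := n.+1%:R^-1 ^+ 2.
have t0 n : 0 < t n by rewrite exprn_gt0// invr_gt0.
pose w n x := t n * vn n x.
have Ww n : W (w n) by apply: energy_spaceZ.
have w0 n x : 0 <= w n x by rewrite mulr_ge0// ltW.
have wle n x : w n x <= n.+1%:R^-1.
  rewrite /w /t expr2 -mulrA ler_piMr ?invr_ge0// mulrC ler_pdivrMr// mul1r.
  by rewrite ge_min lexx orbT.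
have w1 n x : w n x <= 1 by rewrite (le_trans (wle n x))// invf_le1// ler1n.
have [CF CF0 hF] := primitive_abs_le p1 c00 hg 0.
have aw n : admissible (w n).
  split=> //; have [mw wz _ _] := Ww n.
  apply: (integrable_le _ _ (integrable_mulRl CF (integrable_ind mOm fOm))).
    exact: (measurable_primitive hg).
  move=> x; have [i1 i0] := indE R Om x; have [Ox|nOx] := pselect (Om x).
    rewrite i1// mulr1; apply: le_trans (hF x (w n x) _ (w1 n x)) _.
      by apply: lt_le_trans (w0 n x); exact: ltrN10.
    by rewrite ler_piMr// ger0_norm.
  by rewrite i0// wz// (primitive0 hg) normr0 mulr0.
have En n : energy mu k p (vn n) <= energy mu k p v.
  apply: (energy_contr p1 k0 Wv (Wvn n)) => x y.
  by apply: (le_trans (minr_contr _ _ _)); exact: ler_dist_dist.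
apply: contrapT => nneg.
have pos n : 0 <= action (w n).
  by rewrite leNgt; apply/negP => h; apply: nneg; exists (w n).
have mvn n : measurable_fun setT (vn n) by case: (Wvn n).
have mwn n : measurable_fun setT (w n) by case: (Ww n).
have ivn n : intg (fun x => vn n x `^ p).
  by have [_ _ + _] := Wvn n; apply: integrable_eqR => x; rewrite ger0_norm.
pose q n x := Q x (w n x) * vn n x `^ p.
(* Concavity of the primitive in the variable t^p bounds it from below by
   t^p times the quotient. *)
have qF n x : t n `^ p * q n x <= p * F x (w n x).
  have [wx|wx] := ltP 0 (w n x).
    have := primitive_quotient hg x p1 wx (lexx 0).
    rewrite (primitive0 hg) powR0 ?gt_eqF// !sub0r !mulrN lerN2 => h.
    by apply: le_trans h; rewrite /q mulrCA -powRM// ltW.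
  have w00 : w n x = 0 by apply/le_anti; rewrite wx w0.
  have v00 : vn n x = 0.
    by move/eqP: w00; rewrite mulf_eq0 (gt_eqF (t0 n)) => /eqP.
  by rewrite /q v00 w00 (primitive0 hg) powR0 ?gt_eqF// !mulr0.
have q0 n x : 0 <= (Q x (w n x) + C) * vn n x `^ p.
  have [vx|vx] := ltP 0 (vn n x).
    rewrite mulr_ge0 ?powR_ge0// -lerBlDr sub0r; apply: QC => //.
    by rewrite mulr_gt0.
  have -> : vn n x = 0 by apply/le_anti; rewrite vx vn0.
  by rewrite powR0 ?gt_eqF// mulr0.
have mq n : measurable_fun setT (fun x => (Q x (w n x) + C) * vn n x `^ p).
  apply: measurable_funM; last exact: (integrable_measurable (ivn n)).
  by apply: measurable_funD => //; exact: (measurable_quotient hg).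
have qint n : (\int[mu]_x ((Q x (w n x) + C) * vn n x `^ p)%:E <=
    (energy mu k p v + C * \int[mu]_x (`|v x| `^ p))%:E)%E.
  have tp0 : 0 < t n `^ p by rewrite powR_gt0.
  have [[_ _ iF] ] := (aw n, pos n).
  have Ew : energy mu k p (w n) = `|t n| `^ p * energy mu k p (vn n).
    exact: (energyZ (t n) (Wvn n)).
  rewrite /action Ew gtr0_norm// => A0.
  have iup : intg (fun x => (t n `^ p)^-1 * (p * F x (w n x)) + C * vn n x `^ p).
    by apply: integrable_addR; do ?apply: integrable_mulRl.
  apply: (@le_trans _ _ (\int[mu]_x ((t n `^ p)^-1 * (p * F x (w n x)) + C * vn n x `^ p)%:E)%E).
    apply: ge0_le_integral => //.
    - by move=> x _; rewrite lee_fin.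
    - exact/measurable_EFinP.
    - exact: measurable_int iup.
    - move=> x _; rewrite lee_fin mulrDl lerD2r ler_pdivlMl//; exact: qF.
  rewrite EFin_Rintegral// lee_fin RintegralDT; [|by do ?apply: integrable_mulRl..].
  rewrite (RintegralZT (t n `^ p)^-1 (integrable_mulRl p iF)) (RintegralZT p iF).
  rewrite (RintegralZT C (ivn n)); apply: lerD.
    rewrite ler_pdivrMl//; move: A0; rewrite subr_ge0 => /le_trans; apply.
    by rewrite ler_pM2l.
  rewrite ler_wpM2l//; apply: ler_Rintegral => // x.
  by rewrite ler_wpowR// ltW.
move: hv; rewrite ltNge => /negP; apply.
have ll : (limn_einf (fun n => \int[mu]_x ((Q x (w n x) + C) * vn n x `^ p)%:E) <=
    (energy mu k p v + C * \int[mu]_x (`|v x| `^ p))%:E)%E.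
  have c1 : (fun _ : nat => (energy mu k p v + C * \int[mu]_x (`|v x| `^ p))%:E) @ \oo -->
      (energy mu k p v + C * \int[mu]_x (`|v x| `^ p))%:E by exact: cvg_cst.
  by rewrite -(cvg_limn_einf_sup c1).1; exact: limn_einf_le.
apply: le_trans ll; apply: fatou_ae.
- by move=> n; exact/measurable_EFinP.
- apply: measurable_weighted => //; exact: emeasurable_funD.
- by move=> n x; rewrite lee_fin.
- by move=> x; rewrite mule_ge0// lee_fin powR_ge0.
- apply: aeW => x; have [vx|vx] := eqVneq (v x) 0.
    rewrite vx normr0 powR0 ?gt_eqF// mule0; apply: limn_einf_ge0 => n.
    by rewrite lee_fin.
  have Ox : Om x by apply: contrapT => /vz/eqP; rewrite (negPf vx).
  have vnx n : 0 < vn n x by rewrite lt_min normr_gt0 vx n0'.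
  have cw : w ^~ x @ \oo --> (0 : R).
    apply: (@squeeze_cvgr _ _ _ _ (fun=> 0) (fun n => n.+1%:R^-1)).
    - by apply: nearW => n; rewrite w0 wle.
    - exact: cvg_cst.
    - exact: cvg_invS.
  have cq := Qa x (w ^~ x) Ox (fun n => mulr_gt0 (t0 n) (vnx n)) cw.
  have cv : (vn n x `^ p)%:E @[n --> \oo] --> (`|v x| `^ p)%:E.
    apply/cvg_EFin; [exact: nearW|apply: (cvg_powR p0 (fun n => vn0 n x))].
    exact: (@cvg_min_nat R).
  have cqC : (Q x (w n x) + C)%:E @[n --> \oo] --> (a x + C%:E)%E.
    have dC : (a x +? C%:E)%E by rewrite fin_num_adde_defl.
    have cC : (fun _ : nat => C%:E) @ \oo --> C%:E by exact: cvg_cst.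
    exact: cvgeD dC cq cC.
  have up0 : 0 < `|v x| `^ p by rewrite powR_gt0// normr_gt0.
  have md : mule_def (a x + C%:E)%E (`|v x| `^ p)%:E.
    rewrite mule_defE.
    have -> : ((`|v x| `^ p)%:E == 0)%E = false by apply/negbTE; rewrite gt_eqF// lte_fin.
    by rewrite andFb orbF andbF.
  by rewrite -(cvg_limn_einf_sup (cvgeM md cqC cv)).1.
Qed.

End coercivity.

(** * The Euler-Lagrange equation of a minimiser *)

Section euler_lagrange_equation.
Context d (T : measurableType d) (R : realType).
Variable mu : {sigma_finite_measure set T -> \bar R}.
Variables (Om : set T) (k : T * T -> R) (p c0 : R) (g : T -> R -> R).
Hypothesis p1 : 1 < p.
Hypothesis c00 : 0 < c0.
Hypothesis mOm : measurable Om.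
Hypothesis fOm : (mu Om < +oo)%E.
Hypothesis mk : measurable_fun setT k.
Hypothesis k0 : forall z, 0 <= k z.
Hypothesis hg : reaction p c0 g.
Local Notation intg f := (mu.-integrable setT (EFin \o (f : T -> R))).
Local Notation W := (energy_space mu Om k p).
Implicit Types (u v w phi : T -> R).


Let p0 : 0 < p. Proof. exact: lt_trans ltr01 p1. Qed.

Local Notation F := (primitive g).
Local Notation admissible := (admissible mu Om k p g).
Local Notation action := (action mu k p g).
Local Notation minimal u := (forall v, admissible v -> action u <= action v).

Lemma form_cvg u (phi_ : nat -> T -> R) phi psi : W u -> (forall n, W (phi_ n)) ->
  W phi -> W psi -> (forall x, phi_ ^~ x @ \oo --> phi x) ->
  (forall n x y, `|phi_ n x - phi_ n y| <= `|psi x - psi y| + `|u x - u y|) ->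
  form mu k p u (phi_ n) @[n --> \oo] --> form mu k p u phi.
Proof.
move=> Wu Wn Wphi Wpsi cphi dom.
have [mu_ _ _ eu] := Wu; have [_ _ _ epsi] := Wpsi; have [mphi _ _ _] := Wphi.
have [] // := @dominated_cvgR _ _ _ (mu \x mu)%E (fun n => form_density k p u (phi_ n))
  (form_density k p u phi)
  (fun z => 2 * energy_density k p u z + (energy_density k p u z + energy_density k p psi z)).
- by move=> n; apply: measurable_form_density => //; case: (Wn n).
- exact: measurable_form_density.
- by apply: integrable_addR; [exact: integrable_mulRl|exact: integrable_addR].
- apply: aeW => z n; rewrite /form_density normrM (ger0_norm (k0 z)).
  have j1 := normr_jpM (u z.1 - u z.2) (u z.1 - u z.2) p1.
  have j2 := normr_jpM (u z.1 - u z.2) (psi z.1 - psi z.2) p1.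
  rewrite /energy_density mulrA -!mulrDl ler_wpM2r// normrM.
  apply: (@le_trans _ _ (`|jp p (u z.1 - u z.2)| *
      (`|psi z.1 - psi z.2| + `|u z.1 - u z.2|))); first by rewrite ler_wpM2l.
  rewrite normrM in j1; rewrite normrM in j2; rewrite mulrDr.
  move: (`|u z.1 - u z.2| `^ p) (`|psi z.1 - psi z.2| `^ p) j1 j2 => A B j1 j2.
  by rewrite (_ : 2 * A + (A + B) = (A + B) + (A + A)); [exact: lerD|ring].
- apply: aeW => z; apply: cvgM; last exact: cvg_cst.
  by apply: cvgM; [exact: cvg_cst|apply: cvgB; exact: cphi].
Qed.

Fact variation_arith (e ev fu fv h q : R) : 0 < q ->
  e - q * fu <= ev - q * fv -> ev <= e + q * h -> fv - fu <= h.
Proof. by move=> q0 h1 h2; rewrite -(ler_pM2l q0) mulrBr; lra. Qed.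

Lemma maxr_contr (a b : R) : `|Num.max 0 a - Num.max 0 b| <= `|a - b|.
Proof.
wlog ab : a b / b <= a.
  by move=> h; have [/h//|/ltW/h] := leP b a; rewrite distrC (distrC b).
rewrite [leRHS]ger0_norm ?subr_ge0//.
by case: (leP 0 a) => ?; case: (leP 0 b) => ?; rewrite ger0_norm; lra.
Qed.

(** A variation of [u] may leave the nonnegative cone, so its positive part is compared with [u].
    Since [w] vanishes where u > m, only bounded arguments of the reaction enter the difference
    quotients, and dominated convergence applies. *)
Lemma variation_le u w M m : admissible u -> minimal u -> W w ->
  0 <= M -> (forall x, `|w x| <= M) -> (forall x, m < u x -> w x = 0) ->
  intg (fun x => g x (u x) * w x) /\ \int[mu]_x (g x (u x) * w x) <= form mu k p u w.
Proof.
move=> au umin Ww M0 wM wm; have [Wu u0 iF] := au.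
have [mu_ uz iu eu] := Wu; have [mw wz iw ew] := Ww.
(* Division by M + 1 gives |t w| < 1, so u + t w stays above -1, where the primitive is
   differentiable. *)
pose t n : R := n.+1%:R^-1 / (M + 1).
have M1 : 0 < M + 1 by rewrite ltr_wpDl.
have t0 n : 0 < t n by rewrite divr_gt0// invr_gt0.
have tle n : t n <= n.+1%:R^-1.
  by rewrite ler_pdivrMr// ler_peMr ?invr_ge0// lerDr.
have t1 n : t n <= 1 by rewrite (le_trans (tle n))// invf_le1// ler1n.
have ct : t @ \oo --> (0 : R).
  apply: (@squeeze_cvgr _ _ _ _ (fun=> 0) (fun n => n.+1%:R^-1)).
  - by apply: nearW => n; rewrite (ltW (t0 n)) tle.
  - exact: cvg_cst.
  - exact: cvg_invS.
have tw n x : `|t n * w x| <= n.+1%:R^-1 * (M / (M + 1)).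
  rewrite normrM gtr0_norm// /t -mulrA ler_wpM2l ?invr_ge0//.
  by rewrite mulrC ler_wpM2r// invr_ge0 ltW.
have tw1 n x : `|t n * w x| < 1.
  apply: (le_lt_trans (tw n x)).
  apply: (@le_lt_trans _ _ (M / (M + 1))).
    by rewrite ler_piMl ?divr_ge0 ?(ltW M1)// invf_le1// ler1n.
  by rewrite ltr_pdivrMr// mul1r ltrDl.
pose v n x := u x + t n * w x.
have v1 n x : - 1 < v n x.
  have := tw1 n x; rewrite ltr_norml => /andP[h _].
  by rewrite /v (lt_le_trans h)// lerDr.
have Wv n : W (v n) := energy_spaceD p1 mk k0 (t n) Wu Ww.
have mv n : measurable_fun setT (v n) by case: (Wv n).
pose N := Num.bound (Num.max 0 (m + 1)).
have mN : m + 1 <= N.+1%:R.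
  have := archi_boundP (_ : 0 <= Num.max 0 (m + 1)); rewrite le_max lexx => /(_ erefl).
  move=> /ltW h; apply: (@le_trans _ _ (Num.max 0 (m + 1))); first by rewrite le_max lexx orbT.
  by apply: (le_trans h); rewrite ler_nat.
have [CF CF0 hCF] := primitive_abs_le p1 c00 hg N.
have [Cg Cg0 hCg] := reaction_abs_le p1 c00 hg N.
have um x : w x != 0 -> u x <= m.
  by move=> wx; rewrite leNgt; apply/negP => /wm/eqP; rewrite (negPf wx).
have vN n x : w x != 0 -> v n x <= N.+1%:R.
  move=> wx; apply: le_trans mN; rewrite /v; apply: lerD; first exact: um.
  by apply: (le_trans (ler_norm _)); exact: ltW.
have uN x : w x != 0 -> u x <= N.+1%:R.
  by move=> /um h; apply: le_trans mN; rewrite (le_trans h)// lerDl.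
have wind x : w x != 0 -> \1_Om x = 1 :> R.
  by move=> wx; apply: (indE R Om x).1; apply: contrapT => /wz/eqP; rewrite (negPf wx).
pose D n x := (t n)^-1 * (F x (v n x) - F x (u x)).
have xiP n x : exists xi, [/\ Num.min (u x) (v n x) <= xi, xi <= Num.max (u x) (v n x) &
    D n x = g x xi * w x].
  have u1 : - 1 < u x by apply: lt_le_trans (u0 x); exact: ltrN10.
  have [xi [h1 h2 h3]] := primitive_MVT hg x u1 (v1 n x).
  exists xi; split=> //; rewrite /D h3 /v (_ : u x + t n * w x - u x = t n * w x); last ring.
  by rewrite mulrCA mulKf// gt_eqF.
have Dle n x : `|D n x| <= Cg * M * \1_Om x.
  have [wx|wx] := eqVneq (w x) 0.
    have [xi [_ _ ->]] := xiP n x; rewrite wx mulr0 normr0.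
    by apply: mulr_ge0; [exact: mulr_ge0|rewrite indicE].
  have [xi [_ h2 ->]] := xiP n x; rewrite wind// mulr1 normrM; apply: ler_pM => //.
  by apply: hCg; rewrite (le_trans h2)// ge_max uN// vN.
have mD n : measurable_fun setT (D n).
  by apply: measurable_funM => //; apply: measurable_funB; exact: (measurable_primitive hg).
have iDom : intg (fun x => Cg * M * \1_Om x : R) by exact/integrable_mulRl/integrable_ind.
have iD n : intg (D n) := integrable_le (mD n) (Dle n) iDom.
have iFv n : intg (fun x => F x (v n x)).
  apply: (integrable_eqR _ (integrable_addR iF (integrable_mulRl (t n) (iD n)))) => x.
  by rewrite /D mulrA mulfV ?mul1r ?gt_eqF// addrC subrK.
have Wvp n : W (fun x => Num.max 0 (v n x)) := energy_space_max0 p1 mk k0 (Wv n).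
(* For negative arguments the primitive is nonpositive, because g(x,0) >= 0 and g is constant there.
   Passing to the positive part thus raises the primitive and, being a contraction, lowers the
   energy. *)
have Fvp n x : F x (v n x) <= F x (Num.max 0 (v n x)).
  have [v0|/ltW v0] := leP 0 (v n x); first by [].
  by rewrite (primitive0 hg); exact: (primitive_neg p1 hg).
have avp n : admissible (fun x => Num.max 0 (v n x)).
  split=> //; first by move=> x; rewrite le_max lexx.
  apply: (integrable_le _ _ (integrable_normR (iFv n))).
    by case: (Wvp n) => mvp _ _ _; exact: (measurable_primitive hg).
  move=> x; have [v0|/ltW v0] := leP 0 (v n x); first by [].
  by rewrite (primitive0 hg) normr0.
have ineq n : \int[mu]_x D n x <= form mu k p (v n) w.
  have h1 := umin _ (avp n).
  have h2 : action (fun x => Num.max 0 (v n x)) <= energy mu k p (v n) - p * \int[mu]_x F x (v n x).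
    apply: lerB.
      apply: (energy_contr p1 k0 (Wv n) (Wvp n)) => x y.
      exact: maxr_contr.
    rewrite (ler_pM2l p0); have [_ _ ia] := avp n.
    by apply: (ler_Rintegral (iFv n) ia) => x; exact: Fvp.
  have h3 := energyD_le p1 mk k0 (t0 n) Wu Ww.
  rewrite RintegralZT; last exact: integrable_subR.
  rewrite RintegralBT// ler_pdivrMl//.
  exact: (variation_arith p0 (le_trans h1 h2) h3).
have iDw : measurable_fun setT (fun x => g x (u x) * w x).
  by apply: measurable_funM => //; exact: (measurable_reaction hg).
have cD x : D ^~ x @ \oo --> g x (u x) * w x.
  have /choice[xi hxi] := xiP ^~ x.
  rewrite (_ : D ^~ x = fun n => g x (xi n) * w x); last first.
    by apply/funext => n; have [_ _ ->] := hxi n.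
  apply: cvgM; last exact: cvg_cst.
  apply: (@continuous_cvg _ _ _ _ _ xi (g x)); first exact: (reaction_continuous hg).
  have cv : v ^~ x @ \oo --> u x.
    rewrite -[X in _ --> X]addr0 -[X in _ + X](mul0r (w x)).
    by apply: cvgD; [exact: cvg_cst|apply: cvgM => //; exact: cvg_cst].
  apply: (@squeeze_cvgr _ _ _ _ (fun n => Num.min (u x) (v n x)) (fun n => Num.max (u x) (v n x))).
  - by apply: nearW => n; have [-> ->] := hxi n.
  - rewrite -[X in _ --> X]minxx; apply: (@continuous_cvg _ _ _ _ _ (v ^~ x) (Num.min (u x))) => //.
    by apply: continuous_min; [exact: cvg_cst|exact: cvg_id].
  - rewrite -[X in _ --> X]maxxx; apply: (@continuous_cvg _ _ _ _ _ (v ^~ x) (Num.max (u x))) => //.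
    by apply: continuous_max; [exact: cvg_cst|exact: cvg_id].
have [igw cI] : intg (fun x => g x (u x) * w x) /\
    \int[mu]_x D n x @[n --> \oo] --> \int[mu]_x (g x (u x) * w x).
  by apply: (dominated_cvgR (G := fun x => Cg * M * \1_Om x)) => //; apply: aeW.
split=> //.
have [] // := @dominated_cvgR _ _ _ (mu \x mu)%E (fun n => form_density k p (v n) w)
  (form_density k p u w)
  (fun z => 2 `^ p * (energy_density k p u z + energy_density k p w z) + energy_density k p w z).
- by move=> n; exact: measurable_form_density.
- exact: measurable_form_density.
- by apply: integrable_addR => //; apply: integrable_mulRl; exact: integrable_addR.
- apply: aeW => z n; apply: (le_trans (form_density_le p1 k0 _ _ _)).
  rewrite lerD2r /energy_density -mulrDl mulrA ler_wpM2r//.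
  rewrite /v (_ : _ - _ = (u z.1 - u z.2) + t n * (w z.1 - w z.2)); last ring.
  apply: (le_trans (powR_normD _ _ (ltW p0))).
  rewrite ler_wpM2l ?powR_ge0// lerD2l; apply: ler_wpowR => //; first exact: ltW.
  by rewrite normrM gtr0_norm// ler_piMl.
- apply: aeW => z; apply: cvgM; last exact: cvg_cst.
  apply: cvgM; last exact: cvg_cst.
  apply: cvg_jp => //.
  rewrite -[X in _ --> X]addr0 -[X in _ + X](mul0r (w z.1 - w z.2)).
  rewrite (_ : (fun n => _) = (fun n => (u z.1 - u z.2) + t n * (w z.1 - w z.2))); last first.
    by apply/funext => n; rewrite /v; ring.
  by apply: cvgD; [exact: cvg_cst|apply: cvgM => //; exact: cvg_cst].
move=> iform cform; apply: (ler_cvg_to cI cform); exact: nearW.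
Qed.

(** The one-sided inequality for w and for -w. *)
Lemma euler_lagrange u w M m : admissible u -> minimal u -> W w ->
  0 <= M -> (forall x, `|w x| <= M) -> (forall x, m < u x -> w x = 0) ->
  intg (fun x => g x (u x) * w x) /\ form mu k p u w = \int[mu]_x (g x (u x) * w x).
Proof.
move=> au umin Ww M0 wM wm.
have [iw Iw] := variation_le au umin Ww M0 wM wm.
have WN : W (fun x => -1 * w x) := energy_spaceZ p1 mk k0 (-1) Ww.
have wMN x : `|-1 * w x| <= M by rewrite mulN1r normrN.
have wmN x : m < u x -> -1 * w x = 0 by move=> /wm ->; rewrite mulr0.
have [iN IN] := variation_le au umin WN M0 wMN wmN.
split=> //; apply/le_anti; rewrite Iw andbT.
move: IN; have [Wu _ _] := au.
rewrite (_ : form mu k p u (fun x => -1 * w x) = - form mu k p u w); last first.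
  rewrite /form -RintegralNT; last exact: (integrable_form_density p1 mk k0 Wu Ww).
  by apply: eq_Rintegral => z _; rewrite /form_density -mulrBr mulN1r mulrN mulNr.
rewrite (@eq_Rintegral _ _ _ _ _ (fun x => - (g x (u x) * w x))); last first.
  by move=> x _; rewrite mulN1r mulrN.
by rewrite RintegralNT// lerN2.
Qed.

End euler_lagrange_equation.

(** * Positivity of minimisers *)

Section positivity_of_minimisers.
Context d (T : measurableType d) (R : realType).
Variable mu : {sigma_finite_measure set T -> \bar R}.
Variables (Om : set T) (k : T * T -> R) (p c0 : R) (g : T -> R -> R).
Hypothesis p1 : 1 < p.
Hypothesis c00 : 0 < c0.
Hypothesis mOm : measurable Om.
Hypothesis fOm : (mu Om < +oo)%E.
Hypothesis mk : measurable_fun setT k.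
Hypothesis k0 : forall z, 0 <= k z.
Hypothesis hg : reaction p c0 g.
Local Notation W := (energy_space mu Om k p).
Implicit Types (u v w phi : T -> R).


Let pm : 0 < p - 1. Proof. by rewrite subr_gt0. Qed.

Local Notation admissible := (admissible mu Om k p g).
Local Notation action := (action mu k p g).
Local Notation minimal u := (forall v, admissible v -> action u <= action v).

Definition cutoff (e a : R) : R := Num.max 0 (1 - a / e).

Lemma cutoff_itv e a : 0 < e -> 0 <= a -> 0 <= cutoff e a <= 1.
Proof.
move=> e0 a0; rewrite /cutoff le_max lexx /= ge_max ler01 /=.
by rewrite gerBl divr_ge0// ltW.
Qed.

Lemma cutoff_eq0 e a : 0 < e -> e < a -> cutoff e a = 0.
Proof. by move=> e0 ea; rewrite /cutoff max_l// subr_le0 ler_pdivlMr// mul1r ltW. Qed.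

Lemma cutoff_lip e a b : 0 < e -> `|cutoff e a - cutoff e b| <= e^-1 * `|a - b|.
Proof.
move=> e0; apply: (le_trans (maxr_contr _ _)).
rewrite (_ : 1 - a / e - (1 - b / e) = e^-1 * (b - a)); last ring.
by rewrite normrM distrC gtr0_norm// invr_gt0.
Qed.

Lemma cutoff_le e a b : 0 < e -> a <= b -> cutoff e b <= cutoff e a.
Proof.
move=> e0 ab; rewrite /cutoff ge_max !le_max lexx /= lerB ?orbT//.
by rewrite ler_wpM2r// invr_ge0 ltW.
Qed.

Lemma measurable_cutoff e u : measurable_fun setT u ->
  measurable_fun setT (fun x => cutoff e (u x)).
Proof.
move=> mu_; apply: measurable_maxr => //; apply: measurable_funB => //.
exact: measurable_funM.
Qed.

Lemma cutoff_to1 a : 0 <= a -> (fun n : nat => cutoff n.+1%:R a) @ \oo --> (1 : R).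
Proof.
move=> a0; rewrite -[X in _ --> X](max_r (ler01 : 0 <= 1 :> R)).
apply: (@continuous_cvg _ _ _ _ _ (fun n : nat => 1 - a / n.+1%:R) (Num.max 0)).
  by apply: continuous_max; [exact: cvg_cst|exact: cvg_id].
rewrite -[X in _ --> X]subr0 -[X in _ - X](mulr0 a).
by apply: cvgB; [exact: cvg_cst|apply: cvgM; [exact: cvg_cst|exact: cvg_invS]].
Qed.

Lemma cutoff_to0 a : 0 < a -> (fun n : nat => cutoff n.+1%:R^-1 a) @ \oo --> (0 : R).
Proof.
move=> a0; apply: cvg_near_cst; have := near_infty_natSinv_lt (PosNum a0).
apply: filterS => n h.
by rewrite cutoff_eq0// invr_gt0.
Qed.

Lemma cutoff_mul_lip e a b c c' M : 0 < e -> 0 <= a -> 0 <= b -> 0 <= c <= M -> 0 <= c' <= M ->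
  `|cutoff e a * c - cutoff e b * c'| <= M * e^-1 * `|a - b| + `|c - c'|.
Proof.
move=> e0 a0 b0 /andP[c0_ cM] /andP[c0' cM'].
rewrite (_ : _ - _ = (cutoff e a - cutoff e b) * c + cutoff e b * (c - c')); last ring.
apply: (le_trans (ler_normD _ _)); rewrite !normrM; apply: lerD.
  rewrite (ger0_norm c0_) -mulrA mulrC; apply: ler_pM => //; exact: cutoff_lip.
have /andP[h1 h2] := cutoff_itv e0 b0.
by rewrite ger0_norm// ler_piMl.
Qed.

Lemma energy_space_cutoff e u psi M : 0 < e -> W u -> (forall x, 0 <= u x) -> W psi ->
  (forall x, 0 <= psi x <= M) -> W (fun x => cutoff e (u x) * psi x).
Proof.
move=> e0 Wu u0 Wpsi psiM.
have [[x0]|eT] := pselect (inhabited T); last first.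
  rewrite (_ : (fun _ => _) = fun=> 0); first exact: energy_space0.
  by apply/funext => x; exfalso; apply: eT; constructor.
have M0 : 0 <= M by have /andP[/le_trans h /h] := psiM x0.
have C0 : 0 <= M * e^-1 + 1 by rewrite addr_ge0// mulr_ge0// invr_ge0 ltW.
have Me : 0 <= M * e^-1 by rewrite mulr_ge0// invr_ge0 ltW.
apply: (energy_space_lip p1 mk k0 C0 Wu Wpsi).
- case: Wu => mu_ _ _ _; case: Wpsi => mpsi _ _ _.
  by apply: measurable_funM => //; exact: measurable_cutoff.
- move=> x; have /andP[h1 h2] := cutoff_itv e0 (u0 x).
  rewrite normrM (ger0_norm h1); apply: (@le_trans _ _ `|psi x|).
    by rewrite ler_piMl.
  by have := normr_ge0 (u x); have := normr_ge0 (psi x); nra.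
- move=> x y; apply: (le_trans (cutoff_mul_lip e0 (u0 x) (u0 y) (psiM x) (psiM y))).
  by have := normr_ge0 (u x - u y); have := normr_ge0 (psi x - psi y); nra.
Qed.

(* Testing with (1 - u/e)^+ psi and letting e -> 0: on {u = 0} x {u > 0} the
   nonlocal form has a strict sign, while the reaction term is o(1). *)
Lemma strong_positivity u psi M : admissible u -> minimal u -> W psi ->
  (forall x, 0 <= psi x <= M) -> (forall z, z.1 <> z.2 -> 0 < k z) ->
  {ae (mu \x mu)%E, forall z, u z.1 = 0 -> 0 < u z.2 -> psi z.1 = 0}.
Proof.
move=> au umin Wpsi psiM kpos; have [Wu u0 iF] := au.
have [[x0]|eT] := pselect (inhabited T); last first.
  by apply: aeW => -[x y]; exfalso; apply: eT; constructor.
have M0 : 0 <= M by have /andP[/le_trans h /h] := psiM x0.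
have [mu_ uz iu eu] := Wu; have [mpsi psiz ipsi epsi] := Wpsi.
pose e n : R := n.+1%:R^-1.
have e0 n : 0 < e n by rewrite invr_gt0.
have e1 n : e n <= 1 by rewrite invf_le1// ler1n.
pose w n x := cutoff (e n) (u x) * psi x.
have Ww n : W (w n) := energy_space_cutoff (e0 n) Wu u0 Wpsi psiM.
have w0 n x : 0 <= w n x.
  have /andP[h _] := cutoff_itv (e0 n) (u0 x); have /andP[h' _] := psiM x.
  exact: mulr_ge0.
have wM n x : w n x <= M.
  have /andP[h1 h2] := cutoff_itv (e0 n) (u0 x); have /andP[h3 h4] := psiM x.
  by rewrite -(mul1r M); apply: ler_pM.
have wMn n x : `|w n x| <= M by rewrite ger0_norm.
have wz n x : e n < u x -> w n x = 0 by move=> h; rewrite /w cutoff_eq0 ?mul0r.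
have EL n := euler_lagrange p1 c00 mOm fOm mk k0 hg au umin (Ww n) M0 (wMn n) (wz n).
have [C C0 hC] := reaction_ge p1 hg 0.
pose Z : T -> R := \1_[set x | u x = 0].
have mZ : measurable_fun setT Z.
  apply: measurable_indic; rewrite -[X in measurable X]setTI.
  by rewrite (_ : [set x | u x = 0] = u @^-1` [set 0])//; exact: mu_.
have Z1 x : u x = 0 -> Z x = 1 by move=> h; rewrite /Z indicE mem_set.
have Z0 x : u x != 0 -> Z x = 0 by move=> h; rewrite /Z indicE memNset//=; exact/eqP.
(* The sign is chosen so that the limit [Y] is nonnegative: one-sided Fatou then gives an integral
   at most 0, so [Y] vanishes almost everywhere. *)
pose X n z := - form_density k p u (w n) z.
pose Y z := - form_density k p u (fun x => Z x * psi x) z.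
have Y0 z : 0 <= Y z.
  rewrite /Y /form_density oppr_ge0 mulr_le0_ge0//.
  have [z1|z1] := eqVneq (u z.1) 0; have [z2|z2] := eqVneq (u z.2) 0.
  - by rewrite z1 z2 subr0 /jp normr0 mulr0 mul0r.
  - rewrite z1 (Z1 _ z1) (Z0 _ z2) mul1r mul0r subr0 sub0r jpN mulNr oppr_le0.
    by rewrite mulr_ge0 ?ge0_jp ?powR_ge0//; have /andP[] := psiM z.1.
  - rewrite z2 (Z1 _ z2) (Z0 _ z1) mul1r mul0r subr0 sub0r mulrN oppr_le0.
    by rewrite mulr_ge0 ?ge0_jp ?powR_ge0//; have /andP[] := psiM z.2.
  - by rewrite (Z0 _ z1) (Z0 _ z2) !mul0r subrr mulr0.
(* The bounds on the integrals come from the equation: the test function lives where u <= e, and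
   there -g(x,u) <= C e^(p-1), which tends to 0. *)
have [iY IY] : (mu \x mu)%E.-integrable setT (EFin \o Y) /\ \int[(mu \x mu)%E]_z Y z <= 0.
  apply: (@real_fatou _ _ _ (mu \x mu)%E X Y
    (fun z => energy_density k p u z + energy_density k p psi z)
    (fun n => C * M * \int[mu]_x (\1_Om x : R) * e n `^ (p - 1))).
  - by move=> n; apply/integrable_oppR; exact: (integrable_form_density p1 mk k0 Wu (Ww n)).
  - have mZp : measurable_fun setT (fun x => Z x * psi x) by exact: measurable_funM.
    have mfd := measurable_form_density p1 mk mu_ mZp.
    exact: measurable_funN.
  - exact: integrable_addR.
  - move=> n z; rewrite lerN2; apply: (@le_trans _ _ (`|form_density k p u psi z|)); last first.
      exact: form_density_le.
    rewrite /form_density normrM (ger0_norm (k0 z)) ler_wpM2r// normrM /w.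
    have /andP[a1 a2] := cutoff_itv (e0 n) (u0 z.1).
    have /andP[b1 b2] := cutoff_itv (e0 n) (u0 z.2).
    have /andP[c1 _] := psiM z.1; have /andP[c2 _] := psiM z.2.
    set c := cutoff _ _ in a1 a2 *; set c' := cutoff _ _ in b1 b2 *.
    (* Symmetric product rule. The part with c - c' has the favourable sign, since the cutoff
       decreases in [u]; the other is bounded by the increment of [psi], uniformly in e. *)
    rewrite (_ : c * psi z.1 - c' * psi z.2 = (c - c') * ((psi z.1 + psi z.2) / 2) +
      ((c + c') / 2) * (psi z.1 - psi z.2)); last by field.
    rewrite mulrDr -[leRHS]add0r; apply: lerD.
      rewrite mulrA mulr_le0_ge0//; last by rewrite divr_ge0// addr_ge0.
      have [uu|/ltW uu] := leP (u z.1) (u z.2).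
        rewrite le0_jp ?subr_le0// mulNr oppr_le0 mulr_ge0 ?powR_ge0// subr_ge0.
        exact: cutoff_le.
      rewrite ge0_jp ?subr_ge0// mulr_ge0_le0 ?powR_ge0// subr_le0.
      exact: cutoff_le.
    apply: (le_trans (ler_norm _)); rewrite normrM ler_wpM2l// normrM ler_piMl//.
    by rewrite ger0_norm ?divr_ge0 ?addr_ge0// ler_pdivrMr// mul1r lerD.
  - apply: aeW => z; apply: cvgN; apply: cvgM; last exact: cvg_cst.
    apply: cvgM; first exact: cvg_cst.
    have cw x : w ^~ x @ \oo --> Z x * psi x.
      apply: cvgM; last exact: cvg_cst.
      have [ux|ux] := eqVneq (u x) 0.
        rewrite (Z1 _ ux) (_ : (fun n => _) = fun=> 1); first exact: cvg_cst.
        by apply/funext => n; rewrite ux /cutoff mul0r subr0 max_r.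
      rewrite (Z0 _ ux); apply: cutoff_to0.
      by rewrite lt_neqAle eq_sym ux u0.
    by apply: cvgB; exact: cw.
  - move=> n; rewrite RintegralNT; last exact: (integrable_form_density p1 mk k0 Wu (Ww n)).
    rewrite -/(form mu k p u (w n)); have [igw ->] := EL n.
    rewrite -RintegralNT//.
    have iO := integrable_ind mOm fOm.
    rewrite mulrAC -RintegralZT//; apply: ler_Rintegral.
    + exact: integrable_oppR.
    + exact: integrable_mulRl.
    + move=> x; have [i1 i0] := indE R Om x; have [Ox|nOx] := pselect (Om x); last first.
        have [_ wnz _ _] := Ww n.
        by rewrite i0// wnz// !mulr0 oppr0.
      rewrite i1// mulr1; have [ue|/wz->] := leP (u x) (e n); last first.
        by rewrite mulr0 oppr0 mulr_ge0 ?mulr_ge0 ?powR_ge0.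
      rewrite -mulNr mulrAC; apply: (@le_trans _ _ (C * e n `^ (p - 1) * w n x)).
        rewrite ler_wpM2r// lerNl.
        apply: le_trans (hC x (u x) (u0 x) (le_trans ue (e1 n))).
        rewrite lerN2 ler_wpM2l//; apply: ler_wpowR => //; exact: ltW.
      by rewrite ler_wpM2l// mulr_ge0// powR_ge0.
  - rewrite -[X in _ --> X](mulr0 (C * M * \int[mu]_x (\1_Om x : R))).
    apply: cvgM; first exact: cvg_cst.
    have := cvg_powR pm (fun n => ltW (e0 n)) (@cvg_invS R).
    by rewrite powR0// gt_eqF.
apply: filterS (ge0_Rintegral_eq0 iY Y0 IY) => z Yz z1 z2.
move: Yz; rewrite /Y /form_density z1 (Z1 _ z1) (Z0 _ (lt0r_neq0 z2)).
rewrite mul1r mul0r subr0 sub0r jpN !mulNr opprK => /eqP.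
rewrite mulf_eq0 => /orP[|/eqP k00].
  rewrite mulf_eq0 => /orP[|/eqP//].
  by rewrite ge0_jp ?ltW// gt_eqF// powR_gt0.
have kz : 0 < k z by apply: kpos => z12; move: z2; rewrite -z12 z1 ltxx.
by rewrite k00 ltxx in kz.
Qed.

End positivity_of_minimisers.

(** * Existence *)

Section existence_of_solutions.
Context d (T : measurableType d) (R : realType).
Variable mu : {sigma_finite_measure set T -> \bar R}.
Variables (Om : set T) (k : T * T -> R) (p c0 : R) (g : T -> R -> R).
Hypothesis p1 : 1 < p.
Hypothesis c00 : 0 < c0.
Hypothesis mOm : measurable Om.
Hypothesis fOm : (mu Om < +oo)%E.
Hypothesis mk : measurable_fun setT k.
Hypothesis k0 : forall z, 0 <= k z.
Hypothesis hg : reaction p c0 g.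
Local Notation intg f := (mu.-integrable setT (EFin \o (f : T -> R))).
Local Notation W := (energy_space mu Om k p).
Local Notation Q := (quotient p g).
Implicit Types (u v w phi : T -> R).

Local Notation positive_solution := (positive_solution mu Om k p g).

Let p0 : 0 < p. Proof. exact: lt_trans ltr01 p1. Qed.

Local Notation compact_embedding := (compact_embedding mu Om k p).
Local Notation F := (primitive g).
Local Notation admissible := (admissible mu Om k p g).
Local Notation action := (action mu k p g).
Local Notation minimal u := (forall v, admissible v -> action u <= action v).

(** Bounded cutoffs of [phi] satisfy the equation already. The growth bound dominates the reaction
    from above, so Fatou first yields integrability of g(x,u) phi; its absolute value then serves as
    majorant for dominated convergence. *)
Lemma weak_formulation_ge0 u phi : admissible u -> minimal u -> W phi ->
  (forall x, 0 <= phi x) ->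
  intg (fun x => g x (u x) * phi x) /\ form mu k p u phi = \int[mu]_x (g x (u x) * phi x).
Proof.
move=> au umin Wphi phi0; have [Wu u0 iF] := au.
have [mu_ uz iu eu] := Wu; have [mphi phiz iphi ephi] := Wphi.
have n0 (n : nat) : 0 < n.+1%:R :> R by rewrite ltr0n.
pose pn n x := Num.min (phi x) n.+1%:R.
have Wpn n : W (pn n) := energy_space_min p1 mk k0 (ltW (n0 n)) Wphi phi0.
have pnM n x : 0 <= pn n x <= n.+1%:R.
  by rewrite le_min phi0 (ltW (n0 n)) ge_min lexx orbT.
have pnphi n x : pn n x <= phi x by rewrite ge_min lexx.
(* Both parameters are n+1: the cutoff has Lipschitz constant 1/(n+1) in [u] and multiplies a
   function of height at most n+1, so the increments of [w n] are at most those of [u] plus those of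
   [phi], uniformly in n. *)
pose w n x := cutoff n.+1%:R (u x) * pn n x.
have Ww n : W (w n) := energy_space_cutoff p1 mk k0 (n0 n) Wu u0 (Wpn n) (pnM n).
have w0 n x : 0 <= w n x.
  have /andP[h _] := cutoff_itv (n0 n) (u0 x); have /andP[h' _] := pnM n x.
  exact: mulr_ge0.
have wpn n x : w n x <= pn n x.
  have /andP[h1 h2] := cutoff_itv (n0 n) (u0 x); have /andP[h3 h4] := pnM n x.
  by rewrite -(mul1r (pn n x)); apply: ler_pM.
have wphi n x : w n x <= phi x := le_trans (wpn n x) (pnphi n x).
have wM n x : `|w n x| <= n.+1%:R.
  by rewrite ger0_norm// (le_trans (wpn n x))//; have /andP[] := pnM n x.
have wz n x : n.+1%:R < u x -> w n x = 0 by move=> h; rewrite /w cutoff_eq0 ?mul0r.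
have EL n := euler_lagrange p1 c00 mOm fOm mk k0 hg au umin (Ww n) (ltW (n0 n)) (wM n) (wz n).
have cw x : w ^~ x @ \oo --> phi x.
  rewrite -[X in _ --> X]mul1r; apply: cvgM; first exact: cutoff_to1.
  exact: (@cvg_min_nat R).
have cform : form mu k p u (w n) @[n --> \oo] --> form mu k p u phi.
  apply: (form_cvg p1 mk k0 Wu Ww Wphi Wphi cw) => n x y.
  apply: (le_trans (cutoff_mul_lip (n0 n) (u0 x) (u0 y) (pnM n x) (pnM n y))).
  rewrite mulfV ?gt_eqF// mul1r addrC lerD2r; exact: minr_contr.
have mgphi : measurable_fun setT (fun x => g x (u x) * phi x).
  by apply: measurable_funM => //; exact: (measurable_reaction hg).
(* Majorant of c0 (1 + u^(p-1)) phi, from phi <= 1 + phi^p and u^(p-1) phi <= u^p + phi^p. *)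
pose G x := c0 * (\1_Om x + `|phi x| `^ p + (`|u x| `^ p + `|phi x| `^ p)).
have iG : intg G.
  apply/integrable_mulRl/integrable_addR; apply: integrable_addR => //.
  exact: integrable_ind.
have [iN _] : intg (fun x => - (g x (u x) * phi x)) /\
    \int[mu]_x (- (g x (u x) * phi x)) <= - form mu k p u phi.
  apply: (@real_fatou _ _ _ mu (fun n x => - (g x (u x) * w n x)) _ G
    (fun n => - form mu k p u (w n))) => //.
  - by move=> n; apply: integrable_oppR; exact: (EL n).1.
  - exact: measurable_funN.
  - move=> n x; rewrite lerN2 /G; have [i1 i0] := indE R Om x.
    have [Ox|nOx] := pselect (Om x); last first.
      have [_ wnz _ _] := Ww n; rewrite wnz// mulr0 i0//.
      by rewrite mulr_ge0 ?(ltW c00)// !addr_ge0 ?powR_ge0.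
    rewrite i1//; apply: (@le_trans _ _ (c0 * (1 + u x `^ (p - 1)) * phi x)).
      apply: (@le_trans _ _ (c0 * (1 + u x `^ (p - 1)) * w n x)).
        by rewrite ler_wpM2r//; exact: (reaction_le hg).
      by rewrite ler_wpM2l// mulr_ge0 ?(ltW c00)// addr_ge0// powR_ge0.
    rewrite -mulrA ler_pM2l// mulrDl mul1r; apply: lerD.
      rewrite ger0_norm//; have [h|/ltW h] := leP (phi x) 1.
        by rewrite (le_trans h)// lerDl powR_ge0.
      by rewrite (@le_trans _ _ (phi x `^ p)) ?lerDr// le1r_powR// ltW.
    have := normr_jpM (u x) (phi x) p1; rewrite ge0_jp// ger0_norm// mulr_ge0//.
    exact: powR_ge0.
  - apply: aeW => x; apply: cvgN; apply: cvgM; [exact: cvg_cst|exact: cw].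
  - by move=> n; rewrite RintegralNT; [rewrite (EL n).2|exact: (EL n).1].
  - exact: cvgN.
have ig : intg (fun x => g x (u x) * phi x).
  by apply: (integrable_eqR _ (integrable_oppR iN)) => x; rewrite opprK.
split=> //.
have [_ cI] : intg (fun x => g x (u x) * phi x) /\
    \int[mu]_x (g x (u x) * w n x) @[n --> \oo] --> \int[mu]_x (g x (u x) * phi x).
  apply: (dominated_cvgR (G := fun x => `|g x (u x) * phi x|)) => //.
  - by move=> n; exact: (integrable_measurable (EL n).1).
  - exact: integrable_normR.
  - apply: aeW => x n; rewrite normrM [leRHS]normrM ler_wpM2l//.
    by rewrite (ger0_norm (w0 n x)) (ger0_norm (phi0 x)); exact: wphi.
  - apply: aeW => x; apply: cvgM; [exact: cvg_cst|exact: cw].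
have E : (fun n => form mu k p u (w n)) = (fun n => \int[mu]_x (g x (u x) * w n x)).
  by apply/funext => n; rewrite (EL n).2.
by rewrite E in cform; exact: (cvg_unique _ cform cI).
Qed.

Lemma weak_formulation u phi : admissible u -> minimal u -> W phi ->
  intg (fun x => g x (u x) * phi x) /\ form mu k p u phi = \int[mu]_x (g x (u x) * phi x).
Proof.
move=> au umin Wphi; have [Wu _ _] := au.
pose a x := Num.max 0 (phi x); pose b x := Num.max 0 (- 1 * phi x).
have Wa : W a := energy_space_max0 p1 mk k0 Wphi.
have Wb : W b := energy_space_max0 p1 mk k0 (energy_spaceZ p1 mk k0 (-1) Wphi).
have ab x : phi x = a x - b x.
  rewrite /a /b mulN1r; have [h|/ltW h] := leP 0 (phi x).
    by rewrite max_l ?subr0// oppr_le0.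
  by rewrite max_r ?oppr_ge0// sub0r opprK.
have a0 x : 0 <= a x by rewrite le_max lexx.
have b0 x : 0 <= b x by rewrite le_max lexx.
have [ia Ia] := weak_formulation_ge0 au umin Wa a0.
have [ib Ib] := weak_formulation_ge0 au umin Wb b0.
split.
  by apply: (integrable_eqR _ (integrable_subR ia ib)) => x; rewrite (ab x) mulrBr.
rewrite (@eq_Rintegral _ _ _ _ _ (fun x => g x (u x) * a x - g x (u x) * b x)); last first.
  by move=> x _; rewrite (ab x) mulrBr.
rewrite RintegralBT// -Ia -Ib /form -RintegralBT; last 2 first.
- exact: (integrable_form_density p1 mk k0 Wu Wa).
- exact: (integrable_form_density p1 mk k0 Wu Wb).
apply: eq_Rintegral => z _; rewrite /form_density (ab z.1) (ab z.2) -mulrBl -mulrBr.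
by congr (_ * _ * _); ring.
Qed.

Lemma energy_space_ae u u' : W u -> measurable_fun setT u' ->
  (forall x, ~ Om x -> u' x = 0) -> {ae mu, forall x, u x = u' x} ->
  W u' /\ forall phi, measurable_fun setT phi -> form mu k p u phi = form mu k p u' phi.
Proof.
move=> [mu_ uz iu eu] mu' uz' uu'.
have uu2 := ae_prod uu' uu'.
split; last first.
  move=> phi mphi; rewrite /form /Rintegral; congr fine; apply: ae_eq_integral => //.
  - by apply/measurable_EFinP; exact: measurable_form_density.
  - by apply/measurable_EFinP; exact: measurable_form_density.
  - by apply: filterS uu2 => z [h1 h2] _; rewrite /form_density h1 h2.
split=> //; apply: ge0_integrable_lt.
- exact: measurable_normr_powR.
- by move=> x; exact: powR_ge0.
- rewrite (_ : \int[mu]_x (`|u' x| `^ p)%:E = \int[mu]_x (`|u x| `^ p)%:E)%E.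
    by rewrite EFin_Rintegral// ltry.
  apply: ae_eq_integral => //; [exact/measurable_EFinP/measurable_normr_powR..|].
  by apply: filterS uu' => x -> _.
- exact: measurable_energy_density.
- by move=> z; exact: energy_density_ge0.
- rewrite (_ : \int[mu \x mu]_z (energy_density k p u' z)%:E =
     \int[mu \x mu]_z (energy_density k p u z)%:E)%E.
    by rewrite EFin_Rintegral// ltry.
  apply: ae_eq_integral => //.
  - by apply/measurable_EFinP; exact: measurable_energy_density.
  - by apply/measurable_EFinP; exact: measurable_energy_density.
  - by apply: filterS uu2 => z [h1 h2] _; rewrite /energy_density h1 h2.
Qed.

(** The function [psi], bounded and positive exactly where positivity is wanted, feeds
    [strong_positivity]. *)
Theorem existence (a0 ainf : T -> \bar R) (C1 : R) (v psi : T -> R) (M : R) :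
  compact_embedding ->
  (forall z, z.1 <> z.2 -> 0 < k z) ->
  W psi -> (forall x, 0 <= psi x <= M) -> (forall x, Om x -> 0 < psi x) ->
  (forall x, (ainf x <= (Q x 1)%:E)%E) -> measurable_fun setT ainf ->
  (forall x, Om x -> (Q x n.+1%:R)%:E @[n --> \oo] --> ainf x) ->
  (forall v, W v -> ~ {ae mu, forall x, v x = 0} ->
     ((2 * c0 * \int[mu]_x (`|v x| `^ p))%:E <
       (energy mu k p v)%:E + \int[mu]_x (((2 * c0)%:E - ainf x) * (`|v x| `^ p)%:E))%E) ->
  W v -> 0 <= C1 -> measurable_fun setT a0 -> (forall x, (0 <= a0 x + C1%:E)%E) ->
  (forall x t, 0 < t -> t <= 1 -> - C1 <= Q x t) ->
  (forall x (t : nat -> R), Om x -> (forall n, 0 < t n) -> t @ \oo --> (0 : R) ->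
     (Q x (t n))%:E @[n --> \oo] --> a0 x) ->
  ((energy mu k p v + C1 * \int[mu]_x (`|v x| `^ p))%:E <
     \int[mu]_x ((a0 x + C1%:E) * (`|v x| `^ p)%:E))%E ->
  exists u, positive_solution u.
Proof.
move=> cpt kpos Wpsi psiM psi0 ainfQ mainf cainf hinf Wv C10 ma0 a0C QC ca0 hv.
have c2 : 0 <= 2 * c0 by rewrite mulr_ge0// ltW.
have mQ n : measurable_fun setT (fun x => (2 * c0 - Q x n.+1%:R)%:E).
  apply/measurable_EFinP; apply: measurable_funB => //.
  exact: (measurable_quotient hg (measurable_cst _)).
have Q2 x : (ainf x <= (2 * c0)%:E)%E.
  apply: (le_trans (ainfQ x)); rewrite lee_fin.
  exact: (quotient_le2 hg x 0).
have [n [dl [dl0 hdl]]] : exists n (dl : R), 0 < dl /\ forall v, W v ->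
    (((2 * c0 + dl) * \int[mu]_x (`|v x| `^ p))%:E <=
       (energy mu k p v)%:E + \int[mu]_x ((2 * c0 - Q x n.+1%:R)%:E * (`|v x| `^ p)%:E))%E.
  apply: (spectral_gap p1 mk k0 (b_ := fun n x => (2 * c0 - Q x n.+1%:R)%:E)
    (b := fun x => ((2 * c0)%:E - ainf x)%E) cpt c2 mQ) => //.
  - exact: emeasurable_funB.
  - by move=> n x; rewrite lee_fin subr_ge0; exact: (quotient_le2 hg).
  - by move=> x; rewrite sube_ge0 ?orbT.
  - move=> x Ox.
    have dC : ((2 * c0)%:E +? - ainf x)%E by rewrite fin_num_adde_defr.
    have cC : (fun _ : nat => (2 * c0)%:E) @ \oo --> (2 * c0)%:E by exact: cvg_cst.
    exact: (cvgeB dC cC (cainf x Ox)).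
have [K coer] := action_coercive p1 c00 mOm fOm hg hdl.
have neg := action_negative p1 c00 mOm fOm mk k0 hg Wv C10 ma0 a0C QC ca0 hv.
have [u [au uneg umin]] := minimiser p1 c00 mOm fOm mk k0 hg cpt dl0 coer neg.
have [Wu u0 iF] := au; have [mu_ uz iu eu] := Wu.
have SP := strong_positivity p1 c00 mOm fOm mk k0 hg au umin Wpsi psiM kpos.
pose Z := Om `&` [set x | u x = 0].
have mlev : measurable [set x | u x = 0].
  rewrite -[X in measurable X]setTI.
  by rewrite (_ : [set x | u x = 0] = u @^-1` [set 0])//; exact: mu_.
have mZ : measurable Z by apply: measurableI.
pose P := [set x | 0 < u x].
have mP : measurable P.
  rewrite -[X in measurable X]setTI (_ : P = u @^-1` `]0, +oo[).
    by apply: mu_ => //; exact: measurable_itv.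
  by apply/seteqP; split=> x; rewrite /P /= in_itv/= andbT.
(* The zero set in [Om] times the positivity set is null in the product; the second factor is not
   null, because the action is negative while it vanishes for u = 0. *)
have ZP0 : (mu Z * mu P = 0)%E.
  have [N [mN N0 NZ]] := SP.
  rewrite -product_measure1E//; apply/eqP; rewrite eq_le measure_ge0 andbT -[leRHS]N0.
  apply: le_measure; rewrite ?inE//; first exact: measurableX.
  move=> z [[Oz z1] z2]; apply: NZ => /= /(_ z1 z2) psi1.
  by have := psi0 _ Oz; rewrite psi1 ltxx.
have P0 : (mu P != 0)%E.
  apply/eqP => P0.
  have u00 : {ae mu, forall x, u x = 0}.
    exists P; split=> // x /= /eqP ux.
    by rewrite /P /= lt_neqAle eq_sym ux u0.
  have E0 : energy mu k p u = 0.
    rewrite /energy /Rintegral (ae_eq_integral (cst 0)%E)//.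
    - by rewrite integral0.
    - by apply/measurable_EFinP; exact: measurable_energy_density.
    - apply: filterS (ae_prod u00 u00) => z [h1 h2] _.
      by rewrite /energy_density h1 h2 subrr normr0 powR0 ?mul0r// gt_eqF.
  have F0 : \int[mu]_x F x (u x) = 0.
    rewrite /Rintegral (ae_eq_integral (cst 0)%E)//.
    - by rewrite integral0.
    - by apply/measurable_EFinP; exact: (measurable_primitive hg).
    - by apply: filterS u00 => x h1 _; rewrite h1 (primitive0 hg).
  by move: uneg; rewrite /action E0 F0 mulr0 subrr ltxx.
have Z00 : mu Z = 0%E.
  by move/eqP: ZP0; rewrite mule_eq0 (negPf P0) orbF => /eqP.
(* Raising the minimiser to 1 on the null set [Z] gives positivity at every point of [Om]. *)
pose u' x := u x + \1_Z x.
have mu' : measurable_fun setT u'.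
  by apply: measurable_funD => //; exact: (@measurable_indic _ _ R setT Z mZ).
have u'z x : ~ Om x -> u' x = 0.
  by move=> nO; rewrite /u' uz// indicE memNset ?addr0// => -[].
have uu' : {ae mu, forall x, u x = u' x}.
  exists Z; split=> // x /= ux; apply: contrapT => nZ; apply: ux.
  by rewrite /u' indicE memNset ?addr0.
have [Wu' Fu'] := energy_space_ae Wu mu' u'z uu'.
exists u'; split=> // [x Ox|phi Wphi].
  rewrite /u' indicE; have [ux|ux] := eqVneq (u x) 0.
    by rewrite ux add0r mem_set// ltr01.
  by rewrite ltr_pwDl// lt_neqAle eq_sym ux u0.
have [ig Ig] := weak_formulation au umin Wphi.
have [mphi _ _ _] := Wphi.
have mg : measurable_fun setT (fun x => (g x (u' x) * phi x)%:E).
  by apply/measurable_EFinP; apply: measurable_funM => //; exact: (measurable_reaction hg).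
have mg' : measurable_fun setT (fun x => (g x (u x) * phi x)%:E).
  by apply/measurable_EFinP; apply: measurable_funM => //; exact: (measurable_reaction hg).
split.
  apply/integrableP; split=> //.
  have /integrableP[_ fin] := ig; apply: le_lt_trans fin.
  rewrite le_eqVlt; apply/orP; left; apply/eqP; apply: ae_eq_integral => //.
  - exact: measurableT_comp.
  - exact: measurableT_comp.
  - by apply: filterS uu' => x h _ /=; rewrite h.
rewrite -Fu'// Ig /Rintegral; congr fine; apply: ae_eq_integral => //.
by apply: filterS uu' => x h _; rewrite h.
Qed.

End existence_of_solutions.

(** * Compactness *)

Lemma geometric_cauchy (R : realType) (a : nat -> R) (c : R) :
  (forall k, `|a k.+1 - a k| <= c * 2^-1 ^+ k) ->
  cvgn a /\ forall n, `|a n| <= `|a 0%N| + 2 * c.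
Proof.
move=> ha; have c0 : 0 <= c.
  by have := ha 0%N; rewrite expr0 mulr1; exact: le_trans.
split.
  have ct : cvgn (series (telescope a)).
    apply: (@normed_cvg R R^o); apply: (series_le_cvg _ _ ha).
    - by move=> n; exact: normr_ge0.
    - by move=> n; rewrite mulr_ge0// exprn_ge0// invr_ge0.
    - by apply: is_cvg_geometric_series; rewrite ger0_norm// invf_lt1// ltr1n.
  rewrite (_ : a = fun n => a 0%N + series (telescope a) n); last first.
    by apply/funext => n; rewrite -eq_sum_telescope.
  by apply: is_cvgD => //; exact: is_cvg_cst.
move=> n; suff h : `|a n - a 0%N| <= 2 * c * (1 - 2^-1 ^+ n).
  rewrite -[a n](subrK (a 0%N)) addrC; apply: (le_trans (ler_normD _ _)).
  rewrite lerD2l; apply: (le_trans h); apply: ler_piMr; first exact: mulr_ge0.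
  by rewrite gerBl exprn_ge0// invr_ge0.
elim: n => [|n IH]; first by rewrite subrr normr0 expr0 subrr mulr0.
rewrite (_ : a n.+1 - a 0%N = (a n.+1 - a n) + (a n - a 0%N)); last ring.
apply: (le_trans (ler_normD _ _)); apply: (le_trans (lerD (ha n) IH)).
by rewrite exprS le_eqVlt; apply/orP; left; apply/eqP; field.
Qed.

(** An ultrafilter replaces nested subsequences: at each level one colour is selected by it, and
    finitely many levels together with n <= m can be met simultaneously. *)
Lemma diagonal_extraction (K : nat -> finType) (col : forall k, nat -> K k) :
  exists f : nat -> nat, (forall n, (n <= f n)%N) /\
    forall k n, (k <= n)%N -> col k (f n) = col k (f k).
Proof.
have [U [uU Uoo]] := @ultraFilterLemma nat \oo _.
have hc k : exists c : K k, U [set n | col k n = c].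
  apply: contrapT => nc.
  have h : U [set n | forall c : K k, col k n <> c].
    apply: (@filter_forall nat (K k) (fun c n => col k n <> c) U _) => c.
    have [h|//] := in_ultra_setVsetC [set n | col k n = c] uU.
    by exfalso; apply: nc; exists c.
  by have [n /(_ (col k n))] := filter_ex h.
pose c k := projT1 (cid (hc k)).
have cU k : U [set n | col k n = c k] by rewrite /c; case: cid.
have hf n : exists m, (n <= m)%N /\ forall j : 'I_n.+1, col j m = c j.
  have h1 : U [set m | forall j : 'I_n.+1, col j m = c j].
    by apply: (@filter_forall nat 'I_n.+1 (fun j m => col j m = c j) U _) => j; exact: cU.
  have h2 : U [set m | (n <= m)%N] by apply: Uoo; exists n.
  by have [m [hm1 hm2]] := filter_ex (filterI h1 h2); exists m.
have [f hf'] := choice hf; exists f; split; first by move=> n; have [] := hf' n.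
move=> k n kn; have [_ h1] := hf' n; have [_ h2] := hf' k.
by rewrite (h1 (Ordinal (kn : (k < n.+1)%N))) (h2 ord_max).
Qed.

Section extraction.
Context d (T : measurableType d) (R : realType).
Variable mu : {measure set T -> \bar R}.
Variables (Om : set T) (p : R).
Hypothesis p1 : 1 < p.
Local Notation intg f := (mu.-integrable setT (EFin \o (f : T -> R))).

(** The Riesz-Fischer argument with explicit rates. Points of equal colour are close in L^p, and the
    diagonal sequence has rapidly decreasing increments, which give pointwise convergence and a
    majorant at once. *)
Lemma totally_bounded_extraction (w : nat -> T -> R) :
  (forall n, measurable_fun setT (w n)) -> (forall n, intg (fun x => `|w n x| `^ p)) ->
  (forall n x, ~ Om x -> w n x = 0) ->
  (forall e : R, 0 < e -> exists (K : finType) (col : nat -> K), forall n m,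
     col n = col m -> \int[mu]_x (`|w n x - w m x| `^ p) <= e) ->
  exists (f : nat -> nat) (u H : T -> R),
    [/\ (forall n, (n <= f n)%N),
        measurable_fun setT u /\ (forall x, ~ Om x -> u x = 0), intg H,
        {ae mu, forall x n, `|w (f n) x| `^ p <= H x} &
        {ae mu, forall x, (fun n => w (f n) x) @ \oo --> u x}].
Proof.
(* With weights 2^(kp) and tolerances 2^(-k)/2^(kp), the sum S of the weighted p-th powers of
   increments is integrable, and where S is finite the k-th increment is at most S^(1/p) 2^(-k). *)
move=> mw iw wz tb; have p0 : 0 < p by exact: lt_trans ltr01 p1.
pose g k : R := (2 ^+ k) `^ p.
have g0 k : 0 < g k by rewrite powR_gt0// exprn_gt0.
pose e k : R := 2^-1 ^+ k / g k.
have e0 k : 0 < e k by rewrite divr_gt0// exprn_gt0// invr_gt0.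
pose K k := projT1 (cid (tb (e k) (e0 k))).
have hcol k : {col : nat -> K k | forall n m,
     col n = col m -> \int[mu]_x (`|w n x - w m x| `^ p) <= e k}.
  by apply: cid; rewrite /K; case: cid.
pose col k := projT1 (hcol k).
have [f [fn fcol]] := diagonal_extraction col.
pose dk k x := w (f k.+1) x - w (f k) x.
have mdk k : measurable_fun setT (dk k) by exact: measurable_funB.
have idk k : intg (fun x => `|dk k x| `^ p).
  apply: (@integrable_le _ _ _ _ _
     (fun x => 2 `^ p * (`|w (f k.+1) x| `^ p + `|w (f k) x| `^ p))).
  - exact: measurable_normr_powR.
  - move=> x; rewrite ger0_norm ?powR_ge0// /dk.
    by rewrite -(normrN (w (f k) x)); apply: powR_normD; exact: ltW.
  - by apply: integrable_mulRl; exact: integrable_addR.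
have Idk k : \int[mu]_x (`|dk k x| `^ p) <= e k.
  have := projT2 (hcol k); apply; rewrite -/(col k).
  by rewrite (fcol k k.+1)// (fcol k k).
pose s k x : \bar R := (g k * `|dk k x| `^ p)%:E.
have s0 k x : (0 <= s k x)%E by rewrite lee_fin mulr_ge0 ?powR_ge0// ltW.
have ms k : measurable_fun setT (s k).
  by apply/measurable_EFinP; apply: measurable_funM => //; exact: measurable_normr_powR.
pose S x := (\sum_(0 <= k <oo) s k x)%E.
have S0 x : (0 <= S x)%E by apply: nneseries_ge0 => k _ _; exact: s0.
have mS : measurable_fun setT S.
  by apply: ge0_emeasurable_sum => // k _; exact: ms.
have IS : (\int[mu]_x S x < +oo)%E.
  rewrite integral_nneseries//.
  apply: (@le_lt_trans _ _ (\sum_(0 <= k <oo) (2 / (2 ^ (k + 1))%:R)%:E)%E).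
    apply: lee_nneseries => k _; first by move=> _; apply: integral_ge0 => x _; exact: s0.
    rewrite EFin_Rintegral; last exact: integrable_mulRl.
    rewrite RintegralZT// lee_fin addn1 natrX exprS invfM mulrA divff// mul1r -exprVn.
    apply: (@le_trans _ _ (g k * e k)); first by rewrite ler_pM2l.
    by rewrite /e mulrCA mulfV ?mulr1// gt_eqF.
  by rewrite (cvg_lim _ (cvg_geometric_eseries_half (r := 2) (n := 0)))// ltry.
have Sfin : {ae mu, forall x, S x \is a fin_num}.
  have iS : mu.-integrable setT S.
    apply/integrableP; split=> //; under eq_integral => x _ do rewrite gee0_abs//.
    exact: IS.
  by apply: filterS (integrable_ae measurableT iS) => x; exact.
have key x : S x \is a fin_num -> forall k,
    `|dk k x| <= (fine (S x)) `^ p^-1 * 2^-1 ^+ k.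
  move=> Sx k.
  have sS : (s k x <= S x)%E.
    apply: le_trans (nneseries_lim_ge k.+1 (fun n _ _ => s0 n x)).
    rewrite big_nat_recr//= leeDr// sume_ge0//.
  have : g k * `|dk k x| `^ p <= fine (S x) by rewrite -lee_fin fineK.
  rewrite -ler_pdivlMl// => h.
  have : (`|dk k x| `^ p) `^ p^-1 <= ((g k)^-1 * fine (S x)) `^ p^-1.
    by apply: ler_wpowR => //; rewrite invr_ge0 ltW.
  rewrite -powRrM mulfV ?gt_eqF// powRr1// => /le_trans; apply.
  rewrite powRM ?invr_ge0 ?(ltW (g0 k))//; last by rewrite fine_ge0.
  rewrite mulrC ler_wpM2l ?powR_ge0// /g -powRV ?exprn_ge0// -powRrM mulfV ?gt_eqF//.
  by rewrite powRr1 ?invr_ge0 ?exprn_ge0// exprVn.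
(* Setting the sequence to 0 where S is infinite makes it converge at every point, so that the limit
   is Borel. *)
pose ind x : R := \1_[set x | S x \is a fin_num] x.
have mfin : measurable [set x | S x \is a fin_num].
  by rewrite -[X in measurable X]setTI; exact: emeasurable_fin_num.
have mind : measurable_fun setT ind by exact: (@measurable_indic _ _ R setT _ mfin).
have cvgw x : S x \is a fin_num -> cvgn (fun n => w (f n) x) /\
    forall n, `|w (f n) x| <= `|w (f 0%N) x| + 2 * (fine (S x)) `^ p^-1.
  by move=> Sx; apply: geometric_cauchy; exact: key.
pose u x := limn (fun n => w (f n) x * ind x).
have cu x : (fun n => w (f n) x * ind x) @ \oo --> u x.
  rewrite /u; have [Sx|Sx] := pselect (S x \is a fin_num).
    have -> : ind x = 1 by rewrite /ind indicE mem_set.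
    by under eq_fun do rewrite mulr1; have [] := cvgw x Sx.
  have -> : ind x = 0 by rewrite /ind indicE memNset.
  by under eq_fun do rewrite mulr0; exact: is_cvg_cst.
exists f, u, (fun x => 2 `^ p * (`|w (f 0%N) x| `^ p + 2 `^ p * fine (S x))); split=> //.
- split; last first.
    move=> x nO; rewrite /u (_ : (fun n => _) = fun=> 0) ?lim_cst//.
    by apply/funext => n; rewrite wz// mul0r.
  apply: (@measurable_fun_cvg _ _ _ setT (fun n x => w (f n) x * ind x)) => // n.
  exact: measurable_funM.
- apply: integrable_mulRl; apply: integrable_addR => //; apply: integrable_mulRl.
  have mfS : measurable_fun setT (fun x => fine (S x)).
    exact: (measurableT_comp (fine_measurable measurableT)).
  apply: ge0_integrable_lt => //; first by move=> x; exact: fine_ge0.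
  apply: le_lt_trans IS; apply: ge0_le_integral => //.
  - by move=> x _; rewrite lee_fin fine_ge0.
  - exact/measurable_EFinP.
  - move=> x _; have := S0 x; case: (S x) => [r _|_|//]; [exact: lexx|exact: le0y].
- apply: filterS Sfin => x Sx n; have [_ h] := cvgw x Sx.
  have r0 : 0 <= (fine (S x)) `^ p^-1 by exact: powR_ge0.
  apply: (@le_trans _ _ (`| `|w (f 0%N) x| + 2 * (fine (S x)) `^ p^-1| `^ p)).
    by apply: ler_wpowR; [exact: ltW| |rewrite [leRHS]ger0_norm ?addr_ge0 ?mulr_ge0].
  apply: (le_trans (powR_normD _ _ (ltW p0))); rewrite normr_id ler_wpM2l ?powR_ge0//.
  rewrite lerD2l ger0_norm ?mulr_ge0// powRM// -powRrM mulVf ?gt_eqF// powRr1//.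
  by rewrite fine_ge0.
- apply: filterS Sfin => x Sx; have := cu x.
  have -> : ind x = 1 by rewrite /ind indicE mem_set.
  by under eq_fun do rewrite mulr1.
Qed.

End extraction.

(** * Approximation by step functions on cells *)

Section partitions.
Context d (T : measurableType d) (R : realType).
Variable mu : {sigma_finite_measure set T -> \bar R}.
Variables (Om : set T) (k : T * T -> R) (p : R).
Hypothesis p1 : 1 < p.
Hypothesis mk : measurable_fun setT k.
Hypothesis k0 : forall z, 0 <= k z.
Local Notation intg f := (mu.-integrable setT (EFin \o (f : T -> R))).
Local Notation W := (energy_space mu Om k p).
Let p0 : 0 < p. Proof. exact: lt_trans ltr01 p1. Qed.

(** On a cell the kernel is at least 1/D off the diagonal, so replacing a function by constants on
    cells of measure [q] costs D/q times its energy in L^p: this ratio must be small. The cells may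
    stick out of [Om]. *)
Record cell_partition (C : finType) (Q : C -> set T) (q D : R) : Prop := CellPartition {
  cell_measurable : forall c, measurable (Q c);
  cell_measure : forall c, mu (Q c) = q%:E;
  cell_gt0 : 0 < q;
  cell_disjoint : forall c c' x, Q c x -> Q c' x -> c = c';
  cell_cover : forall x, Om x -> exists c, Q c x;
  cell_kernel : forall c x y, Q c x -> Q c y -> x <> y -> 1 <= D * k (x, y);
  cell_const : 0 <= D }.

Section one_partition.
Variables (C : finType) (Q : C -> set T) (q D : R).
Hypothesis hQ : cell_partition Q q D.
Local Notation ind c := (\1_(Q c) : T -> R).

Lemma cell_ind c x : (Q c x -> ind c x = 1) /\ (~ Q c x -> ind c x = 0).
Proof. split=> Qx; rewrite indicE.
  by rewrite mem_set.
by rewrite memNset. Qed.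

Lemma cell_ind_itv c x : 0 <= ind c x <= 1.
Proof. by rewrite indicE; case: (_ \in _); rewrite /= ?lexx ?ler01. Qed.

Lemma measurable_cell_ind c : measurable_fun setT (ind c).
Proof. exact: (@measurable_indic _ _ R setT (Q c) (cell_measurable hQ c)). Qed.

Lemma integrable_cell_ind c : intg (ind c).
Proof.
apply: ge0_integrable_lt.
- exact: measurable_cell_ind.
- by move=> x; have /andP[] := cell_ind_itv c x.
- rewrite integral_indic//; last exact: (cell_measurable hQ).
  by rewrite setIT [X in (X < _)%E](cell_measure hQ c) ltry.
Qed.

Lemma Rintegral_cell_ind c : \int[mu]_x ind c x = q.
Proof.
rewrite /Rintegral integral_indic//; last exact: (cell_measurable hQ).
by rewrite setIT [X in fine X](cell_measure hQ c).
Qed.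

Lemma sum_cell_ind_le x y : \sum_c ind c x * ind c y <= 1.
Proof.
have [[c Qc]|nc] := pselect (exists c, Q c x); last first.
  rewrite big1// => c _; rewrite (cell_ind c x).2 ?mul0r// => Qc.
  by apply: nc; exists c.
rewrite (bigD1 c)//= big1 ?addr0; last first.
  move=> c' c'c; rewrite (cell_ind c' x).2 ?mul0r// => Qc'.
  by rewrite (cell_disjoint hQ Qc' Qc) eqxx in c'c.
have /andP[h1 h2] := cell_ind_itv c x; have /andP[h3 h4] := cell_ind_itv c y.
by rewrite -[leRHS]mulr1; apply: ler_pM.
Qed.


Definition cell_density c u (z : T * T) : R :=
  ind c z.1 * ind c z.2 * energy_density k p u z.

Lemma measurable_cell_ind2 c : measurable_fun setT (fun z : T * T => ind c z.1 * ind c z.2).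
Proof.
apply: measurable_funM.
  exact: (measurableT_comp (measurable_cell_ind c) measurable_fst).
exact: (measurableT_comp (measurable_cell_ind c) measurable_snd).
Qed.

Lemma integrable_cell_density c u : W u ->
  (mu \x mu)%E.-integrable setT (EFin \o cell_density c u).
Proof.
move=> [mu_ uz iu eu]; apply: (integrable_le _ _ eu).
  apply: measurable_funM; last exact: measurable_energy_density.
  exact: measurable_cell_ind2.
move=> z; rewrite /cell_density normrM (ger0_norm (energy_density_ge0 _ k0 _ _)).
rewrite ler_piMl ?energy_density_ge0// normrM.
have /andP[h1 h2] := cell_ind_itv c z.1; have /andP[h3 h4] := cell_ind_itv c z.2.
by rewrite !ger0_norm// -[leRHS]mulr1; apply: ler_pM.
Qed.

(* Mean value: some point of the cell does at least as well as the average,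
   so that no Jensen inequality is needed. *)
Lemma cell_value c u e : 0 < e -> W u -> exists y,
  intg (fun x => ind c x * `|u x - u y| `^ p) /\
  q * \int[mu]_x (ind c x * `|u x - u y| `^ p) <=
    D * \int[(mu \x mu)%E]_z cell_density c u z + e.
Proof.
move=> e0 Wu; have [mu_ uz iu eu] := Wu; have q0 := cell_gt0 hQ.
pose h z := ind c z.1 * ind c z.2 * `|u z.1 - u z.2| `^ p.
have mh : measurable_fun setT h.
  apply: measurable_funM; first exact: measurable_cell_ind2.
  by apply: measurable_normr_powR; exact: measurable_incr.
have ind0 x : 0 <= ind c x by have /andP[] := cell_ind_itv c x.
have h0 z : 0 <= h z by rewrite mulr_ge0 ?powR_ge0// mulr_ge0.
have hle z : h z <= D * cell_density c u z.
  rewrite /h /cell_density mulrCA.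
  have [Q1|nQ1] := pselect (Q c z.1); last by rewrite (cell_ind c z.1).2// !mul0r.
  have [Q2|nQ2] := pselect (Q c z.2); last by rewrite (cell_ind c z.2).2// !(mulr0, mul0r).
  rewrite (cell_ind c z.1).1// (cell_ind c z.2).1// !mul1r /energy_density.
  have [z12|z12] := pselect (z.1 = z.2).
    by rewrite z12 subrr normr0 powR0 ?mul0r ?mulr0// gt_eqF.
  rewrite mulrCA ler_peMr ?powR_ge0//.
  by have := cell_kernel hQ Q1 Q2 z12; rewrite -surjective_pairing.
have icd := integrable_mulRl D (integrable_cell_density c Wu).
have ih : (mu \x mu)%E.-integrable setT (EFin \o h).
  by apply: (integrable_le mh _ icd) => z; rewrite ger0_norm.
have Ih : \int[(mu \x mu)%E]_z h z <= D * \int[(mu \x mu)%E]_z cell_density c u z.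
  rewrite -RintegralZT; last exact: integrable_cell_density.
  exact: ler_Rintegral.
pose A := \int[(mu \x mu)%E]_z h z.
have mrow y : measurable_fun setT (fun x => ind c x * `|u x - u y| `^ p).
  apply: measurable_funM; first exact: measurable_cell_ind.
  by apply: measurable_normr_powR; exact: measurable_funB.
have row0 y x : 0 <= ind c x * `|u x - u y| `^ p by rewrite mulr_ge0 ?powR_ge0.
suff [y Qy hy] : exists2 y, Q c y &
    (\int[mu]_x (ind c x * `|u x - u y| `^ p)%:E <= (q^-1 * (A + e))%:E)%E.
  have iy : intg (fun x => ind c x * `|u x - u y| `^ p).
    by apply: ge0_integrable_lt => //; apply: le_lt_trans hy _; exact: ltry.
  exists y; split=> //; rewrite -ler_pdivlMl//.
  move: hy; rewrite EFin_Rintegral// lee_fin => /le_trans; apply.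
  by rewrite ler_wpM2l ?invr_ge0 ?(ltW q0)// lerD2r.
(* If every point of the cell did worse than average plus e, integrating over the cell would give A
   + e <= A; the slack [e] makes this absurd. *)
apply: contrapT => ny.
have big y : Q c y -> ((q^-1 * (A + e))%:E <= \int[mu]_x (ind c x * `|u x - u y| `^ p)%:E)%E.
  by move=> Qy; rewrite leNgt; apply/negP => hy; apply: ny; exists y => //; exact: ltW.
have fub : (\int[mu \x mu]_z (h z)%:E = \int[mu]_y \int[mu]_x (h (y, x))%:E)%E.
  apply: fubini_tonelli1; first exact/measurable_EFinP.
  by move=> z; rewrite lee_fin.
have : ((A + e)%:E <= \int[mu \x mu]_z (h z)%:E)%E.
  rewrite fub; apply: (@le_trans _ _ (\int[mu]_y (ind c y * (q^-1 * (A + e)))%:E)%E).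
    rewrite (_ : \int[mu]_y _ = (q^-1 * (A + e) * q)%:E)%E.
      by rewrite mulrAC mulVf ?mul1r// gt_eqF.
    under eq_integral => y _ do rewrite mulrC.
    rewrite EFin_Rintegral ?RintegralZT ?Rintegral_cell_ind//.
      exact: integrable_cell_ind.
    exact/integrable_mulRl/integrable_cell_ind.
  apply: ge0_le_integral => //.
  - move=> y _; rewrite lee_fin mulr_ge0// mulr_ge0 ?invr_ge0 ?(ltW q0)//.
    by rewrite addr_ge0 ?(ltW e0)//; exact: Rintegral_ge0T.
  - apply/measurable_EFinP; apply: measurable_funM => //; exact: measurable_cell_ind.
  - apply: (measurable_fun_fubini_tonelli_F (m2 := mu) (EFin \o h)).
      exact/measurable_EFinP.
    by move=> z; rewrite lee_fin.
  - move=> y _; have [Qy|nQy] := pselect (Q c y).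
      rewrite (cell_ind c y).1// mul1r; apply: (le_trans (big y Qy)).
      rewrite le_eqVlt; apply/orP; left; apply/eqP; apply: eq_integral => x _.
      by rewrite /h /= (cell_ind c y).1// mul1r distrC.
    by rewrite (cell_ind c y).2// mul0r; apply: integral_ge0 => x _; rewrite lee_fin.
by rewrite EFin_Rintegral// lee_fin gerDl leNgt e0.
Qed.

(** The cells are disjoint, so the energies over the squares of cells add up to at most the total
    energy. *)
Lemma cell_steps u e : 0 < e -> W u -> exists kap : C -> R,
  (forall c, intg (fun x => ind c x * `|u x - kap c| `^ p)) /\
  \sum_c q * \int[mu]_x (ind c x * `|u x - kap c| `^ p) <=
    D * energy mu k p u + #|C|%:R * e.
Proof.
move=> e0 Wu; have /choice[y hy] := fun c => cell_value c e0 Wu.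
exists (u \o y); split; first by move=> c; have [] := hy c.
apply: (@le_trans _ _ (\sum_c (D * \int[(mu \x mu)%E]_z cell_density c u z + e))).
  by apply: ler_sum => c _; have [] := hy c.
rewrite big_split/= sumr_const -mulr_sumr -[e *+ _]mulr_natl lerD2r.
rewrite ler_wpM2l ?(cell_const hQ)//.
rewrite -lee_fin -sumEFin /energy.
have -> : (\sum_c (\int[(mu \x mu)%E]_z cell_density c u z)%:E =
   \int[mu \x mu]_z (\sum_c cell_density c u z)%:E)%E.
  under [in RHS]eq_integral => z _ do rewrite -sumEFin.
  rewrite ge0_integral_sum//.
  - by apply: eq_bigr => c _; rewrite EFin_Rintegral//; exact: integrable_cell_density.
  - by move=> c; exact: measurable_int (integrable_cell_density c Wu).
  - move=> c z _; rewrite lee_fin mulr_ge0 ?energy_density_ge0// mulr_ge0//.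
have [mu_ uz iu eu] := Wu; rewrite -EFin_Rintegral//.
have sE z : \sum_c cell_density c u z = (\sum_c ind c z.1 * ind c z.2) * energy_density k p u z.
  by rewrite mulr_suml.
apply: ge0_le_integral => //.
- move=> z _; rewrite lee_fin sE mulr_ge0 ?energy_density_ge0//.
  apply: sumr_ge0 => c _; rewrite mulr_ge0//.
- apply/measurable_EFinP; apply: measurable_sum => c.
  exact: (integrable_measurable (integrable_cell_density c Wu)).
- exact: measurable_int eu.
- by move=> z _; rewrite lee_fin sE ler_piMl ?energy_density_ge0// sum_cell_ind_le.
Qed.

(** Bounds the chosen constants, so that finitely many rounded values suffice for a bounded
    family. *)
Lemma cell_step_bound u a c : W u -> intg (fun x => ind c x * `|u x - a| `^ p) ->
  q * `|a| `^ p <=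
    2 `^ p * (\int[mu]_x (`|u x| `^ p) + \int[mu]_x (ind c x * `|u x - a| `^ p)).
Proof.
move=> [mu_ uz iu eu] ia.
rewrite -(Rintegral_cell_ind c) mulrC -RintegralZT; last exact: integrable_cell_ind.
rewrite -RintegralDT// -RintegralZT; last exact: integrable_addR.
apply: ler_Rintegral.
- exact/integrable_mulRl/integrable_cell_ind.
- exact/integrable_mulRl/integrable_addR.
- move=> x; have [Qx|nQx] := pselect (Q c x).
    rewrite (cell_ind c x).1// mulr1 mul1r.
    have := powR_normD (u x) (- (u x - a)) (ltW p0).
    by rewrite normrN (_ : u x + - (u x - a) = a); last ring.
  rewrite (cell_ind c x).2// mulr0 mul0r addr0 mulr_ge0// powR_ge0.
Qed.

(** On each cell u - v = (u - a) - (v - b) + (a - b); two uses of the quasi-triangle inequality give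
    the factor. *)
Lemma cell_distance u v (a b : C -> R) (th : R) : W u -> W v ->
  (forall c, intg (fun x => ind c x * `|u x - a c| `^ p)) ->
  (forall c, intg (fun x => ind c x * `|v x - b c| `^ p)) ->
  (forall c, `|a c - b c| <= th) ->
  \int[mu]_x (`|u x - v x| `^ p) <= 2 `^ p * 2 `^ p *
    (\sum_c \int[mu]_x (ind c x * `|u x - a c| `^ p) +
     \sum_c \int[mu]_x (ind c x * `|v x - b c| `^ p) + #|C|%:R * (q * th `^ p)).
Proof.
move=> [mu_ uz iu eu] [mv vz iv ev] ia ib ab.
have th0 (c : C) : 0 <= th by exact: le_trans (normr_ge0 _) (ab c).
have i3 c : intg (fun x => ind c x * `|u x - a c| `^ p + ind c x * `|v x - b c| `^ p
    + th `^ p * ind c x).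
  apply: integrable_addR; last exact/integrable_mulRl/integrable_cell_ind.
  exact: integrable_addR.
pose G x := \sum_c (ind c x * `|u x - a c| `^ p + ind c x * `|v x - b c| `^ p
    + th `^ p * ind c x).
have iG : intg G.
  rewrite (_ : EFin \o G = fun x => (\sum_c (ind c x * `|u x - a c| `^ p +
    ind c x * `|v x - b c| `^ p + th `^ p * ind c x)%:E)%E); last first.
    by apply/funext => x; rewrite /= sumEFin.
  by apply: integrable_sum => // c _; exact: i3.
have IG : \int[mu]_x G x = \sum_c \int[mu]_x (ind c x * `|u x - a c| `^ p) +
     \sum_c \int[mu]_x (ind c x * `|v x - b c| `^ p) + #|C|%:R * (q * th `^ p).
  apply: EFin_inj; rewrite -EFin_Rintegral//.
  under eq_integral => x _ do rewrite -sumEFin.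
  rewrite integral_sum//.
  transitivity (\sum_c (\int[mu]_x (ind c x * `|u x - a c| `^ p) +
     \int[mu]_x (ind c x * `|v x - b c| `^ p) + q * th `^ p))%:E; last first.
    by rewrite !big_split/= sumr_const -[_ *+ #|C|]mulr_natl.
  rewrite -sumEFin; apply: eq_bigr => c _; rewrite EFin_Rintegral//; congr EFin.
  rewrite RintegralDT ?RintegralDT ?RintegralZT ?Rintegral_cell_ind//.
  - by rewrite mulrC.
  - exact: integrable_cell_ind.
  - exact: integrable_addR.
  - exact/integrable_mulRl/integrable_cell_ind.
rewrite -IG -RintegralZT//; apply: ler_Rintegral.
- apply: (@integrable_le _ _ _ _ _ (fun x => 2 `^ p * (`|u x| `^ p + `|v x| `^ p))).
  + by apply: measurable_normr_powR; exact: measurable_funB.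
  + move=> x; rewrite ger0_norm ?powR_ge0// -(normrN (v x)).
    exact: powR_normD (ltW p0).
  + by apply: integrable_mulRl; exact: integrable_addR.
- exact: integrable_mulRl.
- move=> x; have G0 c : 0 <= ind c x * `|u x - a c| `^ p + ind c x * `|v x - b c| `^ p
      + th `^ p * ind c x.
    have /andP[i0 _] := cell_ind_itv c x.
    by rewrite !addr_ge0 ?mulr_ge0 ?powR_ge0.
  have [Ox|nOx] := pselect (Om x); last first.
    rewrite uz// vz// subrr normr0 powR0 ?gt_eqF//.
    by rewrite mulr_ge0 ?mulr_ge0 ?powR_ge0//; apply: sumr_ge0 => c _.
  have [c Qc] := cell_cover hQ Ox.
  apply: (@le_trans _ _ (2 `^ p * 2 `^ p * (ind c x * `|u x - a c| `^ p +
    ind c x * `|v x - b c| `^ p + th `^ p * ind c x))); last first.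
    rewrite ler_wpM2l ?mulr_ge0 ?powR_ge0// /G (bigD1 c)//= lerDl.
    by apply: sumr_ge0 => c' _.
  rewrite (cell_ind c x).1// !mul1r mulr1.
  rewrite (_ : u x - v x = (u x - a c) + (- (v x - b c) + (a c - b c))); last ring.
  apply: (le_trans (powR_normD _ _ (ltW p0))); rewrite -mulrA ler_wpM2l ?powR_ge0//.
  have h1 := powR_normD (- (v x - b c)) (a c - b c) (ltW p0).
  rewrite normrN in h1.
  have h2 : `|a c - b c| `^ p <= th `^ p by apply: ler_wpowR => //; exact: ltW.
  have h3 : 1 <= 2 `^ p :> R.
    by have := @ler_wpowR R p 1 2 (ltW p0) ler01; rewrite powR1; apply; rewrite ler1n.
  rewrite -addrA mulrDr; apply: lerD.
    by rewrite ler_peMl// powR_ge0.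
  by apply: (le_trans h1); rewrite ler_wpM2l ?powR_ge0// lerD2l.
Qed.

End one_partition.

Lemma powR_root_le (t y : R) : 0 <= t -> t `^ p <= y -> t <= y `^ p^-1.
Proof.
move=> t0 ty; rewrite -[t]powRr1// -[1](@mulfV _ p) ?gt_eqF// powRrM.
by apply: ler_wpowR; rewrite ?invr_ge0 ?powR_ge0 ?(ltW p0).
Qed.

Lemma same_step (B th a b : R) (n : nat) : 0 < th -> `|a| <= B -> `|b| <= B ->
  2 * B / th < n.+1%:R ->
  inord (Num.truncn ((a + B) / th)) = inord (Num.truncn ((b + B) / th)) :> 'I_n.+1 ->
  `|a - b| <= th.
Proof.
move=> th0; rewrite !ler_norml => /andP[a1 a2] /andP[b1 b2] hn.
have pos t : - B <= t -> 0 <= (t + B) / th.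
  by move=> tB; rewrite divr_ge0 ?(ltW th0)// -lerBlDr sub0r.
have small t : - B <= t -> t <= B -> (Num.truncn ((t + B) / th) < n.+1)%N.
  move=> tB Bt; rewrite -(ltr_nat R); apply: le_lt_trans hn.
  have /andP[h _] := truncn_itv (pos t tB); apply: (le_trans h).
  by rewrite ler_pM2r ?invr_gt0// mulr_natl mulr2n lerD2r.
move=> /(congr1 val); rewrite /= !inordK ?small// => E.
have /andP[ha1 ha2] := truncn_itv (pos a a1).
have /andP[hb1 hb2] := truncn_itv (pos b b1).
rewrite E in ha1 ha2.
move: ha1 ha2 hb1 hb2; rewrite -natr1; move: (Num.truncn _)%:R => t.
rewrite !ler_pdivlMr// !ltr_pdivrMr// mulrDl mul1r; move: (t * th) => m.
by clear; move=> *; apply/andP; split; lra.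
Qed.

Lemma step_size_arith (q D M e1 S E : R) (n : nat) : 0 < q -> 0 < e1 -> 0 <= M -> E <= M ->
  0 <= D -> D / q <= e1 / (M + 1) -> q * S <= D * E + n%:R * (q * e1 / n.+1%:R) ->
  S <= e1 + e1.
Proof.
move=> q0 e10 M0 EM D0 Dq; rewrite -ler_pdivlMl// => /le_trans; apply.
rewrite mulrDr; apply: lerD.
  rewrite mulrA [q^-1 * D]mulrC; apply: (@le_trans _ _ (D / q * M)).
    by rewrite ler_wpM2l// divr_ge0// ltW.
  apply: (@le_trans _ _ (e1 / (M + 1) * M)); first by rewrite ler_wpM2r.
  rewrite mulrAC ler_pdivrMr; last by rewrite ltr_wpDl.
  by rewrite ler_pM2l// lerDl.
rewrite mulrCA -[q * e1 / _]mulrA mulKf ?gt_eqF// mulrCA ler_piMr ?(ltW e10)//.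
by rewrite ler_pdivrMr ?ltr0n// mul1r ler_nat leqnSn.
Qed.

(** Total boundedness: the colour of a function is the list of its constants on the cells, rounded
    to finitely many levels. *)
Lemma compact_embedding_cells :
  (forall e : R, 0 < e -> exists (C : finType) (Q : C -> set T) (q D : R),
     cell_partition Q q D /\ D / q <= e) ->
  compact_embedding mu Om k p.
Proof.
move=> cells w M Ww wM eM.
have M0 : 0 <= M by apply: le_trans (wM 0%N); apply: Rintegral_ge0T => x; exact: powR_ge0.
apply: totally_bounded_extraction => //.
- by move=> n; case: (Ww n).
- by move=> n; case: (Ww n).
- by move=> n; case: (Ww n).
move=> e e0; pose P : R := 2 `^ p; have P0 : 0 < P by rewrite powR_gt0.
(* [cell_distance] costs P^2, and its bracket is at most five times [e1]: two for each function and
   one for the rounding. *)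
pose e1 := e / (P * P * 5); have e10 : 0 < e1 by rewrite divr_gt0// !mulr_gt0.
have [|C [Q [q [D [hQ Dq]]]]] := cells (e1 / (M + 1)).
  by rewrite divr_gt0// ltr_wpDl.
have q0 := cell_gt0 hQ.
have eta0 : 0 < q * e1 / #|C|.+1%:R by rewrite divr_gt0// mulr_gt0.
have /choice[kap hkap] := fun n => cell_steps hQ eta0 (Ww n).
pose S n := \sum_c \int[mu]_x ((\1_(Q c) : T -> R) x * `|w n x - kap n c| `^ p).
have hS n : S n <= e1 + e1.
  have [_] := hkap n; rewrite -mulr_sumr => h.
  exact: (step_size_arith q0 e10 M0 (eM n) (cell_const hQ) Dq h).
have S0 n c : 0 <= \int[mu]_x ((\1_(Q c) : T -> R) x * `|w n x - kap n c| `^ p).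
  by apply: Rintegral_ge0T => x; rewrite mulr_ge0 ?powR_ge0.
pose B := (q^-1 * (P * (M + (e1 + e1)))) `^ p^-1.
have hB n c : `|kap n c| <= B.
  apply: powR_root_le; first exact: normr_ge0.
  rewrite ler_pdivlMl//; apply: (le_trans (cell_step_bound hQ (Ww n) (proj1 (hkap n) c))).
  rewrite ler_pM2l//; apply: lerD => //; apply: le_trans (hS n).
  by rewrite /S (bigD1 c)//= lerDl; apply: sumr_ge0 => c' _.
(* The rounding step for which all cells together contribute at most [e1]. *)
pose th := (e1 / (#|C|.+1%:R * q)) `^ p^-1.
have th0 : 0 < th by rewrite powR_gt0// divr_gt0// mulr_gt0.
have thp : th `^ p = e1 / (#|C|.+1%:R * q).
  rewrite /th -powRrM mulVf ?gt_eqF// powRr1// divr_ge0 ?(ltW e10)//.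
  by rewrite mulr_ge0// ltW.
pose L := Num.truncn (2 * B / th).
have hL : 2 * B / th < L.+1%:R by rewrite truncnS_gt.
exists {ffun C -> 'I_L.+1}, (fun n => [ffun c => inord (Num.truncn ((kap n c + B) / th))]).
move=> n m /ffunP nm.
have close c : `|kap n c - kap m c| <= th.
  by apply: (same_step th0 (hB n c) (hB m c) hL); have := nm c; rewrite !ffunE.
apply: (le_trans (cell_distance hQ (Ww n) (Ww m) (proj1 (hkap n)) (proj1 (hkap m)) close)).
have last : #|C|%:R * (q * th `^ p) <= e1.
  rewrite thp (_ : q * (e1 / _) = e1 / #|C|.+1%:R).
    by rewrite mulrCA ler_piMr ?(ltW e10)// ler_pdivrMr ?ltr0n// mul1r ler_nat leqnSn.
  by rewrite [_ * q]mulrC invfM [e1 * _]mulrCA mulVKf ?gt_eqF.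
rewrite (_ : e = 2 `^ p * 2 `^ p * (e1 + e1 + (e1 + e1) + e1)).
  rewrite ler_pM2l ?mulr_gt0//; apply: lerD => //; apply: lerD; exact: hS.
by rewrite /e1 -/P; field; rewrite gt_eqF.
Qed.

End partitions.

(** * The Gagliardo kernel *)

Section euclidean_space.
Context {R : realType} (n : nat).
Local Notation T := 'rV[R]_n.
Local Notation mu := (@lebesgue_rV R n).
Implicit Types (x y : T) (r : R) (U : set T).

Lemma ler_enorm x i : `|x ord0 i| <= enorm x.
Proof.
rewrite /enorm -sqrtr_sqr ler_sqrt; last by apply: sumr_ge0 => j _; exact: sqr_ge0.
by rewrite (bigD1 i)//= lerDl; apply: sumr_ge0 => j _; exact: sqr_ge0.
Qed.

Lemma enorm_ge0 x : 0 <= enorm x.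
Proof. exact: sqrtr_ge0. Qed.

Lemma enorm_le x r : 0 <= r -> (forall i, `|x ord0 i| <= r) -> enorm x <= n%:R * r.
Proof.
move=> r0 xr; rewrite -[leRHS]ger0_norm ?mulr_ge0// -sqrtr_sqr /enorm.
rewrite ler_wsqrtr//; apply: (@le_trans _ _ (\sum_(i < n) r ^+ 2)).
  by apply: ler_sum => i _; rewrite -real_normK ?num_real// lerXn2r ?nnegrE.
rewrite sumr_const card_ord -(mulr_natl (r ^+ 2)) exprMn ler_wpM2r ?sqr_ge0//.
by rewrite -natrX ler_nat; case: (n) => // k; rewrite leq_pmulr.
Qed.

Lemma enorm_gt0 x y : x <> y -> 0 < enorm (x - y).
Proof.
move=> xy; rewrite lt_neqAle enorm_ge0 andbT; apply/eqP => e0; apply: xy.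
apply/rowP => i; apply/eqP; rewrite -subr_eq0 -normr_le0.
have := ler_enorm (x - y) i; rewrite -e0; apply: le_trans.
by rewrite !mxE.
Qed.

Definition cube x r : set T := [set y | forall i, `|y ord0 i - x ord0 i| < r].

Lemma measurable_cube x r : measurable (cube x r).
Proof.
rewrite (_ : cube x r = \bigcap_(i in [set: 'I_n])
    (fun y : T => y ord0 i : measurableTypeR R) @^-1` (`]x ord0 i - r, x ord0 i + r[)).
  apply: fin_bigcap_measurable => // i _.
  rewrite -[X in measurable X]setTI; apply: (measurable_coor i measurableT).
  exact: measurable_itv.
apply/seteqP; split=> y /= h i.
  by move=> _; rewrite /= in_itv/= -ltr_distl.
by have := h i Logic.I; rewrite /= in_itv/= -ltr_distl.
Qed.

Lemma lebesgue_cube x r : 0 < r -> mu (cube x r) = ((2 * r) ^+ n)%:E.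
Proof.
move=> r0.
rewrite (_ : cube x r = [set y : T | forall i,
   (`]x ord0 i - r, x ord0 i + r[%classic : set (measurableTypeR R)) (y ord0 i)]); last first.
  apply/seteqP; split=> y /= h i.
    by rewrite /= in_itv/= -ltr_distl.
  by have := h i; rewrite /= in_itv/= -ltr_distl.
rewrite (@lebesgue_rV_box R n (fun i => `]x ord0 i - r, x ord0 i + r[%classic)) => [|i]; last first.
  exact: measurable_itv.
rewrite (eq_bigr (fun=> (2 * r)%:E)); last first.
  move=> i _; rewrite lebesgue_measure_itv /= lte_fin ltrBlDr -addrA ltrDl addr_gt0//.
  by rewrite -EFinB; congr EFin; ring.
by rewrite big_const card_ord; elim: (n) => [|k IH]//=; rewrite exprS EFinM IH.
Qed.

Lemma open_cube U x : open U -> U x -> exists2 r, 0 < r & cube x r `<=` U.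
Proof.
move=> oU Ux; have /nbhs_ballP[e /= e0 eU] : nbhs x U by exact: open_nbhs_nbhs.
exists e => // y xy; apply: eU; split=> // i j; rewrite (ord1 i).
by rewrite -ball_normE /ball_/= distrC; exact: xy.
Qed.

(** The sigma-algebra is generated by coordinates, so an open set is written as a countable union of
    cubes with rational centres and radii 1/(k+1). *)
Lemma open_measurable_rV U : open U -> measurable U.
Proof.
move=> oU.
pose q2r (q : 'rV[rat]_n) : T := \row_i ratr (q ord0 i).
pose F (qk : 'rV[rat]_n * nat) := if `[< cube (q2r qk.1) qk.2.+1%:R^-1 `<=` U >]
  then cube (q2r qk.1) qk.2.+1%:R^-1 else set0.
rewrite (_ : U = \bigcup_qk F qk).
  apply: countable_bigcupT_measurable => [|qk]; first exact: countableP.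
  by rewrite /F; case: ifP => _; [exact: measurable_cube|exact: measurable0].
apply/seteqP; split=> x; last by move=> [qk _]; rewrite /F; case: asboolP => [h|_]//; exact: h.
move=> Ux.
have [r r0 rU] := open_cube oU Ux.
have [k hk] : exists k : nat, k.+1%:R^-1 < r / 2.
  have r20 : 0 < r / 2 by rewrite divr_gt0.
  by have [N _ hN] := near_infty_natSinv_lt (PosNum r20); exists N; exact: (hN N (leqnn N)).
have kk i : x ord0 i - k.+1%:R^-1 < x ord0 i + k.+1%:R^-1.
  by rewrite ltrBlDr -addrA ltrDl addr_gt0// invr_gt0.
have /choice[q hq] : forall i, exists q : rat,
    ratr q \in `](x ord0 i - k.+1%:R^-1), (x ord0 i + k.+1%:R^-1)[.
  by move=> i; apply: rat_in_itvoo; exact: kk.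
have hx i : `|x ord0 i - ratr (q i)| < k.+1%:R^-1.
  by rewrite distrC ltr_distl; have := hq i; rewrite in_itv.
have sub : cube (q2r (\row_i q i)) k.+1%:R^-1 `<=` U.
  move=> y hy; apply: rU => i; have := hy i; rewrite !mxE => hy'.
  rewrite (_ : _ - _ = (y ord0 i - ratr (q i)) - (x ord0 i - ratr (q i))); last ring.
  apply: (le_lt_trans (ler_normB _ _)); apply: (lt_trans (ltrD hy' (hx i))).
  by rewrite (splitr r); apply: ltrD.
exists (\row_i q i, k) => //; rewrite /F /=; case: asboolP => [_ i|//].
by rewrite !mxE; exact: hx.
Qed.

Lemma continuous_measurable_rV (f : T -> R) : (forall V : set R, open V -> open (f @^-1` V)) ->
  measurable_fun setT (f : T -> measurableTypeR R).
Proof.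
move=> cf; apply: (measurability _ (RGenOpens.measurableE R)) => _ [_ [a [b ->]] <-].
rewrite setTI; apply: open_measurable_rV; apply: cf.
exact: interval_open.
Qed.

Lemma open_lebesgue_gt0 U : open U -> U !=set0 -> mu U != 0%E.
Proof.
move=> oU [x Ux]; have [r r0 rU] := open_cube oU Ux.
have : (mu (cube x r) <= mu U)%E.
  by apply: le_measure; rewrite ?inE//; [exact: measurable_cube|exact: open_measurable_rV].
rewrite lebesgue_cube//; apply: contraTneq => ->.
by rewrite -ltNge lte_fin exprn_gt0// mulr_gt0.
Qed.

Lemma bounded_cube U : bounded_set U -> exists2 B : R, 0 < B & U `<=` cube 0 B.
Proof.
move=> [M [_ hM]]; pose M1 := Num.max 0 M + 1.
have M1M : M < M1 by rewrite ltr_pwDr// le_max lexx orbT.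
exists (M1 + 1); first by rewrite addr_gt0// ltr_pwDr// le_max lexx.
move=> x Ux i; rewrite mxE subr0.
apply: (@le_lt_trans _ _ M1); last by rewrite ltrDl.
apply: le_trans (hM M1 M1M x Ux).
by rewrite [leRHS]/Num.norm /= mx_normrE; apply/bigmax_geP; right => /=; exists (ord0, i).
Qed.

Lemma bounded_lebesgue_lty U : bounded_set U -> measurable U -> (mu U < +oo)%E.
Proof.
move=> /bounded_cube[B B0 UB] mU; apply: (@le_lt_trans _ _ (mu (cube 0 B))).
  by apply: le_measure; rewrite ?inE//; exact: measurable_cube.
by rewrite lebesgue_cube// ltry.
Qed.

Lemma measurable_enorm : measurable_fun setT (fun z : T * T => enorm (z.1 - z.2)).
Proof.
rewrite (_ : (fun _ => _) = (fun z : T * T =>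
   Num.sqrt (\sum_(i < n) (z.1 ord0 i - z.2 ord0 i) ^+ 2))); last first.
  apply/funext => z; rewrite /enorm; congr Num.sqrt; apply: eq_bigr => i _.
  by rewrite !mxE.
apply: (measurableT_comp (continuous_measurable_fun (@sqrt_continuous R))).
apply: measurable_sum => i; apply: measurable_funX; apply: measurable_funB.
  exact: (measurableT_comp (@measurable_coor R n i) measurable_fst).
exact: (measurableT_comp (@measurable_coor R n i) measurable_snd).
Qed.

End euclidean_space.

Section gagliardo_weight.
Context {R : realType} (n : nat).
Local Notation T := 'rV[R]_n.
Local Notation mu := (@lebesgue_rV R n).
Variables (s p : R).
Hypothesis p1 : 1 < p.
Hypothesis s0 : 0 < s.

Let p0 : 0 < p. Proof. exact: lt_trans ltr01 p1. Qed.
Let ps0 : 0 < p * s. Proof. exact: mulr_gt0. Qed.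
Let nps0 : 0 < n%:R + p * s. Proof. by rewrite ltr_wpDl. Qed.

Definition gagliardo_weight (z : T * T) : R := (gagliardo_kernel s p z)^-1.

Lemma gagliardo_weightE z : gagliardo_weight z = enorm (z.1 - z.2) `^ (- (n%:R + p * s)).
Proof. by rewrite powRN. Qed.

Lemma gagliardo_weight_ge0 z : 0 <= gagliardo_weight z.
Proof. by rewrite gagliardo_weightE powR_ge0. Qed.

Lemma gagliardo_weight_gt0 z : z.1 <> z.2 -> 0 < gagliardo_weight z.
Proof. by move=> z12; rewrite gagliardo_weightE powR_gt0// enorm_gt0. Qed.

Lemma measurable_gagliardo_weight : measurable_fun setT gagliardo_weight.
Proof.
rewrite (funext gagliardo_weightE).
apply: (measurableT_comp (measurable_powR _)); exact: measurable_enorm.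
Qed.

Lemma gagliardo_weight_le x y r : 0 < r -> x <> y -> enorm (x - y) <= r ->
  1 <= r `^ (n%:R + p * s) * gagliardo_weight (x, y).
Proof.
move=> r0 xy xyr; rewrite /gagliardo_weight /gagliardo_kernel /=.
rewrite ler_pdivlMr ?powR_gt0 ?enorm_gt0// mul1r.
by apply: ler_wpowR => //; [exact: ltW|exact: enorm_ge0].
Qed.

Lemma same_slot (B dl x : R) (a b : nat) : 0 < dl ->
  - B + a%:R * dl <= x < - B + a%:R * dl + dl ->
  - B + b%:R * dl <= x < - B + b%:R * dl + dl -> a = b.
Proof.
move=> dl0 /andP[h1 h2] /andP[h3 h4]; apply/eqP.
have lt (c e : nat) : c%:R * dl < e%:R * dl + dl -> (c <= e)%N.
  by move=> h; rewrite -ltnS -(ltr_nat R) -(ltr_pM2r dl0) -natr1 mulrDl mul1r.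
by rewrite eqn_leq !lt//; move: (_ * dl) (_ * dl) h1 h2 h3 h4 => u v; lra.
Qed.

Section grid.
Variables (B dl : R).
Hypothesis dl0 : 0 < dl.
Local Notation L := (Num.truncn (2 * B / dl)).+1.

(** Half-open slots make the cells disjoint and of equal measure. *)
Definition grid_cell (c : {ffun 'I_n -> 'I_L}) : set T :=
  [set x | forall i, - B + (c i)%:R * dl <= x ord0 i < - B + (c i)%:R * dl + dl].

Lemma grid_cellE c : grid_cell c = [set x : T | forall i,
  (`[- B + (c i)%:R * dl, - B + (c i)%:R * dl + dl[%classic : set (measurableTypeR R)) (x ord0 i)].
Proof. by apply/seteqP; split=> x /= h i; have := h i; rewrite in_itv. Qed.

Lemma measurable_grid_cell c : measurable (grid_cell c).
Proof.
rewrite (_ : grid_cell c = \bigcap_(i in [set: 'I_n]) (fun y : T => y ord0 i : measurableTypeR R)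
   @^-1` (`[- B + (c i)%:R * dl, - B + (c i)%:R * dl + dl[)).
  apply: fin_bigcap_measurable => // i _.
  rewrite -[X in measurable X]setTI; apply: (measurable_coor i measurableT).
  exact: measurable_itv.
rewrite grid_cellE; apply/seteqP; split=> y /= h i; first by move=> _; exact: h.
by have := h i Logic.I.
Qed.

Lemma lebesgue_grid_cell c : mu (grid_cell c) = (dl ^+ n)%:E.
Proof.
rewrite grid_cellE (@lebesgue_rV_box R n (fun i =>
  `[- B + (c i)%:R * dl, - B + (c i)%:R * dl + dl[%classic)) => [|i]; last exact: measurable_itv.
rewrite (eq_bigr (fun=> dl%:E)); last first.
  move=> i _; rewrite lebesgue_measure_itv /= lte_fin ltrDl dl0.
  by rewrite -EFinB; congr EFin; ring.
by rewrite big_const card_ord; elim: (n) => [|k IH]//=; rewrite exprS EFinM IH.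
Qed.

Lemma grid_cell_partition (Om : set T) : Om `<=` cube 0 B ->
  cell_partition mu Om gagliardo_weight grid_cell (dl ^+ n)
    ((n%:R * dl) `^ (n%:R + p * s)).
Proof.
move=> OmB; split.
- exact: measurable_grid_cell.
- exact: lebesgue_grid_cell.
- exact: exprn_gt0.
- move=> c c' x xc xc'; apply/ffunP => i; apply/val_inj => /=.
  by apply: (same_slot dl0 (xc i) (xc' i)).
- move=> x /OmB xB.
  have pos i : 0 <= (x ord0 i + B) / dl /\ (x ord0 i + B) / dl <= 2 * B / dl.
    have := xB i; rewrite mxE subr0 ltr_norml => /andP[h1 h2].
    rewrite divr_ge0 ?(ltW dl0)//; last by move: h1; lra.
    by rewrite ler_pM2r ?invr_gt0//; split=> //; move: h2; lra.
  have lt i : (Num.truncn ((x ord0 i + B) / dl) < L)%N.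
    by rewrite ltnS le_truncn//; have [] := pos i.
  exists [ffun i => inord (Num.truncn ((x ord0 i + B) / dl))] => i; rewrite ffunE inordK//.
  have [/truncn_itv/andP[h1 h2] _] := pos i.
  rewrite ler_pdivlMr// in h1; rewrite ltr_pdivrMr// -natr1 mulrDl mul1r in h2.
  move: (_ * dl) h1 h2 => a; move=> *; apply/andP; split; lra.
- move=> c x y xc yc xy.
  have n0 : (0 < n)%N.
    case: (posnP n) => // n0; case: xy; apply/rowP => i.
    by have := ltn_ord i; rewrite {2}n0.
  apply: gagliardo_weight_le => //; first by rewrite mulr_gt0 ?ltr0n.
  apply: enorm_le; first exact: ltW.
  move=> i; rewrite !mxE; have /andP[h1 h2] := xc i; have /andP[h3 h4] := yc i.
  rewrite ler_norml; move: (_ * dl) h1 h2 h3 h4 => a; clear; move=> *.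
  by apply/andP; split; lra.
- exact: powR_ge0.
Qed.

(** The kernel exponent exceeds the dimension by p s, and this surplus makes the ratio tend to 0
    with the mesh. *)
Lemma grid_ratio : (n%:R * dl) `^ (n%:R + p * s) / dl ^+ n =
  n%:R `^ (n%:R + p * s) * dl `^ (p * s).
Proof.
rewrite powRM ?(ltW dl0)// [dl `^ (_ + _)]powRD; last by rewrite (gt_eqF nps0).
by rewrite powR_mulrn ?(ltW dl0)// -mulrA [_ * dl `^ _ / _]mulrAC mulfV ?mul1r// gt_eqF// exprn_gt0.
Qed.

End grid.

Lemma gagliardo_compact (Om : set T) : bounded_set Om ->
  compact_embedding mu Om gagliardo_weight p.
Proof.
move=> /bounded_cube[B B0 OmB].
apply: (compact_embedding_cells p1 measurable_gagliardo_weight gagliardo_weight_ge0) => e e0.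
pose A : R := n%:R `^ (n%:R + p * s) + 1.
have A0 : 0 < A by rewrite ltr_wpDl// powR_ge0.
have r0 : 0 < (e / A) `^ (p * s)^-1 by rewrite powR_gt0 ?divr_gt0.
have [m _ hm] := near_infty_natSinv_lt (PosNum r0).
pose dl : R := m.+1%:R^-1; have dl0 : 0 < dl by rewrite invr_gt0.
exists _, (@grid_cell B dl), (dl ^+ n), ((n%:R * dl) `^ (n%:R + p * s)); split.
  exact: grid_cell_partition.
rewrite grid_ratio//; apply: (@le_trans _ _ (A * dl `^ (p * s))).
  by rewrite ler_wpM2r ?powR_ge0// lerDl.
rewrite -ler_pdivlMl// [A^-1 * _]mulrC; have := ltW (hm m (leqnn m)); rewrite /= -/dl => hd.
have := @ler_wpowR R (p * s) _ _ (ltW ps0) (ltW dl0) hd.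
by rewrite -powRrM mulVf ?(gt_eqF ps0)// powRr1 ?divr_ge0 ?(ltW e0) ?(ltW A0).
Qed.

End gagliardo_weight.

(** * A Lipschitz bump in the energy space *)

Lemma geometric_nneseries_lty {R : realType} (u : nat -> R) (C t : R) : 0 <= t < 1 ->
  (forall j, 0 <= u j <= C * t ^+ j) -> (\sum_(0 <= j <oo) (u j)%:E < +oo)%E.
Proof.
move=> /andP[t0 t1] hu.
have u0 j : (0 <= (u j)%:E)%E by rewrite lee_fin; case/andP: (hu j).
have C0 : 0 <= C.
  by have /andP[h1 h2] := hu 0%N; rewrite expr0 mulr1 in h2; exact: le_trans h2.
apply: (@le_lt_trans _ _ (C / (1 - t))%:E); last exact: ltry.
apply: lime_le; first by apply: is_cvg_nneseries => n _ _; exact: u0.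
apply: nearW => n; rewrite sumEFin lee_fin.
apply: (@le_trans _ _ (\sum_(0 <= i < n) C * t ^+ i)).
  by apply: ler_sum => i _; case/andP: (hu i).
rewrite -mulr_sumr ler_wpM2l// -[leRHS]mul1r ler_pdivlMr ?subr_gt0//.
rewrite mulrC big_mkord -opprB mulNr -subrX1 opprB lerBlDr lerDl exprn_ge0//.
Qed.

Section bump.
Context {R : realType} (n : nat).
Local Notation T := 'rV[R]_n.
Local Notation mu := (@lebesgue_rV R n).
Variable Om : set T.
Hypothesis n0 : (0 < n)%N.
Hypothesis oOm : open Om.

Definition cube_radii (x : T) : set R := [set r | 0 <= r <= 1 /\ cube x r `<=` Om].
(** The distance to the complement of [Om] in the maximum norm, capped at 1. *)
Definition bump (x : T) : R := sup (cube_radii x).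

Lemma cube_radii0 x : cube_radii x 0.
Proof.
split; first by rewrite lexx ler01.
by move=> y /(_ (Ordinal n0)); rewrite ltNge normr_ge0.
Qed.

Lemma has_ubound_cube_radii x : has_ubound (cube_radii x).
Proof. by exists 1 => r [/andP[]]. Qed.

Lemma bump_itv x : 0 <= bump x <= 1.
Proof.
apply/andP; split; first exact: ub_le_sup (has_ubound_cube_radii x) _ (cube_radii0 x).
by apply: ge_sup => [|r [/andP[]]//]; exists 0; exact: cube_radii0.
Qed.

Lemma bump_gt0 x : Om x -> 0 < bump x.
Proof.
move=> /(open_cube oOm)[r r0 rO].
apply: (@lt_le_trans _ _ (Num.min r 1)); first by rewrite lt_min r0 ltr01.
apply: ub_le_sup; first exact: has_ubound_cube_radii.
split; first by rewrite le_min ler01 (ltW r0) ge_min lexx orbT.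
by move=> y hy; apply: rO => i; apply: (lt_le_trans (hy i)); rewrite ge_min lexx.
Qed.

Lemma bump_out x : ~ Om x -> bump x = 0.
Proof.
move=> nO; apply/eqP; rewrite eq_le; have /andP[-> _] := bump_itv x; rewrite andbT.
apply: ge_sup; first by exists 0; exact: cube_radii0.
move=> r [/andP[r0 _] rO]; rewrite leNgt; apply/negP => r_gt0; apply: nO.
by apply: rO => i; rewrite subrr normr0.
Qed.

(** A cube of radius q around x contains the one of radius q - r around y. *)
Lemma bump_lip (x y : T) r : (forall i, `|x ord0 i - y ord0 i| <= r) -> `|bump x - bump y| <= r.
Proof.
have half (x' y' : T) : (forall i, `|x' ord0 i - y' ord0 i| <= r) -> bump x' <= bump y' + r.
  move=> xy; have r0 : 0 <= r by apply: le_trans (xy (Ordinal n0)).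
  apply: ge_sup; first by exists 0; exact: cube_radii0.
  move=> q [/andP[q0 q1] qO]; have [qr|rq] := leP q r.
    by apply: (le_trans qr); rewrite lerDr; case/andP: (bump_itv y').
  rewrite -lerBlDr; apply: ub_le_sup; first exact: has_ubound_cube_radii.
  split; first by rewrite subr_ge0 (ltW rq) lerBlDr; apply: (le_trans q1); rewrite lerDl.
  move=> w wy; apply: qO => i.
  rewrite (_ : _ - _ = (w ord0 i - y' ord0 i) - (x' ord0 i - y' ord0 i)); last ring.
  apply: (le_lt_trans (ler_normB _ _)); rewrite -(subrK r q).
  exact: ltr_leD (wy i) (xy i).
move=> xy; rewrite ler_distl lerBlDr !half// => i.
by rewrite distrC.
Qed.

Lemma measurable_bump : measurable_fun setT (bump : T -> measurableTypeR R).
Proof.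
apply: continuous_measurable_rV => V oV; rewrite openE => x Vx.
have /nbhs_ballP[e /= e0 eV] : nbhs (bump x) V by exact: open_nbhs_nbhs.
apply/nbhs_ballP; exists (e / 2) => /=; first by rewrite divr_gt0.
move=> y [_ xy]; apply: eV; rewrite -ball_normE /ball_/=.
apply: (@le_lt_trans _ _ (e / 2)); last by rewrite ltr_pdivrMr// ltr_pMr// ltr1n.
by apply: bump_lip => i; have := xy ord0 i; rewrite -ball_normE /ball_/= => /ltW.
Qed.

End bump.

(** * Finite energy of the bump *)

Section bump_energy.
Context {R : realType} (n : nat).
Local Notation T := 'rV[R]_n.
Local Notation mu := (@lebesgue_rV R n).
Variables (Om : set T) (s p : R).
Hypothesis n0 : (0 < n)%N.
Hypothesis oOm : open Om.
Hypothesis fOm : (mu Om < +oo)%E.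
Hypothesis p1 : 1 < p.
Hypothesis s0 : 0 < s.
Hypothesis s1 : s < 1.
Local Notation k := (@gagliardo_weight R n s p).
Local Notation ind := (\1_Om : T -> R).

Let p0 : 0 < p. Proof. exact: lt_trans ltr01 p1. Qed.
Let ps0 : 0 < p * s. Proof. exact: mulr_gt0. Qed.
Let nps0 : 0 < n%:R + p * s. Proof. by rewrite ltr_wpDl. Qed.
Let pps0 : 0 < p - p * s. Proof. by rewrite subr_gt0 -[ltRHS]mulr1 ltr_pM2l. Qed.
Let one_powR (a : R) : 1 `^ a = 1. Proof. by rewrite powR1. Qed.
Let mOm : measurable Om. Proof. exact: open_measurable_rV. Qed.

Definition near_diagonal (r : R) : set (T * T) :=
  [set z : T * T | forall i, `|z.1 ord0 i - z.2 ord0 i| < r].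
Local Notation indd r := (\1_(near_diagonal r) : T * T -> R).

Lemma measurable_near_diagonal r : measurable (near_diagonal r).
Proof.
rewrite (_ : near_diagonal r = \bigcap_(i in [set: 'I_n])
    ((fun z : T * T => `|z.1 ord0 i - z.2 ord0 i|) @^-1` [set t : R | t < r])).
  apply: fin_bigcap_measurable => // i _.
  rewrite -[X in measurable X]setTI.
  have : measurable_fun setT (fun z : T * T => `|z.1 ord0 i - z.2 ord0 i| : R).
    apply: (measurableT_comp (@normr_measurable R setT)); apply: measurable_funB.
      exact: (measurableT_comp (@measurable_coor R n i) measurable_fst).
    exact: (measurableT_comp (@measurable_coor R n i) measurable_snd).
  apply => //; rewrite (_ : [set t : R | t < r] = `]-oo, r[%classic); first exact: measurable_itv.
  by apply/seteqP; split=> t /=; rewrite in_itv.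
by apply/seteqP; split=> z /= h i => [_|]; exact: h.
Qed.

(** Increments of the bump vanish unless one of the two points lies in [Om]; the sum of indicators
    covers this case and keeps the integral finite. *)
Definition layer r (z : T * T) : R := (ind z.1 + ind z.2) * indd r z.

Lemma layer_ge0 r z : 0 <= layer r z.
Proof. by rewrite mulr_ge0// ?addr_ge0// indicE ler0n. Qed.

Lemma measurable_layer r : measurable_fun setT (layer r).
Proof.
have mi : measurable_fun setT ind by exact: (@measurable_indic _ _ R setT Om mOm).
apply: measurable_funM; last first.
  exact: (@measurable_indic _ _ R setT _ (measurable_near_diagonal r)).
apply: measurable_funD; first exact: (measurableT_comp mi measurable_fst).
exact: (measurableT_comp mi measurable_snd).
Qed.

Lemma integral_layer r : 0 < r ->
  (\int[mu \x mu]_z (layer r z)%:E = (2 * fine (mu Om) * (2 * r) ^+ n)%:E)%E.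
Proof.
move=> r0.
have mi : measurable_fun setT ind by exact: (@measurable_indic _ _ R setT Om mOm).
have md : measurable_fun setT (indd r).
  exact: (@measurable_indic _ _ R setT _ (measurable_near_diagonal r)).
have m1 : measurable_fun setT (fun z : T * T => (ind z.1 * indd r z)%:E).
  apply/measurable_EFinP; apply: measurable_funM => //.
  exact: (measurableT_comp mi measurable_fst).
have m2 : measurable_fun setT (fun z : T * T => (ind z.2 * indd r z)%:E).
  apply/measurable_EFinP; apply: measurable_funM => //.
  exact: (measurableT_comp mi measurable_snd).
have ge0 (a : T) z : (0 <= (ind a * indd r z)%:E)%E.
  by rewrite lee_fin mulr_ge0// indicE ler0n.
have row x : (\int[mu]_y (indd r (x, y))%:E = ((2 * r) ^+ n)%:E)%E.
  rewrite -(lebesgue_cube x r0) -(setIT (cube x r)) -integral_indic//; last exact: measurable_cube.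
  apply: eq_integral => y _; congr EFin; rewrite !indicE; congr (_%:R); congr nat_of_bool.
  by apply/idP/idP; rewrite !inE => h i; have := h i; rewrite /= distrC.
have col y : (\int[mu]_x (indd r (x, y))%:E = ((2 * r) ^+ n)%:E)%E.
  rewrite -(row y); apply: eq_integral => x _; congr EFin; rewrite !indicE.
  congr (_%:R); congr nat_of_bool.
  by apply/idP/idP; rewrite !inE => h i; have := h i; rewrite /= distrC.
have fin : (\int[mu]_x (ind x * (2 * r) ^+ n)%:E = (fine (mu Om) * (2 * r) ^+ n)%:E)%E.
  under eq_integral => x _ do rewrite EFinM muleC.
  rewrite ge0_integralZl//; [|exact/measurable_EFinP|by rewrite lee_fin exprn_ge0 ?mulr_ge0 ?ltW].
  rewrite integral_indic// setIT muleC EFinM fineK//.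
  by rewrite ge0_fin_numE.
rewrite (_ : \int[mu \x mu]_z _ = \int[mu \x mu]_z (ind z.1 * indd r z)%:E +
  \int[mu \x mu]_z (ind z.2 * indd r z)%:E)%E; last first.
  rewrite -ge0_integralD//; apply: eq_integral => z _; by rewrite /layer mulrDl EFinD.
rewrite fubini_tonelli1// fubini_tonelli2// /fubini_F /fubini_G.
have -> : (\int[mu]_x \int[mu]_y (ind (x, y).1 * indd r (x, y))%:E =
           \int[mu]_x (ind x * (2 * r) ^+ n)%:E)%E.
  apply: eq_integral => x _; rewrite EFinM -(row x) -ge0_integralZl//.
  by apply/measurable_EFinP; apply: (measurableT_comp md); exact: measurable_pair1.
have -> : (\int[mu]_y \int[mu]_x (ind (x, y).2 * indd r (x, y))%:E =
           \int[mu]_y (ind y * (2 * r) ^+ n)%:E)%E.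
  apply: eq_integral => y _; rewrite EFinM -(col y) -ge0_integralZl//.
  by apply/measurable_EFinP; apply: (measurableT_comp md); exact: measurable_pair2.
by rewrite fin -EFinD; congr EFin; ring.
Qed.

Local Notation rho j := ((2^-1 : R) ^+ j).
(** Bound of the density on the dyadic shell between [rho j.+1] and [rho j]: Lipschitz increment at
    the outer radius, kernel at the inner one. On the shells beyond 1, [outer_height] uses only that
    increments are at most 1. *)
Definition inner_height j : R := rho j `^ p * (rho j.+1) `^ (- (n%:R + p * s)).
Definition outer_height j : R := ((2 : R) ^+ j) `^ (- (n%:R + p * s)).

Lemma kernel_far (z : T * T) r : 0 < r -> ~ near_diagonal r z ->
  k z <= r `^ (- (n%:R + p * s)).
Proof.
move=> r0 /existsNP[i /negP]; rewrite -leNgt => hi.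
rewrite gagliardo_weightE !powRN lef_pV2 ?posrE ?powR_gt0//.
  apply: ler_wpowR; [exact: ltW|exact: ltW|apply: (le_trans hi)].
  by apply: le_trans (ler_enorm _ i); rewrite !mxE.
apply: (lt_le_trans r0); apply: (le_trans hi).
by apply: le_trans (ler_enorm _ i); rewrite !mxE.
Qed.

Lemma bump_density_le z : bump Om z.1 <> bump Om z.2 ->
  1 <= ind z.1 + ind z.2 /\
  ((exists j, near_diagonal (rho j) z /\
      energy_density k p (bump Om) z <= inner_height j) \/
   (exists j, near_diagonal (2 ^+ j.+1) z /\
      energy_density k p (bump Om) z <= outer_height j)).
Proof.
move=> z12; split.
  have [h1|h1] := pselect (Om z.1).
    by rewrite (indicE _ Om z.1) mem_set// lerDl indicE ler0n.
  have [h2|h2] := pselect (Om z.2).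
    by rewrite (indicE _ Om z.2) mem_set// lerDr indicE ler0n.
  by case: z12; rewrite !bump_out.
have d1 : `|bump Om z.1 - bump Om z.2| <= 1.
  have /andP[h1 h2] := bump_itv Om n0 z.1; have /andP[h3 h4] := bump_itv Om n0 z.2.
  by rewrite ler_norml; apply/andP; split; lra.
have [D1|nD1] := pselect (near_diagonal (rho 0) z).
  left.
  (* The first radius that no longer contains the pair locates its shell; the pair is off the
     diagonal, so one exists. *)
  have hex : exists m, ~~ `[< near_diagonal (rho m) z >].
    have : z.1 <> z.2 by move=> E; apply: z12; rewrite E.
    move=> z12'; have : exists i, z.1 ord0 i != z.2 ord0 i.
      apply: contrapT => h; apply: z12'; apply/rowP => i; apply/eqP.
      by apply/negP => /negP ni; apply: h; exists i.
    move=> [i]; rewrite -subr_eq0 -normr_gt0 => hi.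
    have : (fun m => rho m) @ \oo --> (0 : R).
      by apply: cvg_expr; rewrite ger0_norm ?invr_ge0// invf_lt1// ltr1n.
    move=> /(_ _ (@lt_nbhsl_lt R _ _ hi)) [m _ hm]; exists m; apply/negP => /asboolP /(_ i).
    have r0 : 0 <= rho m by rewrite exprn_ge0.
    by move=> /(lt_trans (hm m (leqnn m) r0)); rewrite ltxx.
  case: (ex_minnP hex) => -[|m] /negP nm min; first by case: nm; apply/asboolP.
  have Dm : near_diagonal (rho m) z.
    apply: contrapT => h; have := min m; rewrite ltnn => /implyP; rewrite implybF.
    by move=> /negP; apply; apply/negP => /asboolP.
  exists m; split=> //; apply: ler_pM; rewrite ?powR_ge0 ?gagliardo_weight_ge0//.
    apply: ler_wpowR => //; first exact: ltW.
    by apply: bump_lip => // i; exact: ltW (Dm i).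
  apply: kernel_far; first by rewrite exprn_gt0// invr_gt0.
  by move=> h; apply: nm; apply/asboolP.
right.
have hex : exists m, `[< near_diagonal (2 ^+ m) z >].
  pose S := \sum_i `|z.1 ord0 i - z.2 ord0 i|.
  exists (Num.truncn S).+1; apply/asboolP => i.
  apply: (@le_lt_trans _ _ S).
    by rewrite /S (bigD1 i)//= lerDl sumr_ge0.
  apply: (lt_le_trans (truncnS_gt _)).
  by rewrite -natrX ler_nat ltnW// ltn_expl.
case: (ex_minnP hex) => -[|m] /asboolP Dm min; first by rewrite expr0 in Dm nD1.
exists m; split=> //; rewrite /energy_density -[leRHS]mul1r.
apply: ler_pM; rewrite ?powR_ge0 ?gagliardo_weight_ge0//.
  by rewrite -[leRHS](one_powR p); apply: ler_wpowR => //; exact: ltW.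
apply: kernel_far; first by rewrite exprn_gt0.
by move=> /asboolP/min; rewrite ltnn.
Qed.

Lemma half_powRX (a : R) j : (2^-1 ^+ j) `^ a = (2^-1 `^ a) ^+ j.
Proof. by rewrite -powR_mulrn ?invr_ge0// -powRrM mulrC powRrM powR_mulrn ?powR_ge0. Qed.

Lemma half_powR_lt1 (a : R) : 0 < a -> 0 <= (2^-1 : R) `^ a < 1.
Proof.
move=> a0; rewrite powR_ge0 -[ltRHS](one_powR a).
by apply: ltr_wpowR => //; rewrite ?invr_ge0 ?invf_lt1// ltr1n.
Qed.

Lemma inner_height_ge0 j : 0 <= inner_height j.
Proof. by rewrite mulr_ge0 ?powR_ge0. Qed.

Lemma outer_height_ge0 j : 0 <= outer_height j.
Proof. exact: powR_ge0. Qed.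

(** The ratio is 2^(-(p - p s)), below 1 because s < 1: near the diagonal, Lipschitz decay beats the
    singularity. Far away the ratio is 2^(-p s), below 1 because s > 0. *)
Lemma inner_heightE j : inner_height j * (2 * rho j) ^+ n =
  2 ^+ n * 2^-1 `^ (- (n%:R + p * s)) * (2^-1 `^ (p - p * s)) ^+ j.
Proof.
have r0 : 0 < rho j by rewrite exprn_gt0// invr_gt0.
rewrite /inner_height exprS powRM ?invr_ge0 ?(ltW r0)// exprMn -half_powRX.
rewrite (_ : p - p * s = p + - (n%:R + p * s) + n%:R); last ring.
rewrite powRD; last by rewrite (gt_eqF r0) implybT.
rewrite powRD; last by rewrite (gt_eqF r0) implybT.
by rewrite powR_mulrn ?(ltW r0)//; ring.
Qed.

Lemma outer_heightE j : outer_height j * (2 * 2 ^+ j.+1) ^+ n =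
  4 ^+ n * (2^-1 `^ (p * s)) ^+ j.
Proof.
have r0 : 0 < (2 : R) ^+ j by rewrite exprn_gt0.
rewrite /outer_height exprS mulrA -natrM exprMn mulrCA; congr (_ * _).
rewrite -half_powRX exprVn -(powR_mulrn n (ltW r0)) -powRD; last by rewrite (gt_eqF r0) implybT.
by rewrite opprD addrAC addNr add0r powRN -powRV ?(ltW r0).
Qed.

(** The density is bounded by a series of layers whose integrals form two geometric series. *)
Lemma energy_space_bump : energy_space mu Om k p (bump Om).
Proof.
have mb := measurable_bump Om n0.
have b0 x : 0 <= bump Om x by case/andP: (bump_itv Om n0 x).
have ii : mu.-integrable setT (EFin \o ind) by exact: (integrable_ind mOm fOm).
pose lay j z : \bar R :=
  (inner_height j * layer (rho j) z + outer_height j * layer (2 ^+ j.+1) z)%:E.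
have lay0 j z : (0 <= lay j z)%E.
  by rewrite lee_fin addr_ge0// mulr_ge0 ?layer_ge0 ?inner_height_ge0 ?outer_height_ge0.
have mlay j : measurable_fun setT (lay j).
  by apply/measurable_EFinP; apply: measurable_funD; apply: measurable_funM => //;
    exact: measurable_layer.
have Il a r : 0 <= a -> 0 < r ->
    (\int[mu \x mu]_z (a * layer r z)%:E = (a * (2 * fine (mu Om) * (2 * r) ^+ n))%:E)%E.
  move=> a0 r0; rewrite EFinM -integral_layer// -ge0_integralZl//.
  - by apply/measurable_EFinP; exact: measurable_layer.
  - by move=> z _; rewrite lee_fin layer_ge0.
have Ilay j : (\int[mu \x mu]_z lay j z = (2 * fine (mu Om) *
    (inner_height j * (2 * rho j) ^+ n + outer_height j * (2 * 2 ^+ j.+1) ^+ n))%:E)%E.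
  under eq_integral => z _ do rewrite /lay EFinD.
  rewrite ge0_integralD//; first last.
  - by apply/measurable_EFinP; apply: measurable_funM => //; exact: measurable_layer.
  - by move=> z _; rewrite lee_fin mulr_ge0 ?layer_ge0 ?outer_height_ge0.
  - by apply/measurable_EFinP; apply: measurable_funM => //; exact: measurable_layer.
  - by move=> z _; rewrite lee_fin mulr_ge0 ?layer_ge0 ?inner_height_ge0.
  rewrite !Il ?inner_height_ge0 ?outer_height_ge0 ?exprn_gt0 ?invr_gt0//.
  by rewrite -EFinD; congr EFin; ring.
split=> //; first by move=> x; exact: bump_out.
  apply: (integrable_le _ _ ii); first exact: measurable_normr_powR.
  move=> x; rewrite ger0_norm ?powR_ge0//; have [Ox|nOx] := pselect (Om x).
    rewrite indicE mem_set// -[leRHS](one_powR p); apply: ler_wpowR => //; first exact: ltW.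
    by rewrite ger0_norm//; case/andP: (bump_itv Om n0 x).
  by rewrite bump_out// normr0 powR0 ?gt_eqF// indicE ler0n.
apply: ge0_integrable_lt.
- by apply: measurable_energy_density => //; exact: measurable_gagliardo_weight.
- by move=> z; apply: energy_density_ge0; exact: gagliardo_weight_ge0.
apply: (@le_lt_trans _ _ (\int[mu \x mu]_z \sum_(0 <= j <oo) lay j z)%E).
  apply: ge0_le_integral => //.
  - by move=> z _; rewrite lee_fin; apply: energy_density_ge0; exact: gagliardo_weight_ge0.
  - apply/measurable_EFinP; apply: measurable_energy_density => //.
    exact: measurable_gagliardo_weight.
  - by apply: ge0_emeasurable_sum => // j _; exact: mlay.
  move=> z _; have term j : (lay j z <= \sum_(0 <= i <oo) lay i z)%E.
    apply: le_trans (nneseries_lim_ge j.+1 (fun i _ _ => lay0 i z)).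
    by rewrite big_nat_recr//= leeDr// sume_ge0.
  have [z12|z12] := pselect (bump Om z.1 = bump Om z.2).
    rewrite /energy_density z12 subrr normr0 powR0 ?gt_eqF// mul0r.
    by apply: nneseries_ge0 => j _ _.
  have [i1 [[j [nd h]]|[j [nd h]]]] := bump_density_le z12.
  - apply: le_trans (term j); rewrite lee_fin; apply: (le_trans h).
    rewrite /layer (indicE _ (near_diagonal (rho j))) mem_set// mulr1.
    rewrite ler_wpDr ?mulr_ge0 ?outer_height_ge0 ?layer_ge0//.
    by rewrite ler_peMr// inner_height_ge0.
  - apply: le_trans (term j); rewrite lee_fin; apply: (le_trans h).
    rewrite ler_wpDl ?mulr_ge0 ?inner_height_ge0 ?layer_ge0//.
    rewrite /layer (indicE _ (near_diagonal _)) mem_set// mulr1.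
    by rewrite ler_peMr// outer_height_ge0.
rewrite integral_nneseries//; under eq_eseriesr => j _ do rewrite Ilay mulrDr EFinD.
have fm0 : 0 <= fine (mu Om) by rewrite fine_ge0.
rewrite nneseriesD => [|j _ _|j _ _]; last 2 first.
- by rewrite lee_fin !mulr_ge0 ?exprn_ge0 ?mulr_ge0 ?exprn_ge0 ?inner_height_ge0.
- by rewrite lee_fin !mulr_ge0 ?exprn_ge0 ?mulr_ge0 ?exprn_ge0 ?outer_height_ge0.
apply: lte_add_pinfty.
- apply: (geometric_nneseries_lty (half_powR_lt1 pps0)
    (C := 2 * fine (mu Om) * (2 ^+ n * 2^-1 `^ (- (n%:R + p * s))))) => j.
  rewrite inner_heightE mulrA lexx andbT.
  by rewrite !mulr_ge0 ?exprn_ge0 ?powR_ge0.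
- apply: (geometric_nneseries_lty (half_powR_lt1 ps0) (C := 2 * fine (mu Om) * 4 ^+ n)) => j.
  rewrite outer_heightE mulrA lexx andbT.
  by rewrite !mulr_ge0 ?exprn_ge0 ?powR_ge0.
Qed.

End bump_energy.

(** * Lebesgue measurable data *)

Section almost_everywhere_integral.
Local Open Scope ereal_scope.
Context d (T : measurableType d) (R : realType) (m : {measure set T -> \bar R}).
Implicit Types (D : set T) (f g F : T -> \bar R) (w : T -> R).
Import HBNNSimple.

(** A simple function below [f], set to 0 on a Borel null set, lies below [g] and has the same
    integral; the integrals being suprema over simple functions, neither [f] nor [g] has to be
    measurable. *)
Lemma ae_le_integral_ge0 f g : (forall x, 0 <= f x) -> (forall x, 0 <= g x) ->
  {ae m, forall x, f x = g x} -> \int[m]_x f x <= \int[m]_x g x.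
Proof.
move=> f0 g0 [A [mA A0 sA]].
rewrite (ge0_integralTE _ f0) (ge0_integralTE _ g0).
apply: ge_ereal_sup => _ [h hf <-].
pose h' := proj_nnsfun h (measurableC mA).
have h'E x : h' x = (h x * \1_(~` A) x)%R by rewrite /h' /= mindicE indicE.
have sE (q : {nnsfun T >-> R}) : sintegral m q = \int[m]_x (q x)%:E.
  by rewrite integral_nnsfun// patch_setT.
have -> : sintegral m h = sintegral m h'.
  rewrite !sE; apply: ae_eq_integral => //; [exact/measurable_EFinP|exact/measurable_EFinP|].
  exists A; split=> // x /= /not_implyP[_ hx]; apply: contrapT => nA; apply: hx.
  by move: (h'E x) => /= ->; rewrite indicE mem_set// mulr1.
apply: ereal_sup_ubound; exists h' => // x; rewrite h'E.
have [Ax|nAx] := pselect (A x).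
  by rewrite indicE memNset ?mulr0// => /(_ Ax).
rewrite indicE mem_set// mulr1; apply: (le_trans (hf x)).
have -> : f x = g x by apply: contrapT => fg; apply: nAx; apply: sA => /=.
by [].
Qed.

(* Unlike [ae_eq_integral], no measurability is required: this is what makes
   the integrals of Lebesgue measurable functions computable on Borel ones. *)
Lemma ae_integral_eq D f g : {ae m, forall x, D x -> f x = g x} ->
  \int[m]_(x in D) f x = \int[m]_(x in D) g x.
Proof.
move=> fg; rewrite integral_mkcond [RHS]integral_mkcond.
have {}fg : {ae m, forall x, (f \_ D) x = (g \_ D) x}.
  apply: filterS fg => x h; rewrite /patch; case: ifPn => //.
  by rewrite inE => /h.
rewrite integralE [RHS]integralE; congr (_ - _); apply/eqP; rewrite eq_le.
  apply/andP; split; apply: ae_le_integral_ge0 => //; apply: filterS fg => x.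
    by rewrite !funeposE => ->.
  by rewrite !funeposE => ->.
apply/andP; split; apply: ae_le_integral_ge0 => //; apply: filterS fg => x.
  by rewrite !funenegE => ->.
by rewrite !funenegE => ->.
Qed.

Lemma integral_funenegB_lty F w : measurable_fun setT F -> (forall x, 0 <= F x) ->
  m.-integrable setT (EFin \o w) -> (forall x, 0 <= (w x)%:E) ->
  \int[m]_x (fun x => F x - (w x)%:E)^\- x < +oo.
Proof.
move=> mF F0 iw w0; have mw := measurable_int _ iw.
have wfin : \int[m]_x (w x)%:E \is a fin_num by exact: integrable_fin_num.
have mD : measurable_fun setT (fun x => F x - (w x)%:E) by exact: emeasurable_funB.
apply: (@le_lt_trans _ _ (\int[m]_x (w x)%:E)); last by rewrite ltey_eq wfin.
apply: ge0_le_integral => //; first exact: measurable_funeneg.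
move=> x _; rewrite funenegE ge_max w0 andbT.
have := F0 x; case: (F x) => [r||]//= r0; last by rewrite leNye.
by rewrite lee_fin opprB lerBlDr lerDl -lee_fin.
Qed.

(** The integral of [F] may be +oo; then the negative part of F - w is still dominated by [w], and
    both sides are +oo. *)
Lemma integralB_ge0 F w : measurable_fun setT F -> (forall x, 0 <= F x) ->
  m.-integrable setT (EFin \o w) -> (forall x, 0 <= (w x)%:E) ->
  \int[m]_x (F x - (w x)%:E) = \int[m]_x F x - (\int[m]_x (w x)%:E).
Proof.
move=> mF F0 iw w0; have mw := measurable_int _ iw.
have [Foo|Foo] := eqVneq (\int[m]_x F x) +oo; last first.
  have iF : m.-integrable setT F.
    apply/integrableP; split=> //; under eq_integral => x _ do rewrite gee0_abs//.
    by rewrite ltey.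
  exact: integralB.
have wfin : \int[m]_x (w x)%:E \is a fin_num by exact: integrable_fin_num.
have mD : measurable_fun setT (fun x => F x - (w x)%:E) by exact: emeasurable_funB.
rewrite Foo -(fineK wfin) addye// integralE.
have neg := integral_funenegB_lty mF F0 iw w0.
have pos : \int[m]_x (fun x => F x - (w x)%:E)^\+ x = +oo.
  apply/eqP; rewrite -leye_eq.
  have : +oo <= \int[m]_x (fun x => F x - (w x)%:E)^\+ x + \int[m]_x (w x)%:E.
    rewrite -Foo -ge0_integralD//; last exact: measurable_funepos.
    apply: ge0_le_integral => //.
    - by apply: emeasurable_funD => //; exact: measurable_funepos.
    - move=> x _; rewrite funeposE -leeBlDr// le_max lexx//.
  move: wfin; case: (\int[m]_x (w x)%:E) => // r _.
  by case: (\int[m]_x _).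
by rewrite pos; move: neg; case: (\int[m]_x _).
Qed.

Lemma integralNB_ge0 F w : measurable_fun setT F -> (forall x, 0 <= F x) ->
  m.-integrable setT (EFin \o w) -> (forall x, 0 <= (w x)%:E) ->
  \int[m]_x ((w x)%:E - F x) = \int[m]_x (w x)%:E - \int[m]_x F x.
Proof.
move=> mF F0 iw w0.
have wfin : \int[m]_x (w x)%:E \is a fin_num by exact: integrable_fin_num.
have mw := measurable_int _ iw.
have neg := integral_funenegB_lty mF F0 iw w0.
rewrite (_ : (fun x => (w x)%:E - F x) = (fun x => - (F x - (w x)%:E))).
  have n0 : 0 <= \int[m]_x (fun x => F x - (w x)%:E)^\- x by apply: integral_ge0 => x _.
  rewrite integralN; last first.
    by move: neg n0; case: (\int[m]_x _^\- x) => [r||]// _ _; case: (\int[m]_x _^\+ x).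
  by rewrite integralB_ge0// [LHS]fin_num_oppeB// addeC.
by apply/funext => x; rewrite fin_num_oppeB// addeC.
Qed.

End almost_everywhere_integral.

(** * Borel representatives vanishing off the domain *)

Section representatives.
Context {R : realType} (n : nat).
Local Notation T := 'rV[R]_n.
Local Notation mu := (@lebesgue_rV R n).
Variables (Om : set T) (s p : R).
Hypothesis oOm : open Om.
Hypothesis p1 : 1 < p.
Local Notation k := (@gagliardo_weight R n s p).
Local Notation W := (energy_space mu Om k p).
Implicit Types u v phi : T -> R.

Let p0 : 0 < p. Proof. exact: lt_trans ltr01 p1. Qed.
Let mOm : measurable Om. Proof. exact: open_measurable_rV. Qed.

Definition represents u' u : Prop := W u' /\ {ae mu, forall x, u x = u' x}.

Lemma represents_refl u : W u -> represents u u.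
Proof. by move=> Wu; split=> //; exact: aeW. Qed.

Lemma gagliardoE u' u : represents u' u ->
  gagliardo s p u = ((energy mu k p u') `^ p^-1)%:E.
Proof.
move=> [[mu_ uz iu eu] uu'].
have E : (\int[mu \x mu]_z (`|u z.1 - u z.2| `^ p / gagliardo_kernel s p z)%:E =
    (energy mu k p u')%:E)%E.
  rewrite -[RHS](EFin_Rintegral eu); apply: ae_integral_eq.
  by apply: filterS (ae_prod uu' uu') => z [h1 h2] _; rewrite h1 h2.
by rewrite /gagliardo E.
Qed.

Lemma gagliardo_powRE u' u : represents u' u ->
  (gagliardo s p u `^ p)%E = (energy mu k p u')%:E.
Proof.
move=> uu'; rewrite (gagliardoE uu') poweR_EFin -powRrM mulVf ?gt_eqF// powRr1//.
by apply: energy_ge0; exact: gagliardo_weight_ge0.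
Qed.

Lemma Lp_norm_powRE D u' u : represents u' u -> Om `<=` D ->
  (Lp_norm D p%:E u `^ p)%E = (\int[mu]_x (`|u' x| `^ p))%:E.
Proof.
move=> [[mu_ uz iu eu] uu'] OD; rewrite /Lp_norm poweR_Lnorm ?gt_eqF// -EFin_Rintegral//.
apply: ae_integral_eq; apply: filterS uu' => x ux _.
rewrite /patch; case: ifPn => [_|]; first by rewrite /= ux.
rewrite notin_setE => nD; rewrite abse0 poweR0r ?gt_eqF// uz => [|Ox].
  by rewrite normr0 powR0 ?gt_eqF.
by apply: nD; exact: OD.
Qed.

Lemma represents_in_W0 u' u : represents u' u -> in_W0 s p Om u.
Proof.
move=> uu'; have [[mu_ uz iu eu] ae] := uu'; split; last first.
  by apply: filterS ae => x -> nO; exact: uz.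
split; last by rewrite (gagliardoE uu') ltry.
split; first by exists u' => //; apply: filterS ae => x h _.
apply: (@lty_poweRy _ _ p); first by rewrite gt_eqF.
by rewrite (Lp_norm_powRE uu' (@subsetT _ Om)) ltry.
Qed.

(** A Borel version times the indicator of [Om], which turns vanishing almost everywhere outside
    into vanishing everywhere outside. *)
Lemma in_W0_represents u : in_W0 s p Om u -> exists u', represents u' u.
Proof.
move=> [[[[h mh uh] Lu] Gu] uz].
pose u' x := h x * \1_Om x.
have mu_ : measurable_fun setT u'.
  by apply: measurable_funM => //; exact: (@measurable_indic _ _ R setT Om mOm).
have uu' : {ae mu, forall x, u x = u' x}.
  apply: filterS2 uh uz => x h1 h2; rewrite /u' indicE.
  have [Ox|nO] := pselect (Om x); first by rewrite mem_set// mulr1 h1.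
  by rewrite memNset// mulr0 h2.
exists u'; split=> //; split=> //.
- by move=> x nO; rewrite /u' indicE memNset// mulr0.
- apply: ge0_integrable_lt => //; first exact: measurable_normr_powR.
  have -> : (\int[mu]_x (`|u' x| `^ p)%:E = Lp_norm setT p%:E u `^ p)%E.
    rewrite /Lp_norm poweR_Lnorm ?gt_eqF//; apply: ae_integral_eq.
    by apply: filterS uu' => x ux _; rewrite patch_setT /= ux.
  by rewrite poweR_lty.
- apply: ge0_integrable_lt.
  + by apply: measurable_energy_density => //; exact: measurable_gagliardo_weight.
  + by move=> z; apply: energy_density_ge0; exact: gagliardo_weight_ge0.
  + have -> : (\int[mu \x mu]_z (energy_density k p u' z)%:E = gagliardo s p u `^ p)%E.
      rewrite /gagliardo -poweRrM mulVf ?gt_eqF// poweRe1; last first.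
        apply: integral_ge0 => z _; rewrite lee_fin mulr_ge0 ?powR_ge0//.
        exact: gagliardo_weight_ge0.
      apply: ae_integral_eq.
      by apply: filterS (ae_prod uu' uu') => z [h1 h2] _; rewrite h1 h2.
    by rewrite poweR_lty.
Qed.

Lemma fracplapE u' u phi' phi : represents u' u -> represents phi' phi ->
  fracplap s p u phi = (form mu k p u' phi')%:E.
Proof.
move=> [Wu uu'] [Wphi pp']; rewrite /form -EFin_Rintegral; last first.
  exact: (integrable_form_density p1 (@measurable_gagliardo_weight R n s p)
    (@gagliardo_weight_ge0 R n s p) Wu Wphi).
apply: ae_integral_eq.
apply: filterS2 (ae_prod uu' uu') (ae_prod pp' pp') => z [h1 h2] [h3 h4] _.
by rewrite h1 h2 h3 h4.
Qed.


Lemma represents_change u' u'' u : represents u' u -> measurable_fun setT u'' ->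
  (forall x, ~ Om x -> u'' x = 0) -> {ae mu, forall x, u' x = u'' x} -> represents u'' u.
Proof.
move=> [Wu' uu'] mu'' zu'' u'u''; split; last by apply: filterS2 uu' u'u'' => x -> ->.
by have [] := energy_space_ae p1 (@measurable_gagliardo_weight R n s p)
    (@gagliardo_weight_ge0 R n s p) Wu' mu'' zu'' u'u''.
Qed.

End representatives.

(** * Repairing the reaction term on a null set *)

Section regularisation.
Context {R : realType} (n : nat).
Local Notation T := 'rV[R]_n.
Local Notation mu := (@lebesgue_rV R n).

(** A dense sequence of nonnegative reals; indices coding no rational give 0. *)
Definition nonneg_rat (m : nat) : R := `|ratr (odflt 0 (@unpickle rat m))|.

Lemma nonneg_rat_dense (t e : R) : 0 <= t -> 0 < e -> exists m, `|nonneg_rat m - t| < e.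
Proof.
move=> t0 e0; have [q] : exists q : rat, ratr q \in `]t, (t + e)[.
  by apply: rat_in_itvoo; rewrite ltrDl.
rewrite in_itv/= => /andP[tq qe]; exists (pickle q).
rewrite /nonneg_rat pickleK/= (ger0_norm (le_trans t0 (ltW tq))).
by rewrite gtr0_norm ?subr_gt0// ltrBlDl.
Qed.

Lemma continuous_max0 (h : R -> R) : {within `[0, +oo[, continuous h} ->
  continuous (fun t : R => h (Num.max 0 t)).
Proof.
move=> /subspace_continuousP ch t.
have pos r : 0 <= Num.max (0 : R) r by rewrite le_max lexx.
have mem r : `[0, +oo[%classic (Num.max (0 : R) r) by rewrite /= in_itv/= andbT.
apply: (@cvg_trans _ (h @ within `[0, +oo[ (nbhs (Num.max 0 t)))); last exact: ch.
move=> P hP.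
have cm : {for t, continuous (Num.max (0 : R))}.
  by apply: (@continuous_max _ _ (fun=> 0) id t); [exact: cvg_cst|exact: cvg_id].
change (\forall r \near t, P (h (Num.max 0 r))).
by apply: (filterS (Filter := nbhs_filter (t : R)) _ (cm _ hP)) => r; apply; exact: mem.
Qed.

Lemma ess_bounded (D : set T) (h : T -> R) : (Lp_norm D +oo%E h < +oo)%E ->
  exists C : R, {ae mu, forall x, D x -> `|h x| <= C}.
Proof.
rewrite /Lp_norm unlock; case: ifPn => [_ fin|].
  have [C hC] : exists C : R, (ess_sup_inf.ess_sup mu (abse \o ((EFin \o h) \_ D)) <= C%:E)%E.
    by move: fin; case: (ess_sup_inf.ess_sup _ _) => [r||]// _; [exists r|exists 0; rewrite leNye].
  exists C; have := ess_sup_inf.ess_sup_ge mu (abse \o ((EFin \o h) \_ D)).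
  apply: filterS => x hx Dx; rewrite -lee_fin; apply: le_trans hC.
  by apply: le_trans hx; rewrite /= /patch mem_set.
(* In this branch of the norm's definition the whole space is null. *)
rewrite -leNgt => h0 _; exists 0, setT; split=> //.
by apply/eqP; rewrite eq_le h0 measure_ge0.
Qed.

Lemma regular_reaction (Om : set T) (p c0 : R) (f : T -> R -> R) :
  1 < p -> 0 < c0 -> measurable Om -> Caratheodory Om f ->
  (forall t, 0 <= t -> in_Lp Om +oo%E (fun x => f x t)) ->
  {ae mu, forall x, Om x -> forall t, 0 <= t -> f x t <= c0 * (1 + t `^ (p - 1))} ->
  {ae mu, forall x, Om x -> forall t1 t2, 0 < t1 -> t1 < t2 ->
     f x t2 / t2 `^ (p - 1) < f x t1 / t1 `^ (p - 1)} ->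
  exists (A : set T) (g : T -> R -> R),
    [/\ A `<=` Om, {ae mu, forall x, Om x -> A x}, reaction p c0 g &
        forall x t, A x -> 0 <= t -> g x t = f x t].
Proof.
move=> p1 c00 mOm [fm fc] fb fle fdecr.
have pm : 0 < p - 1 by rewrite subr_gt0.
have tm0 m : 0 <= nonneg_rat m by exact: normr_ge0.
have hex m : exists h : T -> R, measurable_fun Om h /\
    {ae mu, forall x, Om x -> f x (nonneg_rat m) = h x}.
  by have [h mh hh] := fm _ (tm0 m); exists h.
have [h hh] := choice hex.
have bex m : exists C : R, {ae mu, forall x, Om x -> `|f x m.+1%:R| <= C}.
  by apply: ess_bounded; have [] := fb _ (ler0n R m.+1).
have [C hC] := choice bex.
have a1 : {ae mu, forall x m, Om x -> f x (nonneg_rat m) = h m x}.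
  by apply: ae_foralln => m; exact: (hh m).2.
have a2 : {ae mu, forall x m, Om x -> `|f x m.+1%:R| <= C m} by exact: ae_foralln.
(* Only countably many null sets are discarded: one per rational t for measurability, one per
   integer for boundedness, and one each for continuity, (2) and (3). *)
pose good x := [/\ (forall m, f x (nonneg_rat m) = h m x),
  (forall m, `|f x m.+1%:R| <= C m), {within `[0, +oo[, continuous (f x)},
  (forall t, 0 <= t -> f x t <= c0 * (1 + t `^ (p - 1))) &
  (forall t1 t2, 0 < t1 -> t1 < t2 ->
     f x t2 / t2 `^ (p - 1) < f x t1 / t1 `^ (p - 1))].
have : {ae mu, forall x, Om x -> good x}.
  near=> x => Ox; split.
  - move=> m; move: m Ox; near: x; apply: filterS a1 => x hx m Ox; exact: hx.
  - move=> m; move: m Ox; near: x; apply: filterS a2 => x hx m Ox; exact: hx.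
  - by move: Ox; near: x; exact: fc.
  - by move: Ox; near: x; exact: fle.
  - by move: Ox; near: x; exact: fdecr.
move=> [Z [mZ Z0 sZ]].
pose A := Om `\` Z; have mA : measurable A by exact: measurableD.
have Agood x : A x -> good x.
  by move=> [Ox nZ]; apply: contrapT => ng; apply: nZ; apply: sZ => /(_ Ox).
pose g x t := if x \in A then f x (Num.max 0 t) else c0.
have gA x t : A x -> g x t = f x (Num.max 0 t) by move=> Ax; rewrite /g mem_set.
have gN x t : ~ A x -> g x t = c0 by move=> nA; rewrite /g memNset.
have cg x : continuous (g x).
  have [Ax|nA] := pselect (A x).
    by rewrite (funext (gA x ^~ Ax)); apply: continuous_max0; have [] := Agood x Ax.
  by rewrite (funext (gN x ^~ nA)); exact: cst_continuous.
exists A, g; split.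
- by move=> x [].
- exists Z; split=> // x /= /not_implyP[Ox nA]; apply: contrapT => nZ.
  by apply: nA.
- split.
  + have mrat m : measurable_fun setT (g ^~ (nonneg_rat m)).
      rewrite (_ : g ^~ _ = fun x => (h m \_ A) x + c0 * \1_(~` A) x).
        apply: measurable_funD.
          apply/(measurable_restrictT _ mA); apply: measurable_funS (hh m).1 => //.
          by move=> x [].
        apply: measurable_funM => //.
        exact: (@measurable_indic _ _ R setT _ (measurableC mA)).
      apply/funext => x; have [Ax|nA] := pselect (A x).
        rewrite gA// /patch indicE mem_set// memNset ?mulr0 ?addr0; last by move/(_ Ax).
        rewrite /Num.max lt_neqAle tm0 andbT.
        have [hm _ _ _ _] := Agood x Ax; rewrite -hm.
        by case: eqVneq => [<-|].
      by rewrite gN// /patch indicE memNset// mem_set// mulr1 add0r.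
    move=> t.
    (* For any other t, measurability follows by continuity along rationals tending to max(0,t). *)
    have ex j : exists m, `|nonneg_rat m - Num.max 0 t| < j.+1%:R^-1.
      by apply: nonneg_rat_dense; rewrite ?le_max ?lexx ?invr_gt0.
    have [m hm] := choice ex.
    have cm : (fun j => nonneg_rat (m j)) @ \oo --> Num.max 0 t.
      apply/cvgrPdist_lt => e e0; near=> j; rewrite distrC; apply: (lt_trans (hm j)).
      by near: j; exact: (near_infty_natSinv_lt (PosNum e0)).
    have gt x : g x t = g x (Num.max 0 t).
      by rewrite /g; case: ifP => // _; congr f; rewrite maxA maxxx.
    apply: (@measurable_fun_cvg _ _ _ setT (fun j x => g x (nonneg_rat (m j)))) => // x _.
    rewrite gt; apply: (@cvg_comp _ _ _ _ (g x) _ _ _ cm); exact: cg.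
  + exact: cg.
  + move=> x t t0; rewrite /g; case: ifP => // _; congr f.
    by rewrite maxxx; apply/max_idPl.
  + move=> x t t0; have [Ax|nA] := pselect (A x).
      by rewrite gA// (max_idPr t0); have [_ _ _ hle _] := Agood x Ax; exact: hle.
    by rewrite gN// ler_peMr ?(ltW c00)// lerDl powR_ge0.
  + move=> x t1 t2 t10 t12; have t20 := lt_trans t10 t12.
    have [Ax|nA] := pselect (A x).
      rewrite !gA// !(max_idPr _) ?(ltW t10) ?(ltW t20)//.
      by have [_ _ _ _ hd] := Agood x Ax; exact: hd.
    rewrite !gN// ltr_pM2l// ltf_pV2 ?posrE ?powR_gt0//.
    by apply: ltr_wpowR => //; exact: ltW.
  + move=> m; exists (Num.max (C m) c0) => x; have [Ax|nA] := pselect (A x).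
      rewrite gA// (max_idPr (ler0n _ _)) le_max.
      by have [_ -> _ _ _] := Agood x Ax.
    by rewrite gN// ger0_norm ?(ltW c00)// le_max lexx orbT.
- by move=> x t Ax t0; rewrite gA// (max_idPr t0).
Unshelve. all: by end_near. Qed.

End regularisation.

(** * Limits of the quotient and eigenvalues *)

Section limit_quotients.
Context d (T : measurableType d) (R : realType).
Variables (p c0 : R) (g : T -> R -> R).
Hypothesis hg : reaction p c0 g.
Local Notation Q := (quotient p g).




Definition quotient_sup x : \bar R := ereal_sup ((fun t => (Q x t)%:E) @` `]0, +oo[).
(** The maximum with 1 makes the function nonincreasing on the whole line, so that its limit at +oo
    is this infimum. *)
Definition quotient_inf x : \bar R := ereal_inf (range (fun t => (Q x (Num.max 1 t))%:E)).

Lemma quotient_lt x t1 t2 : 0 < t1 -> t1 < t2 -> Q x t2 < Q x t1.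
Proof. exact: (reaction_decr hg). Qed.

(** Strict, since the quotient at t/2 is already larger. *)
Lemma quotient_lt_sup x t : 0 < t -> ((Q x t)%:E < quotient_sup x)%E.
Proof.
move=> t0; have t20 : 0 < t / 2 by rewrite divr_gt0.
apply: (@lt_le_trans _ _ (Q x (t / 2))%:E).
  by rewrite lte_fin quotient_lt// ltr_pdivrMr// ltr_pMr// ltr1n.
by apply: ereal_sup_ubound; exists (t / 2) => //=; rewrite in_itv/= t20.
Qed.

Lemma quotient_inf_lt x t : 0 < t -> (quotient_inf x < (Q x t)%:E)%E.
Proof.
move=> t0; have t1 : 0 < t + 1 by rewrite addr_gt0.
apply: (@le_lt_trans _ _ (Q x (Num.max 1 (t + 1)))%:E).
  by apply: ereal_inf_lbound; exists (t + 1).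
by rewrite lte_fin quotient_lt// lt_max ltrDl ltr01 orbT.
Qed.

Lemma cvg_quotient_sup x : (Q x t)%:E @[t --> 0^'+] --> quotient_sup x.
Proof.
apply: (@nonincreasing_at_right_cvge R (fun t => (Q x t)%:E) 0 (BInfty R false)) => //.
move=> t1 t2; rewrite !in_itv/= !andbT => t10 t20 t12.
by rewrite lee_fin (quotient_le hg).
Qed.

Lemma cvg_quotient_sup_seq x (t : nat -> R) : (forall n, 0 < t n) -> t @ \oo --> (0 : R) ->
  (Q x (t n))%:E @[n --> \oo] --> quotient_sup x.
Proof.
move=> tpos t0; apply: (@cvg_comp _ _ _ t (fun t => (Q x t)%:E) _ (0^'+)); last first.
  exact: cvg_quotient_sup.
move=> P hP; have [m _ hm] := t0 _ hP; exists m => // n mn.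
exact: (hm n mn (tpos n)).
Qed.

Lemma cvg_quotient_inf x : (Q x t)%:E @[t --> +oo] --> quotient_inf x.
Proof.
apply: (@cvg_trans _ ((Q x (Num.max 1 t))%:E @[t --> +oo])).
  apply: near_eq_cvg; near=> t.
  have t1 : 1 <= t by near: t; exact: nbhs_pinfty_ge.
  by rewrite (max_idPr t1).
apply: nonincreasing_cvge => t1 t2 t12; rewrite lee_fin (quotient_le hg)//.
  by rewrite lt_max ltr01.
by rewrite ge_max !le_max lexx t12 !orbT.
Unshelve. all: by end_near. Qed.

Lemma cvg_quotient_inf_seq x : (Q x n.+1%:R)%:E @[n --> \oo] --> quotient_inf x.
Proof.
apply: (@cvg_comp _ _ _ (fun n => n.+1%:R) (fun t => (Q x t)%:E) _ (+oo)); last first.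
  exact: cvg_quotient_inf.
by have := @cvgr_idn R; rewrite -cvg_shiftS.
Qed.

Lemma measurable_cvg_quotient (a : T -> \bar R) (t : nat -> R) :
  (forall x, (Q x (t n))%:E @[n --> \oo] --> a x) -> measurable_fun setT a.
Proof.
move=> ca; rewrite (_ : a = fun x => limn_einf (fun n => (Q x (t n))%:E)).
  apply: measurable_limn_einf => n; apply/measurable_EFinP.
  exact: (measurable_quotient hg (measurable_cst _)).
by apply/funext => x; rewrite (cvg_limn_einf_sup (ca x)).1.
Qed.

Lemma measurable_quotient_sup : measurable_fun setT quotient_sup.
Proof.
apply: (@measurable_cvg_quotient _ (fun n => n.+1%:R^-1)) => x.
by apply: cvg_quotient_sup_seq => //; exact: cvg_invS.
Qed.

Lemma measurable_quotient_inf : measurable_fun setT quotient_inf.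
Proof. exact: measurable_cvg_quotient cvg_quotient_inf_seq. Qed.

End limit_quotients.

(** * Eigenvalues in terms of the energy space *)

Section rayleigh_quotient.
Context {R : realType} (n : nat).
Local Notation T := 'rV[R]_n.
Local Notation mu := (@lebesgue_rV R n).
Variables (Om : set T) (s p : R).
Hypothesis oOm : open Om.
Hypothesis p1 : 1 < p.
Local Notation k := (@gagliardo_weight R n s p).
Local Notation W := (energy_space mu Om k p).
Local Notation represents := (represents Om s p).
Implicit Types (u v phi : T -> R) (a b : T -> \bar R).

Let p0 : 0 < p. Proof. exact: lt_trans ltr01 p1. Qed.
Let mOm : measurable Om. Proof. exact: open_measurable_rV. Qed.

Lemma weighted_integral_eq a b v' v : represents v' v ->
  {ae mu, forall x, Om x -> a x = b x} ->
  (\int[mu]_(x in Om `&` [set x | v x <> 0%R]) (a x * (`|v x| `^ p)%:E) =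
   \int[mu]_x (b x * (`|v' x| `^ p)%:E))%E.
Proof.
move=> [[mv vz iv ev] vv'] ab; rewrite integral_mkcond; apply: ae_integral_eq.
apply: filterS2 vv' ab => x vx ax _; rewrite /patch -vx.
case: ifPn => [|]; first by rewrite inE => -[Ox _]; rewrite ax.
rewrite notin_setE => nx; suff -> : v x = 0 by rewrite normr0 powR0 ?gt_eqF// mule0.
have [Ox|nO] := pselect (Om x); last by rewrite vx vz.
by apply: contrapT => v0; apply: nx.
Qed.

Definition rayleigh (b : T -> \bar R) v : \bar R :=
  (((energy mu k p v)%:E - \int[mu]_x (b x * (`|v x| `^ p)%:E)) /
    (\int[mu]_x (`|v x| `^ p))%:E)%E.

Lemma energy_space_norm_gt0 v : W v -> ~ {ae mu, forall x, v x = 0} ->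
  0 < \int[mu]_x (`|v x| `^ p).
Proof.
move=> [mv vz iv ev] v0; rewrite ltNge; apply/negP => le0; apply: v0.
have := ge0_Rintegral_eq0 iv (fun x => powR_ge0 _ _) le0.
by apply: filterS => x /powR_eq0_eq0 /eqP; rewrite normr_eq0 => /eqP.
Qed.

Lemma lambda1E a b : {ae mu, forall x, Om x -> a x = b x} ->
  lambda1 s p Om a =
  ereal_inf [set rayleigh b v | v in [set v | W v /\ ~ {ae mu, forall x, v x = 0}]].
Proof.
move=> ab; rewrite /lambda1; congr ereal_inf; apply/seteqP; split=> r /=.
  move=> [v [vW v0 ->]]; have [v' vv'] := in_W0_represents oOm p1 vW.
  exists v'; last first.
    rewrite /rayleigh (gagliardo_powRE p1 vv') (weighted_integral_eq vv' ab).
    by rewrite (Lp_norm_powRE p1 vv').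
  split; first by case: vv'.
  move=> v'0; apply: v0; have [_ vv] := vv'.
  by apply: filterS2 vv v'0 => x -> ->.
move=> [v [Wv v0] <-]; have rv := represents_refl Wv; exists v; split=> //.
  exact: (represents_in_W0 p1 rv).
rewrite /rayleigh (gagliardo_powRE p1 rv) (weighted_integral_eq rv ab).
by rewrite (Lp_norm_powRE p1 rv).
Qed.

Lemma rayleigh_lt0 b v : W v -> ~ {ae mu, forall x, v x = 0} ->
  (rayleigh b v < 0)%E =
  ((energy mu k p v)%:E < \int[mu]_x (b x * (`|v x| `^ p)%:E))%E.
Proof.
move=> Wv v0; have L0 := energy_space_norm_gt0 Wv v0.
rewrite /rayleigh inver gt_eqF// muleC pmule_rlt0 ?lte_fin ?invr_gt0//.
by rewrite sube_lt0.
Qed.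

Lemma rayleigh_gt0 b v : W v -> ~ {ae mu, forall x, v x = 0} ->
  (0 < rayleigh b v)%E =
  (\int[mu]_x (b x * (`|v x| `^ p)%:E) < (energy mu k p v)%:E)%E.
Proof.
move=> Wv v0; have L0 := energy_space_norm_gt0 Wv v0.
by rewrite /rayleigh inver gt_eqF// muleC pmule_rgt0 ?lte_fin ?invr_gt0// sube_gt0.
Qed.

Lemma rayleigh_ge b v (dl : R) : W v -> ~ {ae mu, forall x, v x = 0} ->
  ((dl * \int[mu]_x (`|v x| `^ p))%:E <=
    (energy mu k p v)%:E - \int[mu]_x (b x * (`|v x| `^ p)%:E))%E ->
  (dl%:E <= rayleigh b v)%E.
Proof.
move=> Wv v0; have L0 := energy_space_norm_gt0 Wv v0.
by rewrite /rayleigh inver gt_eqF// lee_pdivlMr.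
Qed.

End rayleigh_quotient.

(** * Weak solutions and pointwise positive solutions *)

Section weak_solutions.
Context {R : realType} (n : nat).
Local Notation T := 'rV[R]_n.
Local Notation mu := (@lebesgue_rV R n).
Variables (Om A : set T) (s p c0 : R) (f g : T -> R -> R).
Hypothesis oOm : open Om.
Hypothesis p1 : 1 < p.
Hypothesis OA : {ae mu, forall x, Om x -> A x}.
Hypothesis hg : reaction p c0 g.
Hypothesis gf : forall x t, A x -> 0 <= t -> g x t = f x t.
Local Notation k := (@gagliardo_weight R n s p).
Local Notation W := (energy_space mu Om k p).
Local Notation represents := (represents Om s p).
Local Notation positive_solution := (positive_solution mu Om k p g).
Implicit Types (u v phi : T -> R).

Let p0 : 0 < p. Proof. exact: lt_trans ltr01 p1. Qed.
Let mOm : measurable Om. Proof. exact: open_measurable_rV. Qed.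

(** [H] is either the inclusion of reals, for the value of the integral, or the absolute value, for
    integrability. *)
Lemma reaction_integral_eq (H : R -> \bar R) u' u phi' phi : H 0 = 0%E ->
  represents u' u -> represents phi' phi -> (forall x, Om x -> 0 < u' x) ->
  (\int[mu]_(x in Om) H (f x (u x) * phi x)%R = \int[mu]_x H (g x (u' x) * phi' x)%R)%E.
Proof.
move=> H0 [_ uu'] [[_ pz _ _] pp'] upos; rewrite integral_mkcond; apply: ae_integral_eq.
apply: filterS3 uu' pp' OA => x ux px Ax _; rewrite /patch.
case: ifPn => [|]; first by rewrite inE => Ox; rewrite ux px gf// ?ltW ?upos//; exact: Ax.
by rewrite notin_setE => nO; rewrite pz// mulr0 H0.
Qed.

(** The value 1 is put on the null part of [Om] where a representative is not positive. *)
Lemma positive_representative u : in_W0 s p Om u -> {ae mu, forall x, Om x -> 0 < u x} ->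
  exists u', represents u' u /\ forall x, Om x -> 0 < u' x.
Proof.
move=> uW u0; have [u1 r1] := in_W0_represents oOm p1 uW.
have [[m1 z1 _ _] uu1] := r1.
pose B := Om `&` u1 @^-1` `]-oo, 0].
have mB : measurable B.
  by apply: measurableI => //; rewrite -[X in measurable X]setTI; exact: m1.
pose u' x := u1 x * \1_(~` B) x + \1_B x.
have uB x : B x -> u' x = 1.
  move=> Bx; rewrite /u' !indicE (mem_set Bx) memNset ?mulr0 ?add0r//.
have uN x : ~ B x -> u' x = u1 x.
  by move=> nB; rewrite /u' !indicE (memNset nB) mem_set// mulr1 addr0.
have mi C : measurable C -> measurable_fun setT (\1_C : T -> R).
  by move=> mC; exact: (@measurable_indic _ _ R setT C mC).
exists u'; split; last first.
  move=> x Ox; have [Bx|nB] := pselect (B x); first by rewrite uB// ltr01.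
  rewrite uN// ltNge; apply/negP => h; apply: nB; split=> //=.
apply: (represents_change p1 r1).
- apply: measurable_funD; last exact: mi.
  by apply: measurable_funM => //; apply: mi; exact: measurableC.
- by move=> x nO; rewrite uN ?z1// => -[].
- apply: filterS2 uu1 u0 => x ux upos; rewrite uN// => -[Ox /=].
  by rewrite in_itv/= -ux leNgt upos.
Qed.

Lemma weak_positive u : weak_solution s p Om f u ->
  exists2 u', positive_solution u' & {ae mu, forall x, u x = u' x}.
Proof.
move=> [uW u0 hu]; have [u' [ru upos]] := positive_representative uW u0.
have [Wu' uu'] := ru; exists u' => //; split=> // phi Wphi.
have rphi := represents_refl Wphi.
have [[_ fin] E] := hu phi (represents_in_W0 p1 rphi).
have [mu' _ _ _] := Wu'; have [mphi _ _ _] := Wphi.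
have mG : measurable_fun setT (fun x => g x (u' x) * phi x).
  by apply: measurable_funM => //; exact: (measurable_reaction hg).
have iG : mu.-integrable setT (EFin \o (fun x => g x (u' x) * phi x)).
  apply/integrableP; split; first exact/measurable_EFinP.
  have := reaction_integral_eq (H := fun t => `|t|%:E) _ ru rphi upos.
  by rewrite normr0 => /(_ erefl) <-.
split=> //; apply: EFin_inj; rewrite -[RHS](EFin_Rintegral iG).
apply: etrans (esym (fracplapE p1 ru rphi)) _.
by rewrite E (reaction_integral_eq (H := EFin) _ ru rphi).
Qed.

Lemma positive_weak u : positive_solution u -> weak_solution s p Om f u.
Proof.
move=> [Wu upos hu]; have ru := represents_refl Wu.
split; [exact: (represents_in_W0 p1 ru)|exact: aeW|].
move=> phi phiW; have [phi' rphi] := in_W0_represents oOm p1 phiW.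
have [Wphi pp'] := rphi; have [iG EG] := hu phi' Wphi.
split; last first.
  rewrite (fracplapE p1 ru rphi) EG (reaction_integral_eq (H := EFin) _ ru rphi)//.
  by rewrite EFin_Rintegral.
split.
  exists (fun x => g x (u x) * phi' x).
    by apply: measurable_funTS; exact: (integrable_measurable iG).
  apply: filterS2 pp' OA => x -> Ax Ox; rewrite gf//; first exact: Ax.
  by rewrite ltW ?upos.
rewrite (reaction_integral_eq (H := fun t => `|t|%:E) _ ru rphi)// ?normr0//.
by have /integrableP[_] := iG.
Qed.

End weak_solutions.

Section weighted_split.
Local Open Scope ereal_scope.
Context d (T : measurableType d) (R : realType) (m : {measure set T -> \bar R}).
Variables (a : T -> \bar R) (w : T -> R) (C : R).
Hypothesis ma : measurable_fun setT a.
Hypothesis iw : m.-integrable setT (EFin \o w).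
Hypothesis w0 : forall x, (0 <= w x)%R.
Hypothesis C0 : (0 <= C)%R.

Let mw : measurable_fun setT (fun x => (w x)%:E). Proof. exact: measurable_int iw. Qed.
Let iCw : m.-integrable setT (EFin \o (fun x => C * w x)%R). Proof. exact: integrable_mulRl. Qed.
Let Cw0 x : 0 <= (C * w x)%:E. Proof. by rewrite lee_fin mulr_ge0. Qed.

(** Separates a weight that may be -oo into a finite term and a nonnegative integral that may be
    +oo. *)
Lemma weighted_integral_upper : (forall x, a x <= C%:E) ->
  \int[m]_x (a x * (w x)%:E) = (C * \int[m]_x w x)%:E - \int[m]_x ((C%:E - a x) * (w x)%:E).
Proof.
move=> aC.
have mF : measurable_fun setT (fun x => (C%:E - a x) * (w x)%:E).
  by apply: emeasurable_funM => //; exact: emeasurable_funB.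
have F0 x : 0 <= (C%:E - a x) * (w x)%:E by rewrite mule_ge0 ?lee_fin// sube_ge0 ?orbT.
rewrite -RintegralZT// -(EFin_Rintegral iCw) -integralNB_ge0//.
apply: eq_integral => x _; have := aC x; have := w0 x.
case: (a x) => [r||] // wx _.
  by rewrite -?EFinB -!EFinM -?EFinB; congr EFin; ring.
(* The remaining case is a weight -oo: at zeros of [w] both sides are 0, elsewhere both are -oo. *)
have [->|wn0] := eqVneq (w x) 0%R; first by rewrite mulr0 !mule0 sube0.
have wp : (0 < w x)%R by rewrite lt_neqAle eq_sym wn0.
rewrite (_ : C%:E - -oo = +oo)// mulNyr mulyr gtr0_sg// !mul1e.
by [].
Qed.

Lemma weighted_integral_lower : (forall x, 0 <= a x + C%:E) ->
  \int[m]_x (a x * (w x)%:E) = \int[m]_x ((a x + C%:E) * (w x)%:E) - (C * \int[m]_x w x)%:E.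
Proof.
move=> aC.
have mF : measurable_fun setT (fun x => (a x + C%:E) * (w x)%:E).
  by apply: emeasurable_funM => //; exact: emeasurable_funD.
have F0 x : 0 <= (a x + C%:E) * (w x)%:E by rewrite mule_ge0 ?lee_fin.
rewrite -RintegralZT// -(EFin_Rintegral iCw) -integralB_ge0//.
apply: eq_integral => x _; have := aC x; have := w0 x.
case: (a x) => [r||] // wx _.
  by rewrite -?EFinD -!EFinM -?EFinB; congr EFin; ring.
have [->|wn0] := eqVneq (w x) 0%R; first by rewrite mulr0 !mule0 sube0.
have wp : (0 < w x)%R by rewrite lt_neqAle eq_sym wn0.
by rewrite (_ : +oo + C%:E = +oo)// mulyr gtr0_sg// mul1e.
Qed.

End weighted_split.

Lemma ereal_gap {R : realDomainType} (E L C dl : R) (I : \bar R) : (0 <= I)%E ->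
  (((C + dl) * L)%:E <= E%:E + I)%E -> ((dl * L)%:E <= E%:E - ((C * L)%:E - I))%E.
Proof.
case: I => [r||]//; rewrite -?EFinD -?EFinB ?lee_fin.
  by move=> _; rewrite mulrDl => h; lra.
by move=> _ _; rewrite /= leey.
Qed.

Lemma ereal_lt_upper {R : realDomainType} (E L C : R) (I : \bar R) : (0 <= I)%E ->
  ((C * L)%:E - I < E%:E)%E -> ((C * L)%:E < E%:E + I)%E.
Proof.
case: I => [r||]//; rewrite -?EFinD -?EFinB ?lte_fin.
  by move=> _ h; lra.
by move=> _ _; rewrite /= ltry.
Qed.

Lemma ereal_lt_lower {R : realDomainType} (E L C : R) (I : \bar R) :
  (E%:E < I - (C * L)%:E)%E -> ((E + C * L)%:E < I)%E.
Proof.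
case: I => [r||]//; rewrite -?EFinD -?EFinB ?lte_fin ?ltry//.
by move=> h; lra.
Qed.

Section limits_of_quotient.
Context d (T : measurableType d) (R : realType).
Variables (p c0 : R) (f g : T -> R -> R) (x : T).
Hypothesis hg : reaction p c0 g.
Hypothesis gf : forall t, 0 <= t -> g x t = f x t.

Lemma lim_quotient0 : lim ((f x t / t `^ (p - 1))%:E @[t --> 0^'+]) = quotient_sup p g x.
Proof.
apply: cvg_lim => //; apply: (@cvg_trans _ ((quotient p g x t)%:E @[t --> 0^'+])); last first.
  exact: (cvg_quotient_sup hg).
apply: near_eq_cvg; near=> t.
have t0 : 0 < t by near: t; exact: nbhs_right_gt.
by rewrite /quotient (gf (ltW t0)).
Unshelve. all: by end_near. Qed.

Lemma lim_quotient_pinfty : lim ((f x t / t `^ (p - 1))%:E @[t --> +oo]) = quotient_inf p g x.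
Proof.
apply: cvg_lim => //; apply: (@cvg_trans _ ((quotient p g x t)%:E @[t --> +oo])); last first.
  exact: (cvg_quotient_inf hg).
apply: near_eq_cvg; near=> t.
have t0 : 0 <= t by near: t; exact: nbhs_pinfty_ge.
by rewrite /quotient (gf t0).
Unshelve. all: by end_near. Qed.

End limits_of_quotient.

(** * Uniqueness and the existence criterion *)

Section brezis_oswald.
Context {R : realType} (n : nat).
Local Notation T := 'rV[R]_n.
Local Notation mu := (@lebesgue_rV R n).
Variables (Om A : set T) (s p c0 : R) (f g : T -> R -> R).
Hypothesis n0 : (0 < n)%N.
Hypothesis oOm : open Om.
Hypothesis bOm : bounded_set Om.
Hypothesis Om0 : Om !=set0.
Hypothesis p1 : 1 < p.
Hypothesis s0 : 0 < s.
Hypothesis s1 : s < 1.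
Hypothesis c00 : 0 < c0.
Hypothesis OA : {ae mu, forall x, Om x -> A x}.
Hypothesis hg : reaction p c0 g.
Hypothesis gf : forall x t, A x -> 0 <= t -> g x t = f x t.
Local Notation k := (@gagliardo_weight R n s p).
Local Notation W := (energy_space mu Om k p).
Local Notation positive_solution := (positive_solution mu Om k p g).
Local Notation asup := (quotient_sup p g).
Local Notation ainf := (quotient_inf p g).
Local Notation nonzero := [set v | W v /\ ~ {ae mu, forall x, v x = 0%R}].
Implicit Types (u v : T -> R).

Let mOm : measurable Om. Proof. exact: open_measurable_rV. Qed.
Let fOm : (mu Om < +oo)%E. Proof. exact: bounded_lebesgue_lty. Qed.
Let muOm0 : mu Om != 0%E. Proof. exact: open_lebesgue_gt0. Qed.
Let mk : measurable_fun setT k. Proof. exact: measurable_gagliardo_weight. Qed.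
Let k0 z : 0 <= k z. Proof. exact: gagliardo_weight_ge0. Qed.
Let cpt : compact_embedding mu Om k p. Proof. exact: gagliardo_compact. Qed.
Let C0 : 0 <= 2 * c0. Proof. by rewrite mulr_ge0// ltW. Qed.

Lemma quotient_inf_le x : (ainf x < (2 * c0)%:E)%E.
Proof.
apply: (lt_le_trans (quotient_inf_lt hg x ltr01)).
by rewrite lee_fin; exact: (quotient_le2 hg x 0).
Qed.

Lemma upper_excess_ge0 v : (0 <= \int[mu]_x (((2 * c0)%:E - ainf x) * (`|v x| `^ p)%:E))%E.
Proof.
apply: integral_ge0 => x _; rewrite mule_ge0 ?lee_fin ?powR_ge0// sube_ge0 ?orbT//.
exact: ltW (quotient_inf_le x).
Qed.

Lemma quotient_inf_integral v : W v -> (\int[mu]_x (ainf x * (`|v x| `^ p)%:E) =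
  (2 * c0 * \int[mu]_x (`|v x| `^ p))%:E -
    \int[mu]_x (((2 * c0)%:E - ainf x) * (`|v x| `^ p)%:E))%E.
Proof.
move=> [_ _ iv _]; apply: weighted_integral_upper => //.
- exact: (measurable_quotient_inf hg).
- by move=> x; apply: ltW; exact: quotient_inf_le.
Qed.

Lemma quotient_sup_integral (C : R) v : 0 <= C -> (forall x, 0 <= asup x + C%:E)%E -> W v ->
  (\int[mu]_x (asup x * (`|v x| `^ p)%:E) =
  \int[mu]_x ((asup x + C%:E) * (`|v x| `^ p)%:E) - (C * \int[mu]_x (`|v x| `^ p))%:E)%E.
Proof.
move=> C0' aC [_ _ iv _]; apply: weighted_integral_lower => //.
exact: (measurable_quotient_sup hg).
Qed.

Lemma positive_solution_neq0 u : positive_solution u -> ~ {ae mu, forall x, u x = 0}.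
Proof.
move=> [_ upos _] [Z [mZ Z0 sZ]]; have : (mu Om <= mu Z)%E.
  apply: le_measure; rewrite ?inE// => x Ox; apply: sZ => /= ux.
  by have := upos x Ox; rewrite ux ltxx.
by apply/negP; rewrite -ltNge Z0 lt_neqAle eq_sym muOm0 measure_ge0.
Qed.

Lemma necessary : (exists u, positive_solution u) ->
  (ereal_inf [set rayleigh s p asup v | v in nonzero] < 0)%E /\
  (0 < ereal_inf [set rayleigh s p ainf v | v in nonzero])%E.
Proof.
move=> [u su]; have u0 := positive_solution_neq0 su; have [Wu _ _] := su; split.
  apply: (@le_lt_trans _ _ (rayleigh s p asup u)).
    by apply: ereal_inf_lbound; exists u.
  rewrite (rayleigh_lt0 _ Wu u0).
  have := lambda_zero_necessary p1 mOm su muOm0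
    (measurable_funTS (measurable_quotient_sup hg)) (fun x t _ t0 => quotient_lt_sup hg x t0).
  move=> /lt_le_trans; apply; rewrite integral_mkcond le_eqVlt; apply/orP; left; apply/eqP.
  apply: eq_integral => x _; rewrite /patch; case: ifPn => //.
  rewrite notin_setE => nO; have [_ uz _ _] := Wu.
  by rewrite (uz x nO) normr0 powR0 ?mule0// gt_eqF// (lt_trans ltr01).
have [dl dl0 hdl] := lambda_infty_necessary p1 c00 mOm fOm mk k0 hg su cpt C0
  (measurable_quotient_inf hg) (fun x t t0 => quotient_inf_lt hg x t0) quotient_inf_le.
apply: (@lt_le_trans _ _ dl%:E); first by rewrite lte_fin.
apply: le_ereal_inf_tmp => _ [v [Wv v0] <-]; apply: (rayleigh_ge Wv v0).
rewrite quotient_inf_integral//; apply: ereal_gap; first exact: upper_excess_ge0.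
exact: hdl.
Qed.

Lemma sufficient :
  (ereal_inf [set rayleigh s p asup v | v in nonzero] < 0)%E ->
  (0 < ereal_inf [set rayleigh s p ainf v | v in nonzero])%E ->
  exists u, positive_solution u.
Proof.
move=> /ereal_inf_lt[_ [v [Wv v0] <-]]; rewrite (rayleigh_lt0 _ Wv v0) => hv hinf.
(* The lower bound of the quotient on (0,1] bounds its supremum from below, so the shifted weight is
   nonnegative. *)
have [C1 C10 hC1] := quotient_ge hg 0.
have supC x : (0 <= asup x + C1%:E)%E.
  apply: (@le_trans _ _ ((quotient p g x 1)%:E + C1%:E)%E).
    by rewrite -EFinD lee_fin -lerBlDr sub0r hC1.
  by rewrite leeD2r// ltW// (quotient_lt_sup hg).
rewrite (quotient_sup_integral C10)// in hv.
apply: (existence p1 c00 mOm fOm mk k0 hg (a0 := asup) (ainf := ainf) (C1 := C1) (v := v)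
  (psi := bump Om) (M := 1) cpt) => //.
- by move=> z; exact: gagliardo_weight_gt0.
- exact: energy_space_bump.
- by move=> x; exact: bump_itv.
- by move=> x; exact: bump_gt0.
- by move=> x; apply: ltW; exact: (quotient_inf_lt hg).
- exact: (measurable_quotient_inf hg).
- by move=> x _; exact: (cvg_quotient_inf_seq hg).
- move=> w Ww w0; apply: ereal_lt_upper; first exact: upper_excess_ge0.
  rewrite -quotient_inf_integral// -(rayleigh_gt0 _ Ww w0); apply: lt_le_trans hinf _.
  by apply: ereal_inf_lbound; exists w.
- exact: (measurable_quotient_sup hg).
- by move=> x t _; exact: (cvg_quotient_sup_seq hg).
- exact: ereal_lt_lower hv.
Qed.

Lemma lambda1_a_zero : lambda1 s p Om (a_zero p f) =
  ereal_inf [set rayleigh s p asup v | v in nonzero].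
Proof.
apply: lambda1E => //; apply: filterS OA => x Ax Ox.
by apply: (lim_quotient0 hg) => t t0; apply: gf => //; exact: Ax.
Qed.

Lemma lambda1_a_infty : lambda1 s p Om (a_infty p f) =
  ereal_inf [set rayleigh s p ainf v | v in nonzero].
Proof.
apply: lambda1E => //; apply: filterS OA => x Ax Ox.
by apply: (lim_quotient_pinfty hg) => t t0; apply: gf => //; exact: Ax.
Qed.

Lemma weak_unique u v : weak_solution s p Om f u -> weak_solution s p Om f v ->
  {ae mu, forall x, u x = v x}.
Proof.
move=> /(weak_positive oOm p1 OA hg gf)[u' su uu'] /(weak_positive oOm p1 OA hg gf)[v' sv vv'].
have uv' := uniqueness p1 c00 mOm fOm mk k0 hg su sv.
by apply: filterS3 uu' vv' uv' => x -> -> ->.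
Qed.

Lemma weak_exists : (exists u, weak_solution s p Om f u) <->
  (lambda1 s p Om (a_zero p f) < 0)%E /\ (0 < lambda1 s p Om (a_infty p f))%E.
Proof.
rewrite lambda1_a_zero lambda1_a_infty; split.
  move=> [u /(weak_positive oOm p1 OA hg gf)[u' su _]].
  by apply: necessary; exists u'.
move=> [h1 h2]; have [u su] := sufficient h1 h2.
by exists u; exact: (positive_weak oOm p1 OA gf su).
Qed.

End brezis_oswald.

Theorem theorem1p3 (R : realType) (N : nat) (Omega : set 'rV[R]_N) (p s : R)
    (f : 'rV[R]_N -> R -> R)
    (hN : (2 <= N)%N) (hOmega : bounded_C11_domain Omega)
    (hp : 1 < p) (hs0 : 0 < s) (hs1 : s < 1)
    (hf : Caratheodory Omega f)
    (hf1 : forall t, 0 <= t -> in_Lp Omega +oo%E (fun x => f x t))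
    (hf2 : exists2 c0 : R, 0 < c0 &
       {ae lebesgue_rV N, forall x, Omega x ->
          forall t, 0 <= t -> f x t <= c0 * (1 + t `^ (p - 1))})
    (hf3 : {ae lebesgue_rV N, forall x, Omega x ->
       forall t1 t2, 0 < t1 -> t1 < t2 ->
         f x t2 / t2 `^ (p - 1) < f x t1 / t1 `^ (p - 1)}) :
  (forall u v : 'rV[R]_N -> R,
     weak_solution s p Omega f u -> weak_solution s p Omega f v ->
     {ae lebesgue_rV N, forall x, u x = v x}) /\
  ((exists u : 'rV[R]_N -> R, weak_solution s p Omega f u) <->
   (lambda1 s p Omega (a_zero p f) < 0)%E /\
   (0 < lambda1 s p Omega (a_infty p f))%E).
Proof.
have [Om0 oOm _ bOm _] := hOmega; have [c0 c00 hle] := hf2.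
have [A [g [_ OA hg gf]]] :=
  regular_reaction hp c00 (open_measurable_rV oOm) hf hf1 hle hf3.
split; first by move=> u v; exact: (weak_unique oOm bOm hp c00 OA hg gf).
exact: (weak_exists (ltnW hN) oOm bOm Om0 hp hs0 hs1 c00 OA hg gf).
Qed.
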